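(* Let $n\ge3$ and $-\frac n2<\delta<\frac n2-2$. Then the null space of the stability operator $L=\Delta_{\underline{\mathcal C}}+|\mathrm{II}|^2$ of the Riemannian catenoid $\underline{\mathcal C}\subset\mathbb R^{n+1}$, acting on $H^{0,\delta}(\underline{\mathcal C})$ (i.e. the set of $u\in H^{0,\delta}(\underline{\mathcal C})$ with $Lu=0$ in the sense of distributions), is spanned by the $n$ functions $$\nu^j=\frac{\Theta^j(\omega)}{\langle\rho\rangle^{n-1}},\qquad j=1,\dots,n.$$
   Context: $\langle\rho\rangle=\sqrt{1+\rho^2}$, and $\Theta=(\Theta^1,\dots,\Theta^n):\mathbb S^{n-1}\to\mathbb R^n$ is the standard embedding of the unit sphere. The Riemannian catenoid $\underline{\mathcal C}\subset\mathbb R^{n+1}$ is the minimal hypersurface of revolution diffeomorphic to $\mathbb R\times\mathbb S^{n-1}$ with coordinates $(\rho,\omega)$, in which its induced metric is $\frac{\rho^2\langle\rho\rangle^{2(n-2)}}{\langle\rho\rangle^{2(n-1)}-1}\,d\rho^2+\langle\rho\rangle^2\mathring g_{\mathbb S^{n-1}}$. Its second fundamental form satisfies $|\mathrm{II}|^2=n(n-1)\langle\rho\rangle^{-2n}$. The space $H^{0,\delta}(\underline{\mathcal C})$ has norm $\|f\|_{H^{0,\delta}}^2=\int_{\underline{\mathcal C}}\langle\rho\rangle^{2\delta}|f|^2\,d\mathrm{Vol}$. *)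

(* Defs.v *)
From HB Require Import structures.
From mathcomp Require Import all_boot all_order all_algebra.
From mathcomp Require Import all_classical all_reals all_analysis.
From mathcomp Require Import ring.
Set Implicit Arguments.
Unset Strict Implicit.
Unset Printing Implicit Defensive.
Import Order.TTheory GRing.Theory Num.Theory.
Import numFieldNormedType.Exports.
Local Open Scope classical_set_scope.
Local Open Scope ring_scope.


Section LebesgueTuple.
Variable R : realType.
Local Notation Rm := (measurableTypeR R).

Definition cons_pair n (p : Rm * n.-tuple Rm) : n.+1.-tuple Rm :=
  [tuple of p.1 :: p.2].

Lemma measurable_cons_pair n : measurable_fun setT (@cons_pair n).
Proof. by apply: measurable_cons. Qed.

Section succ.
Variables (n : nat) (mu : {sigma_finite_measure set (n.-tuple Rm) -> \bar R}).

Definition lebesgue_succ : set (n.+1.-tuple Rm) -> \bar R :=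
  pushforward (@lebesgue_measure R \x mu)%E (@cons_pair n).

Let lebesgue_succ0 : lebesgue_succ set0 = 0%E.
Proof. by rewrite /lebesgue_succ /pushforward preimage_set0 measure0. Qed.

Let lebesgue_succ_ge0 A : (0 <= lebesgue_succ A)%E.
Proof. by rewrite /lebesgue_succ /pushforward measure_ge0. Qed.

Let lebesgue_succ_sigma_additive : semi_sigma_additive lebesgue_succ.
Proof.
move=> F mF tF mUF; rewrite /lebesgue_succ /pushforward preimage_bigcup.
have mpre A : measurable A -> measurable (@cons_pair n @^-1` A).
  by move=> mA; rewrite -[X in measurable X]setTI; exact: measurable_cons_pair.
apply: measure_semi_sigma_additive.
- by move=> k; exact: mpre.
- apply/trivIsetP => /= i j _ _ ij; rewrite -preimage_setI.
  by move/trivIsetP : tF => /(_ _ _ _ _ ij) ->//; rewrite preimage_set0.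
- by rewrite -preimage_bigcup; exact: mpre.
Qed.

HB.instance Definition _ := isMeasure.Build _ _ _ lebesgue_succ
  lebesgue_succ0 lebesgue_succ_ge0 lebesgue_succ_sigma_additive.

Let lebesgue_succ_sigma_finite : sigma_finite setT lebesgue_succ.
Proof.
have /sigma_finiteP[F [TF ndF Foo]] :=
  sigma_finiteT (@lebesgue_measure R : {sigma_finite_measure set _ -> \bar R}).
have /sigma_finiteP[G [TG ndG Goo]] := sigma_finiteT mu.
pose uncons (t : n.+1.-tuple Rm) : Rm * n.-tuple Rm :=
  (thead t, [tuple of behead t]).
have muncons : measurable_fun setT uncons.
  apply: measurable_fun_pair; last exact: measurable_behead.
  exact: measurable_tnth.
exists (fun k => uncons @^-1` (F k `*` G k)).
  apply/seteqP; split=> // t _.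
  have : setT (uncons t).1 by []. 
  have : setT (uncons t).2 by [].
  rewrite TF TG => -[i _ Gi] [j _ Fj]; exists (maxn i j) => //; split.
  - by move: Fj; exact/subsetPset/ndF/leq_maxr.
  - by move: Gi; exact/subsetPset/ndG/leq_maxl.
move=> k; have [mFk Fk] := Foo k; have [mGk Gk] := Goo k; split.
  by rewrite -[X in measurable X]setTI; apply: muncons => //; exact: measurableX.
rewrite /lebesgue_succ /pushforward -comp_preimage.
have -> : uncons \o @cons_pair n = id.
  by apply/funext => -[x t]; congr pair; exact: val_inj.
by rewrite preimage_id product_measure1E// lte_mul_pinfty// ge0_fin_numE.
Qed.

HB.instance Definition _ := Measure_isSigmaFinite.Build _ _ _ lebesgue_succ
  lebesgue_succ_sigma_finite.
End succ.

(* n-dimensional Lebesgue measure on the Borel sets of R^n, where R^n is taken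
   with the product sigma-algebra carried by [n.-tuple]. *)
Fixpoint lebesgue_tuple n : {sigma_finite_measure set (n.-tuple Rm) -> \bar R} :=
  if n is k.+1 then lebesgue_succ (lebesgue_tuple k) else \d_([tuple]).

Lemma lebesgue_tuple_box n (A : 'I_n -> set Rm) :
  (forall i, measurable (A i)) ->
  lebesgue_tuple n [set t | forall i, A i (tnth t i)] =
  (\prod_i @lebesgue_measure R (A i))%E.
Proof.
elim: n A => [|n IH] A mA.
  rewrite big_ord0 /= [LHS]diracE (_ : _ \in _ = true)//.
  by apply/mem_set => -[].
have mbox : measurable
    [set t : n.-tuple Rm | forall i, A (lift ord0 i) (tnth t i)].
  rewrite (_ : mkset _ = \bigcap_(i in setT)
    ((@tnth n Rm ^~ i) @^-1` A (lift ord0 i))); last first.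
    by apply/seteqP; split=> [t At i _|t At i]; [exact: At|exact: (At i)].
  apply: fin_bigcap_measurable => // i _.
  by rewrite -[X in measurable X]setTI; exact: measurable_tnth.
rewrite big_ord_recl -IH// -product_measure1E//.
change (lebesgue_succ (lebesgue_tuple n) [set t | forall i, A i (tnth t i)] =
  (@lebesgue_measure R \x lebesgue_tuple n)%E
    (A ord0 `*` [set t | forall i, A (lift ord0 i) (tnth t i)])).
rewrite /lebesgue_succ /pushforward; congr (_ _).
apply/seteqP; split=> -[x t] /=.
  move=> At; split=> [|i]; first exact: (At ord0).
  by have := At (lift ord0 i); rewrite tnthS.
move=> [Ax At] i; case: (unliftP ord0 i) => [j ->|->//].
by rewrite tnthS.
Qed.

End LebesgueTuple.

Section Calculus.
Variable R : realType.

Definition dot m (v w : 'rV[R]_m) : R := \sum_i v 0 i * w 0 i.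

Definition partial m (V : normedModType R) (i : 'I_m) (f : 'rV[R]_m -> V)
    (x : 'rV[R]_m) : V :=
  'D_(delta_mx 0 i) f x.

(* C^infinity: all iterated partial derivatives exist and are differentiable. *)
Definition smooth m (f : 'rV[R]_m -> R) : Prop :=
  forall (s : seq 'I_m) (x : 'rV[R]_m),
    differentiable (foldr (@partial m R^o) f s) x.

End Calculus.

(* Geometry induced on R^m by an immersion X into R^k. *)
Section Hypersurface.
Variables (R : realType) (m k : nat) (X : 'rV[R]_m -> 'rV[R]_k).
Implicit Types x : 'rV[R]_m.

Definition metric x : 'M[R]_m :=
  \matrix_(i, j) dot (partial i X x) (partial j X x).

Definition volume_density x : R := Num.sqrt (\det (metric x)).

(* |g|^(-1/2) \sum_(i, j) d_i (|g|^(1/2) g^(ij) d_j f) *)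
Definition laplace_beltrami (f : 'rV[R]_m -> R) x : R :=
  (volume_density x)^-1 *
  \sum_i partial (V := R^o) i
    (fun z => \sum_j volume_density z * invmx (metric z) i j *
                     partial (V := R^o) j f z) x.

(* For k = m + 1 the unit normal is unique up to a sign, on which
   [sqnorm_second_form] does not depend. *)
Definition unit_normal x : 'rV[R]_k :=
  xget 0 [set v | dot v v = 1 /\ forall i, dot v (partial i X x) = 0].

Definition second_form x : 'M[R]_m :=
  \matrix_(i, j) dot (partial i (partial j X) x) (unit_normal x).

(* g^(ik) g^(jl) II_ij II_kl *)
Definition sqnorm_second_form x : R :=
  let S := invmx (metric x) *m second_form x in \tr (S *m S).

Definition stability_operator (f : 'rV[R]_m -> R) x : R :=
  laplace_beltrami f x + sqnorm_second_form x * f x.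

End Hypersurface.

Section Catenoid.
Variable R : realType.

Definition jbracket (rho : R) : R := Num.sqrt (1 + rho ^+ 2).

(* dz/drho along the profile curve (r, z) = (<rho>, z(rho)). It equals
   |rho| / (<rho> sqrt (<rho>^(2(n-1)) - 1)) for rho != 0, that is,
   dr/dz = +- sqrt (r^(2(n-1)) - 1); the geometric sum removes the apparent
   singularity at rho = 0. *)
Definition profile_slope (n : nat) (rho : R) : R :=
  (jbracket rho * Num.sqrt (\sum_(k < n.-1) jbracket rho ^+ (2 * k)))^-1.

Definition profile_height (n : nat) (rho : R) : R :=
  Num.sg rho *
  Rintegral (@lebesgue_measure R) `[0, `|rho| ] (profile_slope n).

(* The catenoid in R^(n+1) as the image of R x S^(n-1), with axis along the
   last coordinate. *)
Definition catenoid n (rho : R) (omega : 'rV[R]_n) : 'rV[R]_(n + 1) :=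
  row_mx (jbracket rho *: omega) (profile_height n rho)%:M.

(* A point x of R^n encodes rho = x_0 and the stereographic coordinates
   (x_1, ..., x_(n-1)) on S^(n-1) minus the point e_0. *)
Definition rho_of n (x : 'rV[R]_n) : R := \sum_(i < n | val i == 0%N) x 0 i.

Definition omega_of n (x : 'rV[R]_n) : 'rV[R]_n :=
  let y2 := \sum_(i < n | val i != 0%N) x 0 i ^+ 2 in
  \row_i ((if val i == 0%N then y2 - 1 else 2 * x 0 i) / (y2 + 1)).

(* Functions on the catenoid are functions of (rho, omega), of which only the
   values at unit vectors omega matter. *)
Definition in_chart n (f : R -> 'rV[R]_n -> R) (x : 'rV[R]_n) : R :=
  f (rho_of x) (omega_of x).

Definition catenoid_chart n (x : 'rV[R]_n) : 'rV[R]_(n + 1) :=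
  catenoid (rho_of x) (omega_of x).

Definition row_of_tuple n (t : n.-tuple (measurableTypeR R)) : 'rV[R]_n :=
  \row_i (tnth t i : R).

(* The chart misses only the null set R x {e_0}, so it suffices for
   measurability up to null sets, for integrals and for a.e. statements. *)
Definition catenoid_measurable n (u : R -> 'rV[R]_n -> R) : Prop :=
  measurable_fun [set: n.-tuple (measurableTypeR R)]
    (fun t => in_chart u (row_of_tuple t)).

Definition catenoid_ae_eq n (u v : R -> 'rV[R]_n -> R) : Prop :=
  {ae @lebesgue_tuple R n, forall t,
    in_chart u (row_of_tuple t) = in_chart v (row_of_tuple t)}.

(* Integral over the catenoid of a function given in the chart. *)
Definition catenoid_integral n (F : 'rV[R]_n -> R) : \bar R :=
  (\int[@lebesgue_tuple R n]_t
    (F (row_of_tuple t) *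
     volume_density (@catenoid_chart n) (row_of_tuple t))%:E)%E.

Definition in_H0 n (delta : R) (u : R -> 'rV[R]_n -> R) : Prop :=
  catenoid_measurable u /\
  (catenoid_integral (fun x : 'rV[R]_n =>
     (jbracket (rho_of x) `^ (2 * delta) * in_chart u x ^+ 2)%R) < +oo)%E.

(* Smooth functions on R x S^(n-1) are the restrictions of smooth functions on
   R x R^n. *)
Definition test_function n (phi : R -> 'rV[R]_n -> R) : Prop :=
  smooth (fun p : 'rV[R]_(1 + n) => phi (lsubmx p 0 0) (rsubmx p)) /\
  exists B : R, forall rho omega, dot omega omega = 1 -> B < `|rho| ->
    phi rho omega = 0.

(* L u = 0 in the sense of distributions; L is formally self-adjoint. *)
Definition weak_jacobi n (u : R -> 'rV[R]_n -> R) : Prop :=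
  forall phi : R -> 'rV[R]_n -> R, test_function phi ->
    catenoid_integral (fun x : 'rV[R]_n =>
      in_chart u x *
      stability_operator (@catenoid_chart n) (in_chart phi) x) = 0%E.

Definition null_space n (delta : R) (u : R -> 'rV[R]_n -> R) : Prop :=
  in_H0 delta u /\ weak_jacobi u.

Definition nu n (j : 'I_n) (rho : R) (omega : 'rV[R]_n) : R :=
  omega 0 j / jbracket rho ^+ n.-1.

End Catenoid.

(* (d<rho>/drho)^2 + (dz/drho)^2 is the coefficient of drho^2 in the induced
   metric. *)
Lemma profile_speed (R : realType) (n : nat) (rho : R) :
  (3 <= n)%N -> rho != 0 ->
  (rho / jbracket rho) ^+ 2 + profile_slope n rho ^+ 2 =
  rho ^+ 2 * jbracket rho ^+ (2 * (n - 2)) /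
    (jbracket rho ^+ (2 * (n - 1)) - 1).
Proof.
case: n => [|[|[|n]]]// _ rho0; rewrite /profile_slope !subSS !subn0 /=.
have J0 : 0 < 1 + rho ^+ 2 by rewrite ltr_pwDl// sqr_ge0.
have jE k : jbracket rho ^+ (2 * k) = (1 + rho ^+ 2) ^+ k.
  by rewrite exprM sqr_sqrtr// ltW.
under eq_bigr do rewrite jE.
set S := \sum_(_ < _) _.
have S0 : 0 < S.
  rewrite /S big_ord_recl expr0 ltr_pwDl// sumr_ge0// => i _.
  by rewrite exprn_ge0// ltW.
have geomS : (1 + rho ^+ 2) ^+ n.+2 - 1 = rho ^+ 2 * S.
  by rewrite subrX1 -/S addrAC subrr add0r.
rewrite !jE geomS exprVn !exprMn exprVn (sqr_sqrtr (ltW S0)).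
have -> : jbracket rho ^+ 2 = 1 + rho ^+ 2 by exact: sqr_sqrtr (ltW J0).
have JS : (1 + rho ^+ 2) ^+ n.+1 * (1 + rho ^+ 2) = rho ^+ 2 * S + 1.
  by rewrite -exprSr -geomS subrK.
apply: (@mulIf _ ((1 + rho ^+ 2) * S)); first by rewrite mulf_neq0// gt_eqF.
rewrite mulrDl [X in _ + X](_ : _ = 1); last first.
  by rewrite mulVf// mulf_neq0// gt_eqF.
have -> : rho ^+ 2 / (1 + rho ^+ 2) * ((1 + rho ^+ 2) * S) = rho ^+ 2 * S.
  by rewrite mulrA divfK// gt_eqF.
rewrite -JS; field.
by rewrite rho0 gt_eqF.
Qed.

(* Main.v *)
(* In the stereographic chart, L multiplied by the volume density is in
   divergence form. Applied to a product a(rho) P_w(omega), with P_w a monomial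
   of degree d in omega, it gives sigma ((A a')' - K_d a) P_w plus terms in
   monomials of degree d - 2. Hence, if the integrals over the spheres of a null
   function against all monomials of degree < d vanish, its integral v(rho)
   against P_w satisfies (A v')' = K_d v weakly, hence classically. The function
   nu = <rho>^-(n-1) solves the equation with d = 1. For d >= 1 the quantity
   m = A (v' nu - v nu') satisfies (m v / nu)' = m^2 / (A nu^2) + (K_d - K_1) v^2,
   which is nonnegative, so |v| is bounded below near an end unless v is a
   multiple of nu, and zero if d > 1; for d = 0 explicit solutions give the same
   dichotomy with v = 0. A lower bound on |v| is excluded by the weighted L^2
   bound, as delta > - n / 2. So the moments of degree 1 are multiples of nu,
   and subtracting a combination of the nu^j, found by inverting the Gram matrix
   of the coordinates of the sphere, makes them vanish. By induction on the
   degree all moments of the difference vanish, and polynomials in omega suffice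
   to conclude that it is 0 almost everywhere. Conversely nu^j has finite norm
   because delta < n / 2 - 2, and it solves the equation weakly by Green's
   formula, whose boundary terms vanish by decay in the stereographic
   coordinates. *)

Require Import Defs.
From HB Require Import structures.
From mathcomp Require Import all_boot all_order all_algebra.
From mathcomp Require Import all_classical all_reals all_analysis.
From mathcomp Require Import measurable_realfun.
From mathcomp Require Import ring lra.
Set Implicit Arguments.
Unset Strict Implicit.
Unset Printing Implicit Defensive.
Import Order.TTheory GRing.Theory Num.Theory.
Import numFieldNormedType.Exports.
Local Open Scope classical_set_scope.
Local Open Scope ring_scope.

(** * Functions of class C^k *)

Section Derivation.
Context {R : realType} {V : normedModType R}.
Implicit Types (f g : V -> R) (x v : V).

(** Monomials in omega replace spherical harmonics, so that functions on the sphere need not be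
    decomposed; the price is the coupling to degree d - 2, which the induction absorbs. The
    comparison functions come from ambient motions: nu from translations orthogonal to the axis and,
    for d = 0, where K_0 - K_1 is negative and comparison with nu breaks down, the Jacobi fields of
    the translation along the axis and of dilations. What the L^2 bound says about a moment v is
    only that |v| >= c > 0 cannot hold near an end: 2 delta > -n and the volume growth <rho>^(n-1)
    leave a weight at least of order 1 / <rho>, whose integral diverges logarithmically. Growth of
    solutions is therefore proved in exactly this form, with no asymptotic expansion. The chart
    omits R x {e_0}, where test functions need not vanish. In the chart they are not compactly
    supported, which is why integration by parts has to be prepared by decay estimates. Null
    functions are only measurable, so identities between moments hold almost everywhere until the
    equation provides a smooth representative. *)

Lemma is_derive_addf f g x v (df dg : R) :
  is_derive x v f df -> is_derive x v g dg ->
  is_derive x v (fun y => f y + g y) (df + dg).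
Proof. by move=> hf hg; exact: (@is_deriveD _ _ _ f g). Qed.

Lemma is_derive_subf f g x v (df dg : R) :
  is_derive x v f df -> is_derive x v g dg ->
  is_derive x v (fun y => f y - g y) (df - dg).
Proof. by move=> hf hg; exact: (@is_deriveB _ _ _ f g). Qed.

Lemma is_derive_oppf f x v (df : R) :
  is_derive x v f df -> is_derive x v (fun y => - f y) (- df).
Proof. by move=> hf; exact: (@is_deriveN _ _ _ f). Qed.

Lemma is_derive_mulf f g x v (df dg : R) :
  is_derive x v f df -> is_derive x v g dg ->
  is_derive x v (fun y => f y * g y) (f x * dg + g x * df).
Proof. by move=> hf hg; exact: (@is_deriveM _ _ f g). Qed.

Lemma is_derive_scalef (c : R) f x v (df : R) :
  is_derive x v f df -> is_derive x v (fun y => c * f y) (c * df).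
Proof. by move=> hf; exact: (@is_deriveZ _ _ _ f c). Qed.

Lemma is_derive_expf f (n : nat) x v (df : R) :
  is_derive x v f df ->
  is_derive x v (fun y => f y ^+ n) (n%:R * f x ^+ n.-1 * df).
Proof. by move=> hf; have := @is_deriveX _ _ f n x v df hf; rewrite exprfctE. Qed.

Lemma is_derive_invf f x v (df : R) : f x != 0 ->
  is_derive x v f df -> is_derive x v (fun y => (f y)^-1) (- df / f x ^+ 2).
Proof.
move=> f0 hf; apply: DeriveDef; first exact: derivableV.
by rewrite deriveV// derive_val /GRing.scale/= mulNr mulrC mulNr.
Qed.

Lemma is_derive_sumf (I : Type) (r : seq I) (P : pred I) (F : I -> V -> R) x v
    (dF : I -> R) :
  (forall i, P i -> is_derive x v (F i) (dF i)) ->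
  is_derive x v (fun y => \sum_(i <- r | P i) F i y) (\sum_(i <- r | P i) dF i).
Proof.
move=> hF; elim: r => [|i r IH].
  rewrite big_nil; apply: (@is_derive_eq _ _ _ _ _ _ _ 0) => //.
  rewrite (_ : (fun _ => _) = cst 0); first exact: is_derive_cst.
  by apply/funext => y; rewrite big_nil.
rewrite big_cons; case: ifPn => Pi.
  rewrite (_ : (fun _ => _) =
      (fun y => F i y + \sum_(j <- r | P j) F j y)); last first.
    by apply/funext => y; rewrite big_cons Pi.
  by apply: is_derive_addf => //; exact: hF.
rewrite (_ : (fun _ => _) = (fun y => \sum_(j <- r | P j) F j y))//.
by apply/funext => y; rewrite big_cons (negbTE Pi).
Qed.

(** Restricting [f] to the line through [x] with direction [v] turns this into the one-variable
    chain rule, so [f] need only have a derivative in that one direction. *)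
Lemma is_derive_compf (a : R -> R) (da : R) f x v (df : R) :
  is_derive (f x) (1 : R) a da -> is_derive x v f df ->
  is_derive x v (fun y => a (f y)) (da * df).
Proof.
move=> ha hf.
have /derivable1P hf1 := @ex_derive _ _ _ _ _ _ _ hf.
have hf1' : is_derive (0 : R) (1 : R) (fun h : R => f (h *: v + x)) df.
  split; first exact: hf1.
  rewrite -[RHS](@derive_val _ _ _ _ _ _ _ hf) /derive.
  set g1 := fun h => h^-1 *: _; set g2 := fun h => h^-1 *: _.
  suff -> : g1 = g2 by [].
  apply/funext => h; rewrite /g1 /g2 /=.
  by rewrite addr0 scale0r add0r [_%:A]mulr1.
have ha' : is_derive (f (0 *: v + x)) (1 : R) a da.
  by rewrite scale0r add0r.
have hc := @is_derive1_comp _ _ _ _ _ _ ha' hf1'.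
have [hc1 hc2] := hc.
split; first exact/derivable1P.
rewrite -[RHS]hc2 /derive.
set g1 := fun h => h^-1 *: _; set g2 := fun h => h^-1 *: _.
suff -> : g1 = g2 by [].
apply/funext => h; rewrite /g1 /g2 /=.
by rewrite addr0 scale0r add0r [_%:A]mulr1.
Qed.

Lemma is_derive_sqrtf f x v (df : R) : 0 < f x ->
  is_derive x v f df ->
  is_derive x v (fun y => Num.sqrt (f y)) (df / (2 * Num.sqrt (f x))).
Proof.
move=> f0 hf; rewrite mulrC.
by apply: is_derive_compf; exact: is_derive1_sqrt.
Qed.

(* [D] is the set of directions in which one differentiates: the coordinate
   vectors of a space of rows, or [1] on the line. *)
Fixpoint Cn (D : set V) (k : nat) f : Prop :=
  continuous f /\
  if k is k'.+1 then
    (forall x, differentiable f x) /\ (forall v, D v -> Cn D k' ('D_v f))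
  else True.

Variable D : set V.

Lemma CnS k f : (forall x, differentiable f x) ->
  (forall v, D v -> Cn D k ('D_v f)) -> Cn D k.+1 f.
Proof.
by move=> df Df; split=> // x; exact: differentiable_continuous.
Qed.

Lemma Cn_cont k f : Cn D k f -> continuous f.
Proof. by case: k => [|k] []. Qed.

Lemma Cn_diff k f : Cn D k.+1 f -> forall x, differentiable f x.
Proof. by case=> _ []. Qed.

Lemma Cn_derive k f v : D v -> Cn D k.+1 f -> Cn D k ('D_v f).
Proof. by move=> Dv [_ [_]]; exact. Qed.

Lemma Cn_is_derive k f x v : Cn D k.+1 f -> is_derive x v f ('D_v f x).
Proof.
by move=> cf; apply/derivableP/diff_derivable; exact: (Cn_diff cf).
Qed.

Lemma CnW k f : Cn D k.+1 f -> Cn D k f.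
Proof.
elim: k f => [|k IH] f; first by case.
move=> cf; apply: CnS => [|v Dv]; first exact: (Cn_diff cf).
by apply: IH; exact: Cn_derive cf.
Qed.

Lemma Cn_ler k l f : (k <= l)%N -> Cn D l f -> Cn D k f.
Proof. by move=> /subnK <-; elim: (l - k)%N => // m IH /CnW. Qed.

Lemma Cn_cst k (c : R) : Cn D k (cst c).
Proof.
elim: k c => [|k IH] c; first by split=> //; exact: cst_continuous.
apply: CnS => [x|v _]; first exact: differentiable_cst.
rewrite (_ : 'D_v _ = cst 0)//.
by apply/funext => x; rewrite derive_cst.
Qed.

Lemma Cn_add k f g : Cn D k f -> Cn D k g -> Cn D k (fun x => f x + g x).
Proof.
elim: k f g => [|k IH] f g cf cg.
  by split=> // x; apply: cvgD; [exact: (Cn_cont cf)|exact: (Cn_cont cg)].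
have df := Cn_diff cf; have dg := Cn_diff cg.
apply: CnS => [x|v Dv]; first exact: differentiableD.
rewrite (_ : 'D_v _ = (fun x => 'D_v f x + 'D_v g x)).
  by apply: IH; exact: Cn_derive.
by apply/funext => x; rewrite deriveD//; exact: diff_derivable.
Qed.

Lemma Cn_mul k f g : Cn D k f -> Cn D k g -> Cn D k (fun x => f x * g x).
Proof.
elim: k f g => [|k IH] f g cf cg.
  by split=> // x; apply: cvgM; [exact: (Cn_cont cf)|exact: (Cn_cont cg)].
have df := Cn_diff cf; have dg := Cn_diff cg.
apply: CnS => [x|v Dv]; first exact: differentiableM.
rewrite (_ : 'D_v _ = (fun x => f x * 'D_v g x + g x * 'D_v f x)).
  by apply: Cn_add; apply: IH; by [exact: CnW|exact: Cn_derive].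
by apply/funext => x; rewrite deriveM//; exact: diff_derivable.
Qed.

Lemma Cn_opp k f : Cn D k f -> Cn D k (fun x => - f x).
Proof.
move=> cf; rewrite (_ : (fun _ => _) = (fun x => cst (-1) x * f x)).
  by apply: Cn_mul => //; exact: Cn_cst.
by apply/funext => x /=; rewrite mulN1r.
Qed.

Lemma Cn_sub k f g : Cn D k f -> Cn D k g -> Cn D k (fun x => f x - g x).
Proof. by move=> cf cg; apply: Cn_add => //; exact: Cn_opp. Qed.

Lemma Cn_exp k n f : Cn D k f -> Cn D k (fun x => f x ^+ n).
Proof.
move=> cf; elim: n => [|n IH].
  by under eq_fun do rewrite expr0; exact: Cn_cst.
by under eq_fun do rewrite exprS; exact: Cn_mul.
Qed.

Lemma Cn_sum k (I : Type) (r : seq I) (P : pred I) (F : I -> V -> R) :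
  (forall i, P i -> Cn D k (F i)) -> Cn D k (fun x => \sum_(i <- r | P i) F i x).
Proof.
move=> cF; elim: r => [|i r IH].
  by under eq_fun do rewrite big_nil; exact: Cn_cst.
case: (boolP (P i)) => Pi.
  by under eq_fun do rewrite big_cons Pi; apply: Cn_add => //; exact: cF.
by under eq_fun do rewrite big_cons (negbTE Pi).
Qed.

Lemma Cn_inv k f : (forall x, f x != 0) -> Cn D k f ->
  Cn D k (fun x => (f x)^-1).
Proof.
move=> f0; elim: k => [|k IH] cf.
  by split=> // x; apply: cvgV => //; exact: (Cn_cont cf).
have df := Cn_diff cf.
apply: CnS => [x|v Dv]; first exact: differentiableV.
rewrite (_ : 'D_v _ = (fun x => - 'D_v f x * (f x)^-1 * (f x)^-1)); last first.
  apply/funext => x; rewrite (@derive_val _ _ _ _ _ _ _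
    (is_derive_invf (f0 x) (Cn_is_derive x v cf))).
  by rewrite expr2 invfM mulrA.
have ci := IH (CnW cf).
by apply: Cn_mul => //; apply: Cn_mul => //; apply/Cn_opp/Cn_derive.
Qed.

End Derivation.

Lemma Cn_comp (R : realType) (V : normedModType R) (D : set V) k (a : R -> R) f :
  @Cn R R [set 1] k a -> Cn D k f -> Cn D k (fun x => a (f x)).
Proof.
elim: k a f => [|k IH] a f ca cf.
  split=> // x.
  by apply: continuous_comp; [exact: (Cn_cont cf)|exact: (Cn_cont ca)].
have df := Cn_diff cf; have da := Cn_diff ca.
apply: CnS => [x|v Dv]; first exact: differentiable_comp.
rewrite (_ : 'D_v _ = (fun x => 'D_1 a (f x) * 'D_v f x)).
  apply: Cn_mul; last exact: Cn_derive.
  by apply: (IH ('D_1 a) f _ (CnW cf)); exact: (Cn_derive _ ca).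
apply/funext => x; apply: (@derive_val _ _ _ _ _ _ _
  (is_derive_compf (Cn_is_derive _ _ ca) (Cn_is_derive _ _ cf))).
Qed.

Lemma Cn_sqrt (R : realType) (V : normedModType R) (D : set V) k (f : V -> R) :
  (forall x, 0 < f x) -> Cn D k f -> Cn D k (fun x => Num.sqrt (f x)).
Proof.
move=> f0; elim: k => [|k IH] cf.
  split=> // x; apply: continuous_comp; first exact: (Cn_cont cf).
  exact: sqrt_continuous.
have df := Cn_diff cf.
apply: CnS => [x|v Dv].
  apply: (@differentiable_comp _ _ _ _ f Num.sqrt) => //.
  by apply/derivable1_diffP; have [] := is_derive1_sqrt (f0 x).
rewrite (_ : 'D_v _ = (fun x => 'D_v f x * (2 * Num.sqrt (f x))^-1)).
  apply: Cn_mul; first exact: Cn_derive.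
  apply: Cn_inv => [x|].
    by rewrite mulf_neq0// gt_eqF// sqrtr_gt0.
  by apply: Cn_mul; [exact: Cn_cst|apply/IH/CnW].
apply/funext => x; apply: (@derive_val _ _ _ _ _ _ _
  (is_derive_sqrtf (f0 x) (Cn_is_derive _ _ cf))).
Qed.

Section Line.
Variable R : realType.
Implicit Types f : R -> R.

Local Notation C1 := (@Cn R R [set 1]).

Lemma is_derive1_Cn k f (df : R -> R) :
  (forall x, is_derive x (1 : R) f (df x)) -> C1 k df -> C1 k.+1 f.
Proof.
move=> hf cdf; apply: CnS => [x|v ->].
  by apply/derivable1_diffP; have [] := hf x.
rewrite (_ : 'D_1 f = df)//; by apply/funext => x; have [] := hf x.
Qed.

Lemma Cn_id1 k : C1 k id.
Proof.
case: k => [|k]; first by split=> //; move=> x; exact: cvg_id.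
apply: (is_derive1_Cn (df := cst 1)); exact: Cn_cst.
Qed.

End Line.

(** * Smooth bump functions on the line *)

Section Flat.
Variables (R : realType) (e : R).
Hypothesis e0 : 0 < e.
Implicit Types (p : {poly R}) (x : R).

(** A family closed under differentiation: the derivative of p(1/x) exp(-e/x) is of the same form
    with another polynomial. Smoothness then follows by one induction over the order, for all [p] at
    once. *)
Definition flat_poly p x : R :=
  if 0 < x then p.[x^-1] * expR (- (e / x)) else 0.

Let flat_bound m : exists C, forall x, 0 < x ->
  x^-1 ^+ m * expR (- (e / x)) <= C * x.
Proof.
(* The inequality 1 + t <= exp t at t = e / (x k), raised to the power k = m + 1, beats x^-m with
   one factor x to spare. *)
pose k : R := m.+1%:R; have k0 : 0 < k by rewrite ltr0n.
exists ((k / e) ^+ m.+1) => x x0.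
have ex0 : 0 < e / x by rewrite divr_gt0.
have -> : expR (- (e / x)) = (expR (e / x / k) ^+ m.+1)^-1.
  rewrite -expRM_natl -/k (_ : k * (e / x / k) = e / x) ?expRN//.
  by field; rewrite !gt_eqF.
have h : (e / x / k) ^+ m.+1 <= expR (e / x / k) ^+ m.+1.
  rewrite lerXn2r ?nnegrE ?expR_ge0 ?divr_ge0// ?(ltW k0) ?(ltW e0) ?(ltW x0)//.
  by apply: le_trans (expR_ge1Dx _); rewrite lerDr.
rewrite ler_pdivrMr ?exprn_gt0 ?expR_gt0//.
have := ler_wpM2l (_ : 0 <= (k / e) ^+ m.+1 * x) h.
have -> : (k / e) ^+ m.+1 * x * (e / x / k) ^+ m.+1 = x^-1 ^+ m.
  rewrite mulrAC -exprMn (_ : k / e * (e / x / k) = x^-1); last first.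
    by field; rewrite !gt_eqF.
  by rewrite exprSr mulfVK// gt_eqF.
by apply; rewrite mulr_ge0 ?exprn_ge0 ?divr_ge0// ltW.
Qed.

(** The additional power x^-m makes the induction over [p] in Horner form close: passing from p to p
    X + c trades one factor 1/x for an increase of [m]. *)
Let flat_poly_bound p m : exists C, forall x, 0 < x ->
  `|x^-1 ^+ m * flat_poly p x| <= C * x.
Proof.
elim/poly_ind: p m => [|p c IH] m.
  by exists 0 => x x0; rewrite /flat_poly x0 horner0 mul0r mulr0 mul0r normr0.
have [C1 h1] := IH m.+1; have [C2 h2] := flat_bound m.
exists (C1 + `|c| * C2) => x x0.
have := h1 _ x0; have := h2 _ x0; rewrite /flat_poly x0 hornerMXaddC => {}h2 {}h1.
have -> : x^-1 ^+ m * ((p.[x^-1] * x^-1 + c) * expR (- (e / x))) =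
  x^-1 ^+ m.+1 * (p.[x^-1] * expR (- (e / x))) +
  c * (x^-1 ^+ m * expR (- (e / x))).
  by rewrite exprS; ring.
rewrite (le_trans (ler_normD _ _))// mulrDl lerD// normrM -mulrA ler_wpM2l//.
by rewrite ger0_norm// mulr_ge0 ?expR_ge0// exprn_ge0// invr_ge0 ltW.
Qed.

Lemma is_derive_flat_poly p x : is_derive x (1 : R) (flat_poly p)
  (flat_poly (- ('X^2 * p^`()) + e *: ('X^2 * p)) x).
Proof.
have [x0|x0|<-] := ltgtP 0 x.
- apply: (@near_eq_is_derive R R R (fun y => p.[y^-1] * expR (- (e / y)))).
    near=> y; rewrite /flat_poly ifT//; near: y.
    exact: (lt_nbhsr x0).
  have hi := is_derive_invf (lt0r_neq0 x0) (is_derive_id x (1 : R)).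
  apply: is_derive_eq.
  rewrite /GRing.scale/= /flat_poly x0.
  rewrite !(hornerD, hornerN, hornerZ, hornerM, hornerX).
  field.
  by rewrite gt_eqF.
- apply: (@near_eq_is_derive R R R (cst 0)).
    near=> y; rewrite /flat_poly ifF//; apply/negbTE; rewrite -leNgt ltW//.
    by near: y; exact: (lt_nbhsl x0).
  apply: (@is_derive_eq _ _ _ _ _ _ _ 0).
  by rewrite /flat_poly ltNge (ltW x0).
(* At 0 the difference quotient is flat_poly p h / h, which the bound with m = 1 makes at most C
   |h|. *)
- have [C hC] := flat_poly_bound p 1.
  have h : (fun h : R => h^-1 *: ((flat_poly p \o shift (0 : R)) (h *: 1) -
      flat_poly p 0)) @ (0 : R)^' --> (0 : R).
    apply/cvgrPdist_le => /= d d0.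
    have C0 : 0 <= C.
      by have := hC _ ltr01; rewrite mulr1; apply: le_trans.
    near=> h.
    rewrite /flat_poly ltxx subr0 sub0r normrN addr0 [h *: 1]mulr1.
    case: ifPn => h0; last by rewrite scaler0 normr0 ltW.
    have := hC _ h0; rewrite /flat_poly h0 expr1; move/le_trans; apply.
    apply: (@le_trans _ _ ((C + 1) * `|h|)).
      by rewrite (gtr0_norm h0) ler_wpM2r ?ltW// ltrDl.
    rewrite -ler_pdivlMl ?ltr_wpDl//.
    near: h; apply: dnbhs0_le.
    by rewrite mulr_gt0 ?invr_gt0 ?ltr_wpDl.
  rewrite [X in is_derive _ _ _ X](_ : _ = 0); last by rewrite /flat_poly ltxx.
  by split; [apply/cvg_ex; exists 0|exact/cvg_lim].
Unshelve. all: by end_near. Qed.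

Lemma Cn_flat_poly p k : @Cn R R [set 1] k (flat_poly p).
Proof.
elim: k p => [|k IH] p; last first.
  by apply: is_derive1_Cn (IH _) => x; exact: is_derive_flat_poly.
split=> // x; apply/differentiable_continuous/derivable1_diffP.
by have [] := is_derive_flat_poly p x.
Qed.

(* Tends to the indicator function of ]a, b[ as [e] tends to 0. *)
Definition bump (a b x : R) : R :=
  flat_poly 1 (x - a) * flat_poly 1 (b - x).

Lemma Cn_bump a b k : @Cn R R [set 1] k (bump a b).
Proof.
have hid := Cn_id1 R k.
apply: Cn_mul; apply: Cn_comp (Cn_flat_poly _ _) _; apply: Cn_sub => //;
  exact: Cn_cst.
Qed.

Lemma bumpE a b x :
  bump a b x = if a < x < b then expR (- (e / (x - a))) * expR (- (e / (b - x)))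
               else 0.
Proof.
rewrite /bump /flat_poly !hornerE !subr_gt0.
by case: (a < x); case: (x < b); rewrite /= ?mul0r ?mulr0 ?mul1r.
Qed.

Lemma bump_le1 a b x : bump a b x <= 1.
Proof.
rewrite bumpE; case: ifP => // /andP[ax xb].
have e1 y : 0 < y -> expR (- (e / y)) <= 1.
  by move=> y0; rewrite -expR0 ler_expR lerNl oppr0 divr_ge0// ltW.
by rewrite mulr_ile1 ?expR_ge0// e1// subr_gt0.
Qed.

End Flat.

(** * Integration over the line and over tuples *)

Section RealIntegral.
Context d (T : measurableType d) (R : realType) (mu : {measure set T -> \bar R}).
Implicit Types f g : T -> R.

Lemma ae_mono (P Q : T -> Prop) : {ae mu, forall t, P t} ->
  (forall t, P t -> Q t) -> {ae mu, forall t, Q t}.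
Proof. by move=> hP PQ; apply: filterS hP. Qed.

Lemma integrable_le f g : measurable_fun setT f ->
  (forall t, `|f t| <= g t) -> mu.-integrable setT (EFin \o g) ->
  mu.-integrable setT (EFin \o f).
Proof.
move=> mf fg; apply: le_integrable => //; first exact/measurable_EFinP.
by move=> t _ /=; rewrite lee_fin (le_trans (fg t)) ?ler_norm.
Qed.

Lemma ge0_integrable f : measurable_fun setT f -> (forall t, 0 <= f t) ->
  (\int[mu]_t (f t)%:E < +oo)%E -> mu.-integrable setT (EFin \o f).
Proof.
move=> mf f0 foo; apply/integrableP; split; first exact/measurable_EFinP.
rewrite (_ : (\int[mu]_t _)%E = (\int[mu]_t (f t)%:E)%E)//.
by apply: eq_integral => t _ /=; rewrite ger0_norm.
Qed.

Lemma Rintegral_EFin f : mu.-integrable setT (EFin \o f) ->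
  (\int[mu]_t (f t)%:E = (Rintegral mu setT f)%:E)%E.
Proof. by move=> hf; rewrite fineK//; exact: integrable_fin_num. Qed.

(** The sets over which [f] integrates to 0 form a Dynkin system; the vanishing total integral gives
    closure under complements. *)
Lemma ae0_of_pi_system (G : set (set T)) f :
  @measurable _ T = <<s G >> -> setI_closed G ->
  mu.-integrable setT (EFin \o f) ->
  (\int[mu]_t (f t)%:E = 0)%E ->
  (forall A, G A -> \int[mu]_(t in A) (f t)%:E = 0)%E ->
  {ae mu, forall t, f t = 0}.
Proof.
move=> mG GI intf fT fG.
have intfS A : measurable A -> mu.-integrable A (EFin \o f).
  by move=> mA; apply: integrableS intf.
have fA A : measurable A -> (\int[mu]_(t in A) (f t)%:E = 0)%E.
  rewrite mG; move: A; apply: (@dynkin_induction _ T G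
    (fun A => \int[mu]_(t in A) (f t)%:E = 0)%E mG GI) => //.
    move=> S mS S0; have := fT.
    rewrite -(setUv S) integral_setU//; first last.
    - exact/disj_setPCl.
    - by rewrite setUv; case/integrableP : intf.
    - exact: measurableC.
    by rewrite S0 add0e.
  move=> F mF tF F0; rewrite integral_bigcup//; last first.
    exact/intfS/bigcup_measurable.
  by rewrite eseries0// => i _ _; exact: F0.
have : ae_eq mu setT (EFin \o f) (cst 0%E).
  apply: integral_ae_eq => // E _ mE.
  by rewrite [RHS]integral0_eq// -[RHS](fA _ mE).
by apply: filterS => t /(_ I) [].
Qed.

Lemma dominated_cvg_EFin (f_ : nat -> T -> R) f g :
  (forall k, measurable_fun setT (f_ k)) -> measurable_fun setT f ->
  (forall t, f_ ^~ t @ \oo --> f t) ->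
  mu.-integrable setT (EFin \o g) -> (forall k t, `|f_ k t| <= g t) ->
  (fun k => \int[mu]_t (f_ k t)%:E)%E @ \oo --> (\int[mu]_t (f t)%:E)%E.
Proof.
move=> mf_ mf f_f ig f_g.
have [|||||//] := @dominated_convergence _ _ _ mu setT measurableT
  (fun k => EFin \o f_ k) (EFin \o f) (EFin \o g).
- by move=> k; exact/measurable_EFinP.
- exact/measurable_EFinP.
- by apply: aeW => t _; apply: cvg_EFin; [exact: nearW|exact: f_f].
- exact: ig.
- by apply: aeW => t k _; rewrite /= lee_fin.
Qed.

End RealIntegral.

Section Tuple.
Variable R : realType.
Local Notation Rm := (measurableTypeR R).
Local Notation leb := (@lebesgue_measure R).
Local Notation tup n := (@lebesgue_tuple R n).

Lemma ge0_integral_tupleS n (f : n.+1.-tuple Rm -> \bar R) :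
  measurable_fun setT f -> (forall t, 0 <= f t)%E ->
  (\int[tup n.+1]_t f t = \int[leb]_x \int[tup n]_t f (cons_pair (x, t)))%E.
Proof.
move=> mf f0.
have -> : (\int[tup n.+1]_t f t =
    \int[pushforward (leb \x tup n)%E (@cons_pair R n)]_t f t)%E by [].
rewrite ge0_integral_pushforward//; last exact: measurable_cons_pair.
rewrite preimage_setT fubini_tonelli1//; last by move=> p; exact: f0.
by apply: measurableT_comp => //; exact: measurable_cons_pair.
Qed.

Lemma integrable_tupleS n (f : n.+1.-tuple Rm -> \bar R) :
  (tup n.+1).-integrable setT f <->
  measurable_fun setT f /\
  (leb \x tup n)%E.-integrable setT (f \o @cons_pair R n).
Proof.
have mc := @measurable_cons_pair R n.
split=> [/integrableP[mf foo]|[mf /integrableP[mf' foo]]].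
  split=> //; apply/integrableP; split; first exact: measurableT_comp.
  move: foo.
  have -> : (\int[tup n.+1]_t `|f t| =
    \int[pushforward (leb \x tup n)%E (@cons_pair R n)]_t `|f t|)%E by [].
  by rewrite ge0_integral_pushforward//; exact: measurableT_comp.
apply/integrableP; split=> //.
have -> : (\int[tup n.+1]_t `|f t| =
    \int[pushforward (leb \x tup n)%E (@cons_pair R n)]_t `|f t|)%E by [].
by rewrite ge0_integral_pushforward//; exact: measurableT_comp.
Qed.

Lemma integral_tupleS_prod n (f : n.+1.-tuple Rm -> \bar R) :
  (tup n.+1).-integrable setT f ->
  (\int[tup n.+1]_t f t = \int[leb \x tup n]_p f (cons_pair p))%E.
Proof.
move=> /integrable_tupleS[mf intf].
have -> : (\int[tup n.+1]_t f t =
    \int[pushforward (leb \x tup n)%E (@cons_pair R n)]_t f t)%E by [].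
by rewrite integral_pushforward//; exact: measurable_cons_pair.
Qed.

Lemma integral_tupleS n (f : n.+1.-tuple Rm -> \bar R) :
  (tup n.+1).-integrable setT f ->
  (\int[tup n.+1]_t f t = \int[leb]_x \int[tup n]_t f (cons_pair (x, t)))%E.
Proof.
move=> hf; rewrite integral_tupleS_prod//.
by rewrite -integral12_prod_meas1//; have /integrable_tupleS[] := hf.
Qed.

Lemma integral_tupleS2 n (f : n.+1.-tuple Rm -> \bar R) :
  (tup n.+1).-integrable setT f ->
  (\int[tup n.+1]_t f t = \int[tup n]_t \int[leb]_x f (cons_pair (x, t)))%E.
Proof.
move=> hf; rewrite integral_tupleS_prod//.
by rewrite -integral21_prod_meas1//; have /integrable_tupleS[] := hf.
Qed.

Lemma ge0_integral_prod_tuple n (f : 'I_n -> R -> R) :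
  (forall i, measurable_fun setT (f i : Rm -> R)) ->
  (forall i x, 0 <= f i x) ->
  (\int[tup n]_t (\prod_i f i (tnth t i))%:E =
   \prod_i \int[leb]_x (f i x)%:E)%E.
Proof.
elim: n f => [|n IH] f mf f0.
  rewrite big_ord0 (_ : (fun t : 0.-tuple Rm => _) = cst 1%E).
    rewrite integral_cst// mul1e/= diracE (_ : _ \in _ = true)//.
    exact/mem_set.
  by apply/funext => t; rewrite big_ord0.
have mprod m (g : 'I_m -> R -> R) :
    (forall i, measurable_fun setT (g i : Rm -> R)) ->
    measurable_fun setT (fun t : m.-tuple Rm => \prod_i g i (tnth t i)).
  move=> mg; apply: measurable_prod => i _.
  apply: (@measurableT_comp _ _ _ _ _ _ (g i)).
    exact: mg.
  exact: measurable_tnth.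
rewrite ge0_integral_tupleS//; first last.
- by move=> t; rewrite lee_fin prodr_ge0.
- by apply/measurable_EFinP; exact: (mprod _ f mf).
rewrite big_ord_recl -IH//.
have I0 : (0 <= \int[tup n]_t
    (\prod_i f (lift ord0 i) (tnth t i))%:E)%E.
  by apply: integral_ge0 => t _; rewrite lee_fin prodr_ge0.
rewrite -ge0_integralZr//; last 2 first.
- exact/measurable_EFinP.
- by move=> x _; rewrite lee_fin.
apply: eq_integral => x _.
rewrite -ge0_integralZl//; first last.
- by rewrite lee_fin.
- by move=> t _; rewrite lee_fin prodr_ge0.
- apply/measurable_EFinP.
  by apply: (mprod _ (fun i => f (lift ord0 i))) => i; exact: mf.
apply: eq_integral => t _; rewrite -EFinM big_ord_recl; congr (_ * _)%:E.
by apply: eq_bigr => i _; rewrite tnthS.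
Qed.

(** Row vectors carry the topology and tuples the product sigma-algebra. An open set is the union of
    the boxes with rational centre and radius 1/(k+1) that it contains, a countable union of
    measurable sets. *)
Lemma measurable_row_of_tuple n (f : 'rV[R]_n -> R) : continuous f ->
  measurable_fun setT (fun t : n.-tuple Rm => f (row_of_tuple t)).
Proof.
move=> cf mT; apply: (measurability _ (RGenOInfty.measurableE R)) => //.
move=> _ [_ [a ->] <-]; rewrite setTI.
set U := f @^-1` `]a, +oo[%classic.
have oU : open U.
  by apply: open_comp => [x _|]; [exact: cf|exact: interval_open].
pose box (p : n.-tuple rat * nat) := [set x : 'rV[R]_n |
  forall i, `|x 0 i - ratr (tnth p.1 i)| < p.2.+1%:R^-1].
have UE : U = \bigcup_(p in [set p | box p `<=` U]) box p.
  apply/seteqP; split=> [x Ux|x [p]]; last exact.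
  have /nbhs_ballP[e /= e0 xeU] : nbhs x U by exact: open_nbhs_nbhs.
  have [k ke] : exists k : nat, k.+1%:R^-1 < e / 2.
    near \oo => k; exists k; near: k.
    by apply: near_infty_natSinv_lt (PosNum _); rewrite divr_gt0.
  have k0 : (0 : R) < k.+1%:R^-1 by rewrite invr_gt0.
  have ex i : {q : rat | `|x 0 i - ratr q| < k.+1%:R^-1}.
    apply: cid.
    have [q] : exists q, ratr q \in `]x 0 i, x 0 i + k.+1%:R^-1[.
      by apply: rat_in_itvoo; rewrite ltrDl.
    rewrite in_itv/= => /andP[xq qx].
    by exists q; rewrite distrC gtr0_norm ?subr_gt0// ltrBlDl.
  exists ([tuple sval (ex i) | i < n], k).
    move=> y; rewrite /box /= => yk; apply: xeU; split=> // i j.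
    rewrite !(ord1 i) /ball/=.
    have := yk j; rewrite tnth_mktuple => {}yk.
    rewrite -(subrKA (ratr (sval (ex j)))) (le_lt_trans (ler_normD _ _))//.
    rewrite (splitr e) ltrD//; first exact: lt_trans (svalP (ex j)) ke.
    by rewrite distrC (lt_trans yk).
  by move=> i /=; rewrite tnth_mktuple; case: (ex i).
rewrite (_ : _ @^-1` _ = \bigcup_(p in [set p | box p `<=` U])
    [set t : n.-tuple Rm | box p (row_of_tuple t)]); last first.
  rewrite -[LHS]/((@row_of_tuple R n) @^-1` U) {1}UE preimage_bigcup.
  by [].
rewrite bigcup_mkcond; apply: countable_bigcupT_measurable => // p.
case: ifPn => // _.
rewrite (_ : mkset _ = \bigcap_(i in setT)
    ((@tnth n Rm ^~ i) @^-1` (ball (ratr (tnth p.1 i) : R) p.2.+1%:R^-1))); last first.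
  apply/seteqP; split=> [t bt i _|t bt i].
    by have := bt i; rewrite mxE distrC /ball.
  by have := bt i I; rewrite /= mxE distrC /ball.
apply: fin_bigcap_measurable => // i _.
rewrite -[X in measurable X]setTI; apply: measurable_tnth => //.
exact: measurable_ball.
Unshelve. all: by end_near. Qed.

End Tuple.

Section LineIntegral.
Variable R : realType.
Local Notation leb := (@lebesgue_measure R).
Implicit Types f g G : R -> R.

Lemma integral_FTC G g a b : a <= b ->
  (forall x, is_derive x (1 : R) G (g x)) -> continuous g ->
  (\int[leb]_(x in `[a, b]) (g x)%:E = (G b - G a)%:E)%E.
Proof.
move=> ab dG cg; move: ab; rewrite le_eqVlt => /predU1P[<-|ab].
  by rewrite set_itv1 integral_set1 subrr.
have cG : continuous G.
  move=> x; apply/differentiable_continuous/derivable1_diffP.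
  by have [] := dG x.
rewrite EFinB; apply: continuous_FTC2 => //.
- exact: continuous_subspaceT.
- split=> [x _| |]; first by have [] := dG x.
    by apply: cvg_at_right_filter; exact: cG.
  by apply: cvg_at_left_filter; exact: cG.
- by move=> x _; rewrite derive1E; have [] := dG x.
Qed.

Lemma integrable_continuous_itv g a b : continuous g ->
  leb.-integrable `[a, b] (EFin \o g).
Proof.
move=> cg; apply: continuous_compact_integrable; first exact: segment_compact.
exact: continuous_subspaceT.
Qed.

(** Integrability of [g] allows dominated convergence along the intervals [-k, k], over which the
    integral is G(k) - G(-k). *)
Lemma integral_derive0 G g : (forall x, is_derive x (1 : R) G (g x)) ->
  continuous g -> leb.-integrable setT (EFin \o g) ->
  G x @[x --> +oo] --> 0 -> G x @[x --> -oo] --> 0 ->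
  (\int[leb]_x (g x)%:E = 0)%E.
Proof.
move=> dG cg ig Gy GNy.
have mg : measurable_fun setT g by exact: continuous_measurable_fun.
pose f_ (k : nat) := g \_ `[- k%:R, k%:R].
have mf_ k : measurable_fun setT (f_ k).
  by apply/(measurable_restrictT _ _).1 => //; exact/measurable_funTS.
have f_g x : f_ ^~ x @ \oo --> g x.
  apply: cvg_near_cst; near=> k.
  rewrite /f_ patchE ifT//; apply/mem_set; rewrite /= in_itv/= -ler_norml.
  by near: k; exact: nbhs_infty_ger.
have fg k x : `|f_ k x| <= `|g x|.
  by rewrite /f_ patchE; case: ifP => // _; rewrite normr0.
have := @dominated_cvg_EFin _ (measurableTypeR R) R leb _ _ _ mf_ mg f_g (integrable_norm ig) fg.
have -> : (fun k => \int[leb]_x (f_ k x)%:E)%E =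
    (fun k : nat => (G k%:R - G (- k%:R))%:E).
  apply/funext => k.
  rewrite -(@integral_FTC G g) ?ge0_cp// [RHS]integral_mkcond.
  by apply: eq_integral => x _; rewrite restrict_EFin.
have h0 : (fun k : nat => (G k%:R - G (- k%:R))%:E) @ \oo --> (0 : R)%:E.
  apply: cvg_EFin; first by near=> k.
  rewrite [X in _ --> X](_ : _ = 0 - 0); last by rewrite subrr.
  apply: cvgB.
    exact: (cvg_comp _ _ (@cvgr_idn R) Gy).
  apply: (cvg_comp (fun k : nat => - k%:R) G _ GNy).
  by apply/cvgNrNy; exact: cvgr_idn.
by move=> h; rewrite -(cvg_lim _ h)// (cvg_lim _ h0).
Unshelve. all: by end_near. Qed.

Definition itv_integrable f := forall a b, leb.-integrable `[a, b] (EFin \o f).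

(** The signed integral from 0 to x: for x different from 0 one of the two intervals is empty. *)
Definition primitive f x : R :=
  Rintegral leb `[0, x] f - Rintegral leb `[x, 0] f.

(** Moving the base point from 0 to a point left of [x] removes the case distinction on the sign of
    [x], and results on integrals with a fixed lower end apply. *)
Lemma primitiveE f M x : itv_integrable f -> 0 <= M -> - M <= x ->
  primitive f x = Rintegral leb `[- M, x] f - Rintegral leb `[- M, 0] f.
Proof.
move=> intf M0 Mx.
have split_itv a b c : a <= b -> b <= c ->
    Rintegral leb `[a, c] f = Rintegral leb `[a, b] f + Rintegral leb `[b, c] f.
  move=> ab bc.
  have := @Rintegral_itvB _ f (BLeft a) (BRight c) b (intf _ _).
  rewrite !bnd_simp => /(_ ab bc) /eqP.
  rewrite subr_eq addrC => /eqP ->; congr +%R.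
  by apply: Rintegral_itv_obnd_cbnd; apply: integrableS (intf b c) => //;
    exact: subset_itv_oc_cc.
rewrite /primitive; have [x0|x0] := leP 0 x.
  rewrite (split_itv (- M) 0 x) ?oppr_le0// addrAC subrr add0r.
  move: x0; rewrite le_eqVlt => /predU1P[<-|x0].
    by rewrite subrr set_itv1 Rintegral_set1.
  rewrite [X in _ - X](_ : _ = 0) ?subr0//.
  by rewrite set_itv_ge ?Rintegral_set0// bnd_simp -ltNge.
rewrite (split_itv (- M) x 0 Mx (ltW x0)).
rewrite [X in X - _ = _](_ : _ = 0); first by ring.
by rewrite set_itv_ge ?Rintegral_set0// bnd_simp -ltNge.
Qed.

Lemma primitive0 f : primitive f 0 = 0.
Proof. by rewrite /primitive subrr. Qed.

Lemma is_derive_primitive g x : continuous g ->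
  is_derive x (1 : R) (primitive g) (g x).
Proof.
move=> cg; pose M := `|x| + 1.
have [xM Mx] : - M < x /\ x < M.
  by apply/andP; rewrite -ltr_norml ltrDl.
have M0 : 0 <= M by rewrite addr_ge0.
have ig : itv_integrable g by move=> a b; exact: integrable_continuous_itv.
pose F y := Rintegral leb `[- M, y] g.
have dF : is_derive x (1 : R) F (g x).
  have [h1 h2] := @continuous_FTC1_closed _ g (- M) x M Mx (ig _ _) xM (cg _).
  by split; [exact: h1|rewrite -derive1E].
apply: (@near_eq_is_derive R R R (fun y => F y - F 0)); last first.
  by apply: is_derive_eq; rewrite subr0.
near=> y; rewrite (@primitiveE _ M)// ltW//.
by near: y; exact: lt_nbhsr.
Unshelve. all: by end_near. Qed.

Lemma continuous_primitive f : itv_integrable f -> continuous (primitive f).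
Proof.
move=> intf x; pose M := `|x| + 1.
have [xM Mx] : - M < x /\ x < M.
  by apply/andP; rewrite -ltr_norml ltrDl.
have M0 : 0 <= M by rewrite addr_ge0.
have MM : - M < M by exact: lt_trans Mx.
have := parameterized_integral_continuous (ltW MM) (intf (- M) M).
move=> /(continuous_within_itvP _ MM)[+ _ _] => /(_ x).
rewrite in_itv/= xM Mx => /(_ isT) cF.
have : (fun y => Rintegral leb `[- M, y] f - Rintegral leb `[- M, 0] f) @ x -->
    Rintegral leb `[- M, x] f - Rintegral leb `[- M, 0] f.
  by apply: cvgB; [exact: cF|exact: cvg_cst].
rewrite /continuous_at (@primitiveE f M x)// ?(ltW xM)//; apply: cvg_trans.
apply: near_eq_cvg; near=> y; rewrite -(@primitiveE f M)// ltW//.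
by near: y; exact: lt_nbhsr.
Unshelve. all: by end_near. Qed.

End LineIntegral.

Section TupleIntegral.
Variable R : realType.
Local Notation Rm := (measurableTypeR R).
Local Notation leb := (@lebesgue_measure R).
Local Notation tup n := (@lebesgue_tuple R n).

Lemma ae0_continuous n (f : 'rV[R]_n -> R) : continuous f ->
  {ae tup n, forall t, f (row_of_tuple t) = 0} -> forall x, f x = 0.
Proof.
move=> cf [N [mN N0 fN]] x; apply: contrapT => /eqP fx0.
have /nbhs_ballP[e /= e0 xe] : nbhs x (f @^-1` [set y | y != 0]).
  by apply: cf; apply: open_nbhs_nbhs; split; [exact: open_neq|].
pose B := [set t : n.-tuple Rm | forall i, ball (x 0 i : R) e (tnth t i : R)].
have mB : measurable B.
  rewrite (_ : B = \bigcap_(i in setT) ((@tnth n Rm ^~ i) @^-1`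
      (ball (x 0 i : R) e))); last first.
    by apply/seteqP; split=> t Bt i; [move=> _|]; exact: Bt.
  apply: fin_bigcap_measurable => // i _.
  rewrite -[X in measurable X]setTI; apply: measurable_tnth => //.
  exact: measurable_ball.
have BN : B `<=` N.
  move=> t Bt; apply: fN => /= ft0.
  have : ball x e (row_of_tuple t).
    by split=> // i j; rewrite (ord1 i) mxE; exact: Bt.
  by move=> /xe /=; rewrite ft0 eqxx.
have : (tup n B <= 0)%E by rewrite -N0 le_measure ?inE.
have -> : tup n B = (\prod_(i < n) leb (ball (x ord0 i : R) e))%E.
  apply: (lebesgue_tuple_box (A := fun i => ball (x 0 i : R) e)) => i.
  exact: measurable_ball.
under eq_bigr do rewrite lebesgue_measure_ball ?ltW//.
by rewrite prodEFin lee_fin leNgt prodr_gt0// => i _; rewrite mulrn_wgt0.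
Qed.

Definition tset n (t : n.-tuple Rm) (i : 'I_n) (s : R) : n.-tuple Rm :=
  [tuple if j == i then s else tnth t j | j < n].

Lemma tset_cons0 n (x s : R) (t : n.-tuple Rm) :
  tset (cons_pair (x, t)) ord0 s = cons_pair (s, t).
Proof.
apply: eq_from_tnth => j; rewrite tnth_mktuple.
by case: (unliftP ord0 j) => [k ->|->]; rewrite ?eqxx //= !tnthS.
Qed.

Lemma tset_consS n (x s : R) (t : n.-tuple Rm) i :
  tset (cons_pair (x, t)) (lift ord0 i) s = cons_pair (x, tset t i s).
Proof.
apply: eq_from_tnth => j; rewrite tnth_mktuple.
case: (unliftP ord0 j) => [k ->|->] //=.
by rewrite !tnthS (inj_eq (@lift_inj _ _)) tnth_mktuple.
Qed.

(** By Fubini the coordinate [i] is integrated innermost: the induction integrates the first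
    coordinate last, unless it is [i] itself. *)
Lemma integral_coord_derive0 n (i : 'I_n) (G g : n.-tuple Rm -> R) :
  (forall t s, is_derive s (1 : R) (fun s => G (tset t i s)) (g (tset t i s))) ->
  (forall t, continuous (fun s => g (tset t i s))) ->
  (forall t, G (tset t i s) @[s --> +oo] --> 0) ->
  (forall t, G (tset t i s) @[s --> -oo] --> 0) ->
  (tup n).-integrable setT (EFin \o g) ->
  (\int[tup n]_t (g t)%:E = 0)%E.
Proof.
elim: n i G g => [[]//|n IH] i G g dG cg Gy GNy ig.
have /integrable_tupleS[mg ig'] := ig.
case: (unliftP ord0 i) => [j|] ij; subst i.
  rewrite integral_tupleS//.
  apply: etrans (integral0 leb setT); apply: ae_eq_integral => //; first exact: (measurable_fubini_F ig').
  have := ae_integrable1 ig'; apply: filterS => x igx _ /=.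
  apply: (IH j (fun t => G (cons_pair (x, t)))) => //.
  - by move=> t s; have := dG (cons_pair (x, t)) s;
      under eq_fun do rewrite tset_consS; rewrite tset_consS.
  - by move=> t; have := cg (cons_pair (x, t));
      under eq_fun do rewrite tset_consS.
  - by move=> t; have := Gy (cons_pair (x, t));
      under eq_fun do rewrite tset_consS.
  - by move=> t; have := GNy (cons_pair (x, t));
      under eq_fun do rewrite tset_consS.
rewrite integral_tupleS2//.
apply: etrans (integral0 (tup n) setT); apply: ae_eq_integral => //; first exact: (measurable_fubini_G ig').
have := ae_integrable2 ig'; apply: filterS => t igt _ /=.
apply: (@integral_derive0 _ (fun x => G (cons_pair (x, t)))) => //.
- by move=> s; have := dG (cons_pair (0, t)) s;
    under eq_fun do rewrite tset_cons0; rewrite tset_cons0.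
- by have := cg (cons_pair (0, t)); under eq_fun do rewrite tset_cons0.
- by have := Gy (cons_pair (0, t)); under eq_fun do rewrite tset_cons0.
- by have := GNy (cons_pair (0, t)); under eq_fun do rewrite tset_cons0.
Qed.

End TupleIntegral.

(** The flux a v' is differentiated as a whole, the form in which regularity of weak solutions
    delivers the equation. *)
Definition sturm_solution (R : realType) (a k v dv : R -> R) :=
  (forall x, is_derive x (1 : R) v (dv x)) /\
  (forall x, is_derive x (1 : R) (fun y => a y * dv y) (k x * v x)).

(** * The profile of the catenoid and its Sturm-Liouville equations *)

Section Profile.
Variables (R : realType) (N : nat).
Local Notation C1 := (@Cn R R [set 1]).
Local Notation J := (@jbracket R).
Implicit Types x : R.

Lemma jbracket_gt0 x : 0 < J x.
Proof. by rewrite sqrtr_gt0 ltr_pwDl// sqr_ge0. Qed.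

Lemma jbracket_sqr x : J x ^+ 2 = 1 + x ^+ 2.
Proof. by rewrite sqr_sqrtr// addr_ge0// sqr_ge0. Qed.

Lemma jbracket_ge1 x : 1 <= J x.
Proof. by rewrite -[leLHS]sqrtr1 ler_wsqrtr// lerDl sqr_ge0. Qed.

Lemma jbracket_ge x : `|x| <= J x.
Proof. by rewrite -sqrtr_sqr ler_wsqrtr// lerDr. Qed.

Lemma jbracket_le x : J x <= 1 + `|x|.
Proof.
rewrite -[leRHS]ger0_norm ?addr_ge0// -sqrtr_sqr ler_wsqrtr//.
by rewrite sqrrD expr1n -real_normK ?num_real// mul1r -addrA lerD2l lerDr mulrn_wge0.
Qed.

Lemma jbracketN x : J (- x) = J x.
Proof. by rewrite /jbracket sqrrN. Qed.

(** Here and below n = N + 3. By the geometric series this is (<x>^(2(n-1)) - 1) / x^2 without the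
    singularity at x = 0. *)
Definition profile_sum x : R := \sum_(k < N.+2) J x ^+ (2 * k).

Definition profile_root x : R := Num.sqrt (profile_sum x).

Local Notation T := profile_root.

(** The function A of the radial operator v -> (A v')'. It is the radial volume density W times the
    inverse radial metric coefficient, and 1 / A is the slope of the profile height. *)
Definition profile_flux x : R := J x * T x.

Local Notation A := profile_flux.

Lemma profile_sumE x : profile_sum x = \sum_(k < N.+2) (1 + x ^+ 2) ^+ k.
Proof. by apply: eq_bigr => k _; rewrite exprM jbracket_sqr. Qed.

Lemma profile_sum_gt0 x : 0 < profile_sum x.
Proof.
rewrite profile_sumE big_ord_recl expr0 ltr_pwDl// sumr_ge0// => k _.
by rewrite exprn_ge0// addr_ge0// sqr_ge0.
Qed.

Lemma profile_root_gt0 x : 0 < T x.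
Proof. by rewrite sqrtr_gt0 profile_sum_gt0. Qed.

Lemma profile_flux_gt0 x : 0 < A x.
Proof. by rewrite mulr_gt0// ?jbracket_gt0 ?profile_root_gt0. Qed.

Lemma profile_root_sqr x : T x ^+ 2 = profile_sum x.
Proof. by rewrite sqr_sqrtr// ltW// profile_sum_gt0. Qed.

Lemma profile_root_geom x : x ^+ 2 * T x ^+ 2 = J x ^+ (2 * N.+2) - 1.
Proof.
rewrite profile_root_sqr profile_sumE exprM jbracket_sqr subrX1.
by congr (_ * _); rewrite addrAC subrr add0r.
Qed.

Lemma Cn_jbracket k : C1 k J.
Proof.
apply: Cn_sqrt => [x|]; first by rewrite ltr_pwDl// sqr_ge0.
by apply: Cn_add; [exact: Cn_cst|apply: Cn_exp; exact: Cn_id1].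
Qed.

Lemma Cn_profile_root k : C1 k T.
Proof.
apply: Cn_sqrt => [x|]; first exact: profile_sum_gt0.
by apply: Cn_sum => i _; apply: Cn_exp; exact: Cn_jbracket.
Qed.

Lemma Cn_profile_flux k : C1 k A.
Proof. by apply: Cn_mul; [exact: Cn_jbracket|exact: Cn_profile_root]. Qed.

Lemma is_derive_jbracket x : is_derive x (1 : R) J (x / J x).
Proof.
have h : is_derive x (1 : R) (fun y => 1 + y ^+ 2) (2 * x).
  apply: is_derive_eq; rewrite /GRing.scale/= mulr1 add0r; ring.
have x0 : 0 < 1 + x ^+ 2 by rewrite ltr_pwDl// sqr_ge0.
have hs := @is_derive_sqrtf R R (fun y => 1 + y ^+ 2) x _ _ x0 h.
rewrite (_ : x / J x = 2 * x / (2 * Num.sqrt (1 + x ^+ 2))); first exact: hs.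
by rewrite -/(J x) -mulf_div divff ?mul1r// pnatr_eq0.
Qed.

Lemma is_derive_jbracketXV k x : is_derive x (1 : R) (fun y => (J y ^+ k)^-1)
  (- (k%:R * x / J x ^+ k.+2)).
Proof.
have J0 := jbracket_gt0 x.
have h := is_derive_expf k (is_derive_jbracket x).
apply: (is_derive_eq (is_derive_invf _ h)); first by rewrite expf_neq0// gt_eqF.
case: k {h} => [|k]; first by rewrite !mul0r oppr0 mul0r.
rewrite /= !exprS; have : J x ^+ k != 0 by rewrite expf_neq0// gt_eqF.
set P := J x ^+ k => P0; field.
by rewrite P0 gt_eqF.
Qed.

(** The left side of the identity is the derivative of x T. Differentiating (x T)^2 = <x>^(2(n-1)) -
    1 would give it except at x = 0, so the geometric sum is differentiated instead. *)
Lemma profile_root_derive x : exists2 dT, is_derive x (1 : R) T dT &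
  T x + x * dT = N.+2%:R * J x ^+ (2 * N.+1) / T x.
Proof.
pose t := 1 + x ^+ 2.
pose dS := \sum_(k < N.+2) k%:R * t ^+ k.-1 * (2 * x).
have ht : is_derive x (1 : R) (fun y => 1 + y ^+ 2) (2 * x).
  apply: is_derive_eq; rewrite /GRing.scale/= mulr1 add0r; ring.
have hS : is_derive x (1 : R) profile_sum dS.
  rewrite (_ : profile_sum = fun y => \sum_(k < N.+2) (1 + y ^+ 2) ^+ k).
    by apply: is_derive_sumf => k _; exact: is_derive_expf.
  by apply/funext => y; rewrite profile_sumE.
have hT := is_derive_sqrtf (profile_sum_gt0 x) hS.
exists (dS / (2 * T x)) => //.
have T0 := profile_root_gt0 x.
(* The derivative in t of (t - 1) (1 + t + ... + t^(m-1)) = t^m - 1. *)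
have key m : \sum_(k < m) t ^+ k + (t - 1) * \sum_(k < m) k%:R * t ^+ k.-1 =
    m%:R * t ^+ m.-1.
  elim: m => [|m IH]; first by rewrite !big_ord0 mulr0 mul0r addr0.
  rewrite !big_ord_recr /= mulrDr addrACA IH -natr1.
  case: m {IH} => [|m]; first by rewrite !mul0r mulr0 !expr0; ring.
  by rewrite /= !exprS -natr1; ring.
have := key N.+2.
rewrite -profile_sumE -profile_root_sqr (_ : t - 1 = x ^+ 2); last first.
  by rewrite /t addrAC subrr add0r.
rewrite exprM jbracket_sqr -/t /= => <-.
rewrite /dS -mulr_suml; set s := \sum_(i < _) _.
by field; rewrite gt_eqF.
Qed.

Definition profile_nu x : R := (J x ^+ N.+2)^-1.

Local Notation nuJ := profile_nu.

Lemma profile_nu_gt0 x : 0 < nuJ x.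
Proof. by rewrite invr_gt0 exprn_gt0// jbracket_gt0. Qed.

Lemma Cn_profile_nu k : C1 k nuJ.
Proof.
apply: Cn_inv => [x|]; last by apply: Cn_exp; exact: Cn_jbracket.
by rewrite expf_neq0// gt_eqF// jbracket_gt0.
Qed.

(* With W the radial volume density: W / J^2 and |II|^2 W. *)
Definition profile_volume x : R := J x ^+ (2 * N).+3 / T x.
Definition angular_weight x : R := J x ^+ (2 * N).+1 / T x.
Definition potential x : R := (N.+3 * N.+2)%:R / (J x ^+ 3 * T x).

Local Notation W := profile_volume.
Local Notation q := angular_weight.
Local Notation V := potential.

Lemma profile_volume_gt0 x : 0 < W x.
Proof. by rewrite divr_gt0 ?exprn_gt0 ?jbracket_gt0 ?profile_root_gt0. Qed.

Lemma angular_weight_gt0 x : 0 < q x.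
Proof. by rewrite divr_gt0 ?exprn_gt0 ?jbracket_gt0 ?profile_root_gt0. Qed.

Let cont1 k f := @Cn_cont R R [set 1] k f.

Lemma continuous_jbracket : continuous J.
Proof. exact: cont1 (Cn_jbracket 0). Qed.

Let contTV : continuous (fun x => (T x)^-1).
Proof.
apply: (cont1 (k := 0)); apply: Cn_inv => [x|]; last exact: Cn_profile_root.
by rewrite gt_eqF// profile_root_gt0.
Qed.

Let contJX k : continuous (fun x => J x ^+ k).
Proof. by apply: (cont1 (k := 0)); apply: Cn_exp; exact: Cn_jbracket. Qed.

Lemma continuous_profile_volume : continuous W.
Proof. by move=> x; apply: cvgM; [exact: contJX|exact: contTV]. Qed.

Lemma continuous_angular_weight : continuous q.
Proof. by move=> x; apply: cvgM; [exact: contJX|exact: contTV]. Qed.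

Lemma continuous_potential : continuous V.
Proof.
apply: (cont1 (k := 0)); apply: Cn_mul; first exact: Cn_cst.
apply: Cn_inv => [x|].
  by rewrite mulf_neq0 ?expf_neq0 ?gt_eqF ?jbracket_gt0 ?profile_root_gt0.
by apply: Cn_mul; [apply: Cn_exp; exact: Cn_jbracket|exact: Cn_profile_root].
Qed.

(* (d^2 + (n - 2) d) is the d-th eigenvalue of the sphere. *)
Definition mode_potential (d : nat) x : R := (d * (d + N.+1))%:R * q x - V x.

Local Notation K := mode_potential.

Lemma continuous_mode_potential d : continuous (K d).
Proof.
move=> x; apply: cvgB; last exact: continuous_potential.
by apply: cvgM; [exact: cvg_cst|exact: continuous_angular_weight].
Qed.

Local Notation solves_mode := (sturm_solution A).

Let Jneq0 x : J x != 0. Proof. by rewrite gt_eqF// jbracket_gt0. Qed.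
Let Tneq0 x : T x != 0. Proof. by rewrite gt_eqF// profile_root_gt0. Qed.
Let Pneq0 x : J x ^+ N != 0. Proof. by rewrite expf_neq0. Qed.

Let geom x : x ^+ 2 = (J x ^+ N ^+ 2 * J x ^+ 4 - 1) / T x ^+ 2.
Proof.
apply: (mulIf (expf_neq0 2 (Tneq0 x))).
rewrite profile_root_geom divfK ?expf_neq0// -exprM -exprD; congr (_ ^+ _ - 1).
by rewrite -[N.+2]addn2 mulnC mulnDl.
Qed.

Let J2N x : J x ^+ (2 * N) = J x ^+ N * J x ^+ N.
Proof. by rewrite mul2n -addnn exprD. Qed.

Let J2N1 x : J x ^+ (2 * N.+1) = J x ^+ 2 * (J x ^+ N * J x ^+ N).
Proof. by rewrite mulnS exprD J2N. Qed.

(** Geometrically, translations orthogonal to the axis preserve minimality, and the component of the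
    unit normal along such a translation, omega_j times this function, is the corresponding Jacobi
    field. *)
Lemma solves_mode1 :
  solves_mode (K 1) nuJ (fun x => - (N.+2%:R * x / J x ^+ N.+4)).
Proof.
split=> x; first exact: is_derive_jbracketXV.
have [dT hT eT] := profile_root_derive x.
(* The root is made to occur only in the product y T(y), whose derivative [eT] gives in closed
   form. *)
have fE : (fun y => A y * - (N.+2%:R * y / J y ^+ N.+4)) =
    (fun y => - N.+2%:R * ((y * T y) * (J y ^+ N.+3)^-1)).
  apply/funext => y; rewrite /A !exprS; field.
  by rewrite Jneq0 Pneq0.
rewrite fE; apply: (is_derive_eq (is_derive_scalef _ (is_derive_mulf
  (is_derive_mulf (is_derive_id x (1 : R)) hT) (is_derive_jbracketXV _ x)))).
rewrite mulr1 [x * dT + T x]addrC eT /K /q /V /nuJ.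
rewrite (_ : x * T x * - (N.+3%:R * x / J x ^+ N.+3.+2) =
  - (N.+3%:R * (x ^+ 2 * T x) / J x ^+ N.+3.+2)); last by ring.
rewrite mul1n add1n natrM J2N1 geom !exprS !expr0 J2N.
 have := Pneq0 x; set P := J x ^+ N => P0.
by rewrite -!natr1; field; rewrite Jneq0 Tneq0 P0.
Qed.

(** Up to sign the component of the unit normal along the axis, which is the Jacobi field of
    translations along the axis. *)
Definition mode0_odd x : R := x * T x * nuJ x.

Lemma solves_mode0_odd :
  solves_mode (K 0) mode0_odd (fun x => N.+2%:R / (J x ^+ N.+4 * T x)).
Proof.
split=> x.
  have [dT hT eT] := profile_root_derive x.
  apply: (is_derive_eq (is_derive_mulf (is_derive_mulf
    (is_derive_id x (1 : R)) hT) (is_derive_jbracketXV _ x))).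
  rewrite mulr1 [x * dT + T x]addrC eT.
  rewrite (_ : x * T x * - (N.+2%:R * x / J x ^+ N.+2.+2) =
    - (N.+2%:R * (x ^+ 2 * T x) / J x ^+ N.+2.+2)); last by ring.
 rewrite J2N1 geom !exprS !expr0.
  have := Pneq0 x; set P := J x ^+ N => P0.
  by field; rewrite Jneq0 Tneq0 P0.
have fE : (fun y => A y * (N.+2%:R / (J y ^+ N.+4 * T y))) =
    (fun y => N.+2%:R * (J y ^+ N.+3)^-1).
  apply/funext => y; rewrite /A !exprS; field.
  by rewrite Jneq0 Pneq0 Tneq0.
rewrite fE; apply: (is_derive_eq (is_derive_scalef _ (is_derive_jbracketXV _ x))).
rewrite /K /V /mode0_odd /nuJ mul0r sub0r natrM !exprS.
have := Pneq0 x; set P := J x ^+ N => P0.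
by field; rewrite Jneq0 Tneq0 P0.
Qed.

(** For the height z of the profile this is the inner product of position and unit normal, the
    Jacobi field of dilations. Together with [mode0_odd] it spans the solutions for d = 0. *)
Definition mode0_even (z : R -> R) x : R := J x * nuJ x - z x * mode0_odd x.

Lemma solves_mode0_even (z : R -> R) :
  (forall x, is_derive x (1 : R) z (A x)^-1) ->
  solves_mode (K 0) (mode0_even z)
    (fun x => - (N.+2%:R * (mode0_odd x + z x / J x ^+ N.+3)) / A x).
Proof.
move=> hz; have [h1 h2] := solves_mode0_odd.
split=> x.
  have e1 := is_derive_mulf (is_derive_jbracket x) (is_derive_jbracketXV N.+2 x).
  apply: (is_derive_eq (is_derive_subf e1 (is_derive_mulf (hz x) (h1 x)))).
  rewrite /mode0_odd /nuJ /A !exprS; have := Pneq0 x; set P := J x ^+ N => P0.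
  rewrite -!natr1; set c : R := N%:R.
  rewrite (_ : J x * - ((c + 1 + 1) * x / (J x * (J x * (J x * (J x * P))))) +
    (J x * (J x * P))^-1 * (x / J x) = - ((c + 1) * x / (J x * (J x * (J x * P))))).
    by field; rewrite Jneq0 Tneq0 P0.
  by field; rewrite Jneq0 P0.
have fE : (fun y => A y * (- (N.+2%:R * (mode0_odd y + z y / J y ^+ N.+3)) / A y)) =
    (fun y => - N.+2%:R * (mode0_odd y + z y * (J y ^+ N.+3)^-1)).
  apply/funext => y; rewrite mulrC divfK ?mulNr//.
  by rewrite gt_eqF// profile_flux_gt0.
rewrite fE; apply: (is_derive_eq (is_derive_scalef _ (is_derive_addf (h1 x)
  (is_derive_mulf (hz x) (is_derive_jbracketXV _ x))))).
rewrite /K /V /mode0_even /mode0_odd /nuJ /A mul0r sub0r natrM !exprS.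
have := Pneq0 x; set P := J x ^+ N => P0.
by rewrite -!natr1; field; rewrite Jneq0 Tneq0 P0.
Qed.

End Profile.

(** * Test functions on the line and integration by parts *)

Section CompactSupport.
Variable R : realType.
Local Notation leb := (@lebesgue_measure R).
Local Notation Rm := (measurableTypeR R).
Local Notation C1 := (@Cn R R [set 1]).
Local Notation rI f := (Rintegral leb setT f).
Implicit Types f g h v : R -> R.

Definition compact_support f := exists B : R, forall x, B < `|x| -> f x = 0.

Definition test1 f := (forall k, C1 k f) /\ compact_support f.

Lemma compact_supportP f : compact_support f ->
  exists2 B : R, 0 < B & forall x, B <= `|x| -> f x = 0.
Proof.
move=> [B fB]; exists (`|B| + 1); first by rewrite ltr_wpDl.
move=> x Bx; apply: fB; apply: lt_le_trans Bx.
by rewrite (le_lt_trans (ler_norm B))// ltrDl.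
Qed.

Lemma compact_support_derive f df :
  (forall x, is_derive x (1 : R) f (df x)) ->
  compact_support f -> compact_support df.
Proof.
move=> hf [B fB]; exists B => x Bx.
have h : is_derive x (1 : R) f 0.
  apply: (@near_eq_is_derive R R R (cst 0)).
  near=> y; rewrite fB//; near: y.
  have : `|y| @[y --> x] --> `|x| by apply: cvg_norm; exact: cvg_id.
  by move/cvgr_gt; apply.
by rewrite -(@derive_val _ _ _ _ _ _ _ (hf x)) (@derive_val _ _ _ _ _ _ _ h).
Unshelve. all: by end_near. Qed.

Lemma compact_support_mull f g : compact_support g ->
  compact_support (fun x => f x * g x).
Proof. by move=> [B gB]; exists B => x /gB ->; rewrite mulr0. Qed.

Lemma compact_support_sub f g : compact_support f -> compact_support g ->
  compact_support (fun x => f x - g x).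
Proof.
move=> [A fA] [B gB]; exists (Num.max A B) => x.
by rewrite gt_max => /andP[/fA -> /gB ->]; rewrite subr0.
Qed.

Lemma test1_sub f g : test1 f -> test1 g -> test1 (fun x => f x - g x).
Proof.
move=> [cf sf] [cg sg]; split=> [k|]; first exact: Cn_sub.
exact: compact_support_sub.
Qed.

Lemma test1_scale (c : R) f : test1 f -> test1 (fun x => c * f x).
Proof.
move=> [cf sf]; split=> [k|]; last exact: compact_support_mull.
by apply: Cn_mul => //; exact: Cn_cst.
Qed.

Lemma continuous_itv_integrable g : continuous g -> itv_integrable g.
Proof. by move=> cg a b; exact: integrable_continuous_itv. Qed.

Lemma bounded_on_segment g B : 0 <= B -> continuous g ->
  exists C, forall x, `|x| <= B -> `|g x| <= C.
Proof.
move=> B0 cg.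
have cng : {within `[- B, B], continuous (fun x => `|g x|)}.
  apply: continuous_subspaceT => x.
  by apply: cvg_norm; exact: cg.
have [c _ hc] := EVT_max (ge0_cp B0).2 cng.
exists `|g c| => x xB; apply: hc.
by rewrite in_itv/= -ler_norml.
Qed.

Lemma integrable_mul_compact v g : measurable_fun setT (v : Rm -> R) ->
  itv_integrable v -> continuous g -> compact_support g ->
  leb.-integrable setT (EFin \o (fun x => v x * g x)).
Proof.
move=> mv iv cg /compact_supportP[B B0 gB].
have [C hC] := bounded_on_segment (ltW B0) cg.
have C0 : 0 <= C by apply: le_trans (hC 0 _); rewrite ?normr0 ?(ltW B0).
apply: (@integrable_le _ Rm R leb _ (fun x => C * `|(v \_ `[- B, B]) x|)).
- apply: measurable_funM => //; exact: continuous_measurable_fun.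
- move=> x; rewrite normrM mulrC patchE; case: ifPn => [/set_mem/=|].
    by rewrite in_itv/= -ler_norml => xB; rewrite ler_wpM2r// hC.
  move=> /negP xB; rewrite gB ?normr0 ?mul0r ?mulr0//.
  rewrite leNgt; apply/negP => xB'; apply: xB; apply/mem_set => /=.
  by rewrite in_itv/= -ler_norml ltW.
- have i1 : leb.-integrable setT (EFin \o (v \_ `[- B, B])).
    by rewrite -restrict_EFin; apply/(integrable_mkcond _ _).1 => //; exact: iv.
  exact: (integrableZl measurableT C (integrable_abse i1)).
Qed.

Lemma integrable_compact g : continuous g -> compact_support g ->
  leb.-integrable setT (EFin \o g).
Proof.
move=> cg sg; rewrite (_ : g = fun x => cst 1 x * g x).
  apply: integrable_mul_compact => //.
  by apply: continuous_itv_integrable; exact: cst_continuous.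
by apply/funext => x; rewrite mul1r.
Qed.

Lemma itv_integrable_mul v g : measurable_fun setT (v : Rm -> R) ->
  itv_integrable v -> continuous g -> itv_integrable (fun x => v x * g x).
Proof.
move=> mv iv cg a b.
have ab0 : 0 <= `|a| + `|b| by rewrite addr_ge0.
have [C hC] := bounded_on_segment ab0 cg.
have abC x : x \in `[a, b] -> `|x| <= `|a| + `|b|.
  rewrite in_itv/= ler_norml => /andP[ax xb]; apply/andP; split.
    rewrite (le_trans _ ax)// lerNl (le_trans _ (_ : `|a| <= _)) ?lerDl//.
    by rewrite -normrN ler_norm.
  by rewrite (le_trans xb)// (le_trans (ler_norm b))// lerDr.
apply: (@le_integrable _ Rm R leb _ _ _ (fun x => C%:E * (v x)%:E)%E) => //.
- apply/measurable_EFinP; apply/measurable_funTS/measurable_funM => //.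
  exact: continuous_measurable_fun.
- move=> x /= abx; rewrite lee_fin normrM [leRHS]normrM mulrC ler_wpM2r//.
  by rewrite (le_trans (hC _ _) (ler_norm _))// abC.
- by apply: integrableZl => //; exact: iv.
Qed.

Lemma itv_integrable_sub v g : itv_integrable v -> itv_integrable g ->
  itv_integrable (fun x => v x - g x).
Proof.
move=> iv ig a b; rewrite (_ : EFin \o _ = (EFin \o v) \- (EFin \o g))%E//.
by apply: integrableB.
Qed.

Lemma Rintegral_derive0 f df : (forall x, is_derive x (1 : R) f (df x)) ->
  continuous df -> compact_support f -> rI df = 0.
Proof.
move=> hf cdf sf; have sdf := compact_support_derive hf sf.
have [B B0 fB] := compact_supportP sf.
rewrite /Rintegral (@integral_derive0 _ f df)//.
- exact: integrable_compact.
- apply: cvg_near_cst; near=> x; apply: fB.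
  by rewrite (le_trans _ (ler_norm x))//; near: x; apply: nbhs_pinfty_ge; exact: num_real.
- apply: cvg_near_cst; near=> x; apply: fB.
  rewrite -normrN (le_trans _ (ler_norm (- x)))// lerNr.
  by near: x; apply: nbhs_ninfty_le; exact: num_real.
Unshelve. all: by end_near. Qed.

Lemma ibp_compact f df g dg :
  (forall x, is_derive x (1 : R) f (df x)) -> continuous df ->
  (forall x, is_derive x (1 : R) g (dg x)) -> continuous dg ->
  compact_support g ->
  rI (fun x => f x * dg x) = - rI (fun x => df x * g x).
Proof.
move=> hf cdf hg cdg sg; have sdg := compact_support_derive hg sg.
have cont (k dk : R -> R) :
  (forall x, is_derive x (1 : R) k (dk x)) -> continuous k.
  move=> hk x; apply/differentiable_continuous/derivable1_diffP.
  by have [] := hk x.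
have cf := cont _ _ hf; have cg := cont _ _ hg.
have cM (a b : R -> R) : continuous a -> continuous b ->
  continuous (fun x => a x * b x) by move=> ca cb x; apply: cvgM; [exact: ca|exact: cb].
have : rI (fun x => f x * dg x + df x * g x) = 0.
  apply: (@Rintegral_derive0 (fun x => f x * g x)).
  - by move=> x; rewrite [df x * _]mulrC; exact: is_derive_mulf.
  - by move=> x; apply: cvgD; exact: cM.
  - exact: compact_support_mull.
rewrite RintegralD//; last 2 first.
- by apply: integrable_compact; [exact: cM|exact: compact_support_mull].
- by apply: integrable_compact; [exact: cM|exact: compact_support_mull].
by move/eqP; rewrite addr_eq0 => /eqP.
Qed.

(* The primitive of [h] is only absolutely continuous, so this is Fubini's
   theorem on a triangle. *)
Lemma ibp_primitive h g dg : measurable_fun setT (h : Rm -> R) ->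
  itv_integrable h -> (forall x, is_derive x (1 : R) g (dg x)) ->
  continuous dg -> compact_support g ->
  rI (fun x => primitive h x * dg x) = - rI (fun x => h x * g x).
Proof.
move=> mh ih hg cdg sg; have sdg := compact_support_derive hg sg.
have cg : continuous g.
  move=> x; apply/differentiable_continuous/derivable1_diffP.
  by have [] := hg x.
have [M1 M10 gM1] := compact_supportP sg.
have [M2 M20 gM2] := compact_supportP sdg.
pose M := Num.max M1 M2.
have gM x : M <= `|x| -> g x = 0.
  by rewrite ge_max => /andP[? _]; exact: gM1.
have dgM x : M <= `|x| -> dg x = 0.
  by rewrite ge_max => /andP[_ ?]; exact: gM2.
have M0 : 0 <= M by rewrite le_max (ltW M10).
pose hM := h \_ `[- M, M].
have mhM : measurable_fun setT (hM : Rm -> R).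
  by apply/(measurable_restrictT _ _).1 => //; exact/measurable_funTS.
have ihM : leb.-integrable setT (EFin \o hM).
  rewrite -restrict_EFin; apply/(integrable_mkcond _ _).1 => //; exact: ih.
have mdg : measurable_fun setT (dg : Rm -> R) by exact: continuous_measurable_fun.
have idg : leb.-integrable setT (EFin \o dg) by exact: integrable_compact.
pose F (p : Rm * Rm) : R :=
  dg p.1 * hM p.2 * (\1_(`[0, +oo[%classic : set R) (p.1 - p.2 : R) : R).
have mF : measurable_fun setT F.
  apply: measurable_funM.
    apply: measurable_funM.
      by apply: (@measurableT_comp _ _ _ _ _ _ (dg : Rm -> R)).
    by apply: (@measurableT_comp _ _ _ _ _ _ (hM : Rm -> R)).
  apply: (@measurableT_comp _ _ _ _ _ _ (\1_(`[0, +oo[%classic : set R) : R -> R)).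
    exact: measurable_indic.
  by apply: measurable_funB.
have iF : (leb \x leb)%E.-integrable setT (EFin \o F).
  apply/integrable12ltyP; first exact/measurable_EFinP.
  apply: (@le_lt_trans _ _ (\int[leb]_x (`|(dg x)%:E| *
      \int[leb]_y `|(hM y)%:E|))%E).
    apply: ge0_le_integral => //.
    - by move=> x _; apply: integral_ge0.
    - apply: (measurable_fun_fubini_tonelli_F (fun p => `|(EFin \o F) p|%E)) => //.
      by apply: measurableT_comp => //; exact/measurable_EFinP.
    - apply: emeasurable_funM => //.
      by apply: measurableT_comp => //; exact/measurable_EFinP.
    move=> x _; rewrite -ge0_integralZl//; last first.
      by apply: measurableT_comp => //; exact/measurable_EFinP.
    apply: ge0_le_integral => //.
    - apply: measurableT_comp => //; apply: (measurable_fun_pair2 (f := EFin \o F)).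
      exact/measurable_EFinP.
    - apply: emeasurable_funM => //.
      by apply: measurableT_comp => //; exact/measurable_EFinP.
    move=> y _; rewrite -abseM lee_fin /F /= [leLHS]normrM ler_piMr//.
    by rewrite indicE; case: (_ \in _); rewrite ?normr1 ?normr0.
  rewrite ge0_integralZr//; last 2 first.
  - by apply: measurableT_comp => //; exact/measurable_EFinP.
  - by apply: integral_ge0.
  apply: lte_mul_pinfty; first exact: integral_ge0.
    rewrite ge0_fin_numE ?integral_ge0//.
    by have /integrableP[] := idg.
  by have /integrableP[] := ihM.
have indE x y : (\1_(`[0, +oo[%classic : set R) (x - y : R) : R) = (y <= x)%R%:R.
  by rewrite indicE mem_setE in_itv/= andbT subr_ge0.
(* Integrating in y gives the primitive based at -M. The constant by which it differs from
   [primitive h] multiplies [dg], whose integral is 0. *)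
have e1 x : (\int[leb]_y (EFin \o F) (x, y) =
    (primitive h x * dg x + Rintegral leb `[- M, 0] h * dg x)%:E)%E.
  have [xM|xM] := leP M `|x|.
    rewrite dgM// !mulr0 addr0.
    by rewrite integral0_eq// => y _; rewrite /F /= dgM// !mul0r.
  move: xM; rewrite ltr_norml => /andP[Mx xM].
  rewrite -mulrDl (@primitiveE _ h M)// ?(ltW Mx)// subrK mulrC EFinM.
  rewrite /Rintegral fineK; last first.
    by apply: integrable_fin_num => //; exact: ih.
  rewrite -(integralZl _ (ih (- M) x))//.
  rewrite [RHS]integral_mkcond; apply: eq_integral => y _.
  rewrite /F /= patchE indE /hM patchE.
  case: ifPn => [/set_mem/=|/negP yM].
    rewrite in_itv/= => /andP[My yM]; case: ifPn => [/set_mem/=|/negP yx].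
      by rewrite in_itv/= => /andP[_ ->]; rewrite mulr1 EFinM.
    rewrite [y <= x](_ : _ = false) ?mulr0//; apply/negbTE/negP => yx'.
    by apply: yx; apply/mem_set; rewrite /= in_itv/= My.
  rewrite mulr0 mul0r ifF//; apply/negbTE/negP => /set_mem/=.
  rewrite in_itv/= => /andP[My yx]; apply: yM; apply/mem_set.
  by rewrite /= in_itv/= My (le_trans yx) ?ltW.
have e2 y : (\int[leb]_x (EFin \o F) (x, y) = (- (h y * g y))%:E)%E.
  rewrite /F /= /hM patchE; case: ifPn => [/set_mem/=|/negP yM].
    rewrite in_itv/= => /andP[My yM].
    transitivity (\int[leb]_(x in `[y, M]) (h y * dg x)%:E)%E.
      rewrite [RHS]integral_mkcond; apply: eq_integral => x _.
      rewrite /= patchE indE; case: ifPn => [/set_mem/=|/negP xyM].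
        by rewrite in_itv/= => /andP[-> _]; rewrite mulr1 mulrC.
      case: (leP y x) => yx /=; last by rewrite mulr0.
      rewrite dgM ?mul0r// (le_trans _ (ler_norm x))// leNgt; apply/negP => xM.
      by apply: xyM; apply/mem_set; rewrite /= in_itv/= yx ltW.
    have hh x : is_derive x (1 : R) (fun x => h y * g x) (h y * dg x).
      exact: is_derive_scalef.
    rewrite (integral_FTC yM hh); last first.
      by move=> x; apply: cvgM; [exact: cvg_cst|exact: cdg].
    by rewrite (gM M) ?ger0_norm// mulr0 sub0r.
  rewrite (gM y) ?mulr0 ?oppr0.
    by rewrite integral0_eq// => x _; rewrite mulr0 mul0r.
  rewrite leNgt; apply/negP => yM'; apply: yM; apply/mem_set => /=.
  by rewrite in_itv/= -ler_norml ltW.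
have := Fubini iF; under eq_integral do rewrite e1.
under [X in _ = X]eq_integral do rewrite e2.
move=> /(congr1 fine); rewrite -!/(Rintegral _ _ _).
have cP := continuous_primitive ih.
have mP : measurable_fun setT (primitive h : Rm -> R).
  exact: continuous_measurable_fun.
rewrite RintegralD//; last 2 first.
- by apply: integrable_mul_compact => //; exact: continuous_itv_integrable.
- apply: (integrable_mul_compact (v := cst _)) => //.
  by apply: continuous_itv_integrable; exact: cst_continuous.
rewrite RintegralZl// (Rintegral_derive0 hg)// mulr0 addr0 => ->.
rewrite -[RHS]mulN1r -RintegralZl//; last exact: integrable_mul_compact.
by apply: eq_Rintegral => x _; rewrite mulN1r.
Qed.

End CompactSupport.

(** * Regularity of weak solutions *)

Section WeakSolutions.
Variable R : realType.
Local Notation leb := (@lebesgue_measure R).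
Local Notation Rm := (measurableTypeR R).
Local Notation C1 := (@Cn R R [set 1]).
Local Notation rI f := (Rintegral leb setT f).
Implicit Types f g h v : R -> R.

Definition loc_integrable f :=
  measurable_fun setT (f : Rm -> R) /\ itv_integrable f.

Lemma continuous_loc_integrable f : continuous f -> loc_integrable f.
Proof.
move=> cf; split; first exact: continuous_measurable_fun.
exact: continuous_itv_integrable.
Qed.

Lemma loc_integrable_sub f g : loc_integrable f -> loc_integrable g ->
  loc_integrable (fun x => f x - g x).
Proof.
move=> [mf hf] [mg hg]; split; first exact: measurable_funB.
exact: itv_integrable_sub.
Qed.

Lemma loc_integrable_mul f g : loc_integrable f -> continuous g ->
  loc_integrable (fun x => f x * g x).
Proof.
move=> [mf hf] cg; split; last exact: itv_integrable_mul.
by apply: measurable_funM => //; exact: continuous_measurable_fun.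
Qed.

Lemma test1_cont f : test1 f -> continuous f.
Proof. by move=> [/(_ 0%N) cf _]; exact: Cn_cont cf. Qed.

Lemma loc_integrable_test f a : loc_integrable f -> test1 a ->
  leb.-integrable setT (EFin \o (fun x => f x * a x)).
Proof.
move=> [mf hf] ta; apply: integrable_mul_compact => //.
  exact: test1_cont.
by case: ta.
Qed.

Lemma pair_subr f a b : loc_integrable f -> test1 a -> test1 b ->
  rI (fun x => f x * (a x - b x)) = rI (fun x => f x * a x) - rI (fun x => f x * b x).
Proof.
move=> hf ta tb; rewrite -RintegralB//; [|exact: loc_integrable_test..].
by apply: eq_Rintegral => x _; rewrite mulrBr.
Qed.

Lemma pair_subl f g a : loc_integrable f -> loc_integrable g -> test1 a ->
  rI (fun x => (f x - g x) * a x) = rI (fun x => f x * a x) - rI (fun x => g x * a x).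
Proof.
move=> hf hg ta; rewrite -RintegralB//; [|exact: loc_integrable_test..].
by apply: eq_Rintegral => x _; rewrite mulrBl.
Qed.

Lemma pair_scaler f c a : loc_integrable f -> test1 a ->
  rI (fun x => f x * (c * a x)) = c * rI (fun x => f x * a x).
Proof.
move=> hf ta; rewrite -RintegralZl//; last exact: loc_integrable_test.
by apply: eq_Rintegral => x _; rewrite mulrCA.
Qed.

Lemma pair_scalel f c a : loc_integrable f -> test1 a ->
  rI (fun x => (c * f x) * a x) = c * rI (fun x => f x * a x).
Proof.
move=> hf ta; rewrite -RintegralZl//; last exact: loc_integrable_test.
by apply: eq_Rintegral => x _; rewrite mulrA.
Qed.

Lemma test1_mul f a : (forall k, C1 k f) -> test1 a -> test1 (fun x => f x * a x).
Proof.
move=> cf [ca sa]; split=> [k|]; first exact: Cn_mul.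
exact: compact_support_mull.
Qed.

Lemma test1_derive f : test1 f -> test1 ('D_1 f).
Proof.
move=> [cf sf]; split=> [k|]; first by apply: Cn_derive => //; exact: cf.
apply: compact_support_derive sf => x; exact: (Cn_is_derive x 1 (cf 1%N)).
Qed.

Lemma test1_bump (e a b : R) : 0 < e -> test1 (bump e a b).
Proof.
move=> e0; split=> [k|]; first exact: Cn_bump.
exists (`|a| + `|b|) => x abx; rewrite bumpE; case: ifPn => // /andP[ax xb].
exfalso; move: abx; apply/negP; rewrite -leNgt ler_norml; apply/andP; split.
  by have := ler_norm (- a); have := normr_ge0 b; rewrite normrN; lra.
by have := ler_norm b; have := normr_ge0 a; lra.
Qed.

Lemma ae0_line f : continuous f -> {ae leb, forall x, f x = 0} ->
  forall x, f x = 0.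
Proof.
move=> cf [N [mN N0 fN]] x; apply: contrapT => /eqP fx0.
have /nbhs_ballP[e /= e0 xe] : nbhs x (f @^-1` [set y | y != 0]).
  by apply: cf; apply: open_nbhs_nbhs; split; [exact: open_neq|].
have BN : ball x e `<=` N.
  by move=> y xy; apply: fN => /= fy0; have := xe _ xy; rewrite /= fy0 eqxx.
have : (leb (ball x e : set R) <= 0)%E.
  by rewrite -N0 le_measure ?inE//; exact: measurable_ball.
have -> : leb (ball x e : set R) = (e *+ 2)%:E.
  by apply: lebesgue_measure_ball; exact: ltW.
by rewrite lee_fin leNgt mulrn_wgt0.
Qed.

(** Testing against [bump] with e = 1/(k+1) and letting k grow shows that [f] integrates to 0 over
    every bounded open interval; these intervals form a pi-system generating the Borel sets. *)
Lemma ae0_of_test f : loc_integrable f ->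
  (forall a, test1 a -> rI (fun x => f x * a x) = 0) ->
  {ae leb, forall x, f x = 0}.
Proof.
move=> [mf hf] f0.
have itv0 a b : (\int[leb]_(x in `]a, b[) (f x)%:E = 0)%E.
  pose f_ k x := f x * bump k.+1%:R^-1 a b x.
  pose g := fun x => `|(f \_ `[a, b]) x|.
  have k0 k : (0 : R) < k.+1%:R^-1 by rewrite invr_gt0.
  have ig : leb.-integrable setT (EFin \o g).
    have h : leb.-integrable setT (EFin \o (f \_ `[a, b])).
      by rewrite -restrict_EFin; apply/(integrable_mkcond _ _).1 => //; exact: hf.
    exact: (integrable_abse h).
  have mfab : measurable_fun setT ((f \_ `]a, b[) : Rm -> R).
    by apply/(measurable_restrictT _ _).1 => //; exact/measurable_funTS.
  have mf_ k : measurable_fun setT (f_ k : Rm -> R).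
    apply: measurable_funM => //; apply: continuous_measurable_fun.
    by apply: test1_cont; exact: test1_bump.
  have f_f x : f_ ^~ x @ \oo --> (f \_ `]a, b[) x.
    rewrite patchE; case: ifPn => [/set_mem/=|/negP abx].
      rewrite in_itv/= => abx; rewrite -[X in _ --> X]mulr1.
      apply: cvgM; first exact: cvg_cst.
      have -> : (fun k : nat => bump k.+1%:R^-1 a b x) =
          (fun k : nat => expR (- (k.+1%:R^-1 * (x - a)^-1)) *
             expR (- (k.+1%:R^-1 * (b - x)^-1))).
        by apply/funext => k; rewrite bumpE abx.
      have hh (c : R) : (fun k : nat => expR (- (k.+1%:R^-1 * c))) @ \oo --> expR 0.
        apply: continuous_cvg; first exact: continuous_expR.
        rewrite -[X in _ --> X]oppr0; apply: cvgN.
        rewrite -[X in _ --> X](mul0r c); apply: cvgM; last exact: cvg_cst.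
        exact: cvg_harmonic.
      have h := cvgM (hh (x - a)^-1) (hh (b - x)^-1).
      rewrite expR0 mulr1 in h.
      exact: h.
    rewrite (_ : f_ ^~ x = cst 0); first exact: cvg_cst.
    apply/funext => k; rewrite /f_ bumpE ifF ?mulr0//; apply/negbTE/negP => h.
    by apply: abx; apply/mem_set; rewrite /= in_itv/=.
  have f_g k x : `|f_ k x| <= g x.
    rewrite /f_ bumpE; case: ifPn => [/andP[ax xb]|_]; last by rewrite mulr0 normr0 normr_ge0.
    rewrite /g patchE ifT; last by apply/mem_set; rewrite /= in_itv/= !ltW.
    rewrite normrM ler_piMr// ger0_norm ?mulr_ge0 ?expR_ge0//.
    by have := bump_le1 (k0 k) a b x; rewrite bumpE ax xb.
  have := @dominated_cvg_EFin _ Rm R leb _ _ _ mf_ mfab f_f ig f_g.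
  rewrite (_ : (fun k => _) = cst 0%E); last first.
    apply/funext => k; have tk := test1_bump a b (k0 k).
    have /Rintegral_EFin -> := @loc_integrable_test f _ (conj mf hf) tk.
    by rewrite f0.
  move=> h; rewrite integral_mkcond restrict_EFin.
  exact: (cvg_unique _ h (@cvg_cst _ _ _ _ _)).
have itvI (a b c d : R) : `]a, b[ `&` `]c, d[ =
    `]Num.max a c, Num.min b d[%classic.
  apply/seteqP; split=> x /=; rewrite !in_itv/= gt_max lt_min.
    by move=> [/andP[-> ->] /andP[-> ->]].
  by move=> /andP[/andP[-> ->] /andP[-> ->]].
(* The cutoff turns local integrability into the integrability on the whole line that the pi-system
   argument asks for. *)
pose G (M : nat) := f \_ `](- M%:R), M%:R[.
have GE (M : nat) : {ae leb, forall x, G M x = 0}.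
  have iG : leb.-integrable setT (EFin \o G M).
    rewrite /G -restrict_EFin; apply/(integrable_mkcond _ _).1 => //.
    apply: integrableS (hf (- M%:R) M%:R) => //.
    exact: subset_itv_oo_cc.
  apply: (@ae0_of_pi_system _ Rm R leb (@RGenOpens.G R)) => //.
  - exact: RGenOpens.measurableE.
  - move=> _ _ [a [b ->]] [c [d ->]]; exists (Num.max a c), (Num.min b d).
    exact: itvI.
  - rewrite -[RHS](itv0 (- M%:R) M%:R) [RHS]integral_mkcond.
    by apply: eq_integral => x _; rewrite restrict_EFin.
  - move=> _ [a [b ->]].
    rewrite (_ : (fun x => _) = (EFin \o f) \_ `](- M%:R), M%:R[); last first.
      by rewrite restrict_EFin.
    rewrite -integral_mkcondr itvI; exact: itv0.
apply: (ae_mono (ae_foralln GE)) => x Gx.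
have [M xM] : exists M : nat, `|x| < M%:R.
  by exists (Num.truncn `|x|).+1; rewrite truncnS_gt.
have := Gx M; rewrite /G patchE ifT//; apply/mem_set.
by rewrite /= in_itv/= -ltr_norml.
Qed.

Lemma test1_antiderivative b : test1 b -> rI b = 0 ->
  exists2 g, test1 g & forall x, is_derive x (1 : R) g (b x).
Proof.
move=> tb b0; have cb := test1_cont tb.
have [cbk /compact_supportP[B B0 bB]] := tb.
pose g x := primitive b x - primitive b (- B).
have dg x : is_derive x (1 : R) g (b x).
  have h := is_derive_primitive x cb.
  by apply: is_derive_eq; rewrite subr0.
exists g => //; split=> [k|].
  by apply: CnW; apply: is_derive1_Cn dg _; exact: cbk.
have FTC a c : a <= c -> (\int[leb]_(x in `[a, c]) (b x)%:E = (g c - g a)%:E)%E.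
  by move=> ac; exact: integral_FTC.
have gB : g (- B) = 0 by rewrite /g subrr.
exists B => x; have [x0|x0] := leP 0 x.
  rewrite ger0_norm// => Bx.
  have : (\int[leb]_(y in `[(- B)%R, x]) (b y)%:E = 0)%E.
    rewrite -[RHS](_ : (\int[leb]_y (b y)%:E = 0)%E); last first.
      rewrite Rintegral_EFin ?b0//; apply: integrable_compact => //.
      by case: tb.
    rewrite integral_mkcond; apply: eq_integral => y _.
    rewrite patchE; case: ifPn => // /negP yx.
    rewrite bB// leNgt ltr_norml; apply/negP => /andP[y1 y2]; apply: yx.
    by apply/mem_set; rewrite /= in_itv/= !ltW//; lra.
  by rewrite FTC; [rewrite gB subr0 => -[]|lra].
rewrite ltr0_norm// => Bx.
have : (\int[leb]_(y in `[x, (- B)%R]) (b y)%:E = 0)%E.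
  rewrite integral0_eq// => y /=; rewrite in_itv/= => /andP[_ yB].
  by rewrite bB// -normrN (le_trans _ (ler_norm _))// lerNr.
rewrite FTC; last by lra.
by rewrite gB sub0r => -[] /eqP; rewrite oppr_eq0 => /eqP.
Qed.

Variable A : R -> R.
Hypothesis A0 : forall x, 0 < A x.
Hypothesis CA : forall k, C1 k A.

Let z := primitive (fun x => (A x)^-1).

Let cAV k : C1 k (fun x => (A x)^-1).
Proof. by apply: Cn_inv => // x; rewrite gt_eqF. Qed.

Let dz x : is_derive x (1 : R) z (A x)^-1.
Proof. by apply: is_derive_primitive; exact: Cn_cont (cAV 0). Qed.

Let cz : continuous z.
Proof.
move=> x; apply/differentiable_continuous/derivable1_diffP.
by have [] := dz x.
Qed.

(** The kernel of v -> (A v')' is spanned by 1 and [z]. Orthogonality to 1 makes the antiderivative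
    g of [b] compactly supported; orthogonality to [z], after an integration by parts, does the same
    for the antiderivative of g / A. *)
Lemma flux_surjective b : test1 b -> rI b = 0 -> rI (fun x => z x * b x) = 0 ->
  exists2 a, test1 a & b = 'D_1 (fun y => A y * 'D_1 a y).
Proof.
move=> tb b0 zb0; have [g tg dg] := test1_antiderivative tb b0.
have tgA : test1 (fun x => (A x)^-1 * g x) by exact: test1_mul.
have gA0 : rI (fun x => (A x)^-1 * g x) = 0.
  have := ibp_compact dz (Cn_cont (cAV 0)) dg (test1_cont tb) tg.2.
  by rewrite zb0 => /esym/eqP; rewrite oppr_eq0 => /eqP.
have [a ta da] := test1_antiderivative tgA gA0.
exists a => //; apply/funext => x.
rewrite (_ : (fun y => A y * 'D_1 a y) = g).
  by rewrite (@derive_val _ _ _ _ _ _ _ (dg x)).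
apply/funext => y; rewrite (@derive_val _ _ _ _ _ _ _ (da y)).
by rewrite mulrA mulfV ?mul1r// gt_eqF.
Qed.

(** Two test functions dual to 1 and z - c correct an arbitrary test function to one in the image
    described by [flux_surjective], which [f] annihilates. So [f] acts on test functions like a
    combination of 1 and [z]. *)
Lemma du_bois_reymond f : loc_integrable f ->
  (forall a, test1 a -> rI (fun x => f x * 'D_1 (fun y => A y * 'D_1 a y) x) = 0) ->
  exists c1 c2, {ae leb, forall x, f x = c1 + c2 * z x}.
Proof.
move=> hf f0.
have lz : loc_integrable z by exact: continuous_loc_integrable.
have l1 (c : R) : loc_integrable (cst c).
  by apply: continuous_loc_integrable; exact: cst_continuous.
pose I (b : R -> R) := rI (fun x => cst 1 x * b x).
have IE b : I b = rI b by apply: eq_Rintegral => x _; rewrite mul1r.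
have [t1 tt1 It1] : exists2 t, test1 t & I t = 1.
  have [t [tt It]] : exists t, test1 t /\ I t != 0.
    apply: contrapT => h.
    have : {ae leb, forall x : R, cst 1 x = 0 :> R}.
      apply: (ae0_of_test (l1 1)) => a ta; apply: contrapT => /eqP Ia.
      by apply: h; exists a.
    have c1 : continuous (cst 1 : R -> R) by exact: cst_continuous.
    by move=> /(ae0_line c1) /(_ 0)/= /eqP; rewrite oner_eq0.
  exists (fun x => (I t)^-1 * t x); first exact: test1_scale.
  by rewrite /I pair_scaler// mulVf.
(* Shifting [z] by c makes it orthogonal to [t1], so that [t1] and the later [t2] are exactly dual
   to 1 and z - c. *)
pose c := rI (fun x => z x * t1 x).
have lzc : loc_integrable (fun x => z x - cst c x) by exact: loc_integrable_sub.
pose Z (b : R -> R) := rI (fun x => (z x - cst c x) * b x).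
have Zt1 : Z t1 = 0.
  rewrite /Z pair_subl//; apply/eqP; rewrite subr_eq0; apply/eqP.
  rewrite -/c -[LHS]mulr1 -It1 /I -pair_scalel//.
  by apply: eq_Rintegral => x _; rewrite mulr1.
have [t2 tt2 [It2 Zt2]] : exists2 t, test1 t & I t = 0 /\ Z t = 1.
  have [t [tt Zt]] : exists t, test1 t /\ Z t != 0.
    apply: contrapT => h.
    have : {ae leb, forall x : R, z x - cst c x = 0}.
      apply: (ae0_of_test lzc) => a ta; apply: contrapT => /eqP Ia.
      by apply: h; exists a.
    have czc : continuous (fun x => z x - cst c x).
      by move=> x; apply: cvgB; [exact: cz|exact: cvg_cst].
    move=> /(ae0_line czc) zc.
    have : is_derive (0 : R) (1 : R) (fun x => z x - cst c x) ((A 0)^-1).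
      by have h0 := dz 0; apply: is_derive_eq; rewrite subr0.
    rewrite (_ : (fun x => _) = cst 0); last by apply/funext => x; exact: zc.
    move=> hd; have := @derive_val _ _ _ _ _ _ _ hd.
    by rewrite derive_cst => /esym/eqP; rewrite invr_eq0 gt_eqF.
  pose t' x := t x - I t * t1 x.
  have tt' : test1 t' by apply: test1_sub => //; exact: test1_scale.
  have It' : I t' = 0.
    rewrite /I /t' pair_subr//; last exact: test1_scale.
    by rewrite pair_scaler// -/(I t) -/(I t1) It1 mulr1 subrr.
  have Zt' : Z t' = Z t.
    rewrite /Z /t' pair_subr//; last exact: test1_scale.
    by rewrite pair_scaler// -/(Z t) -/(Z t1) Zt1 mulr0 subr0.
  exists (fun x => (Z t)^-1 * t' x); first exact: test1_scale.
  by rewrite /I /Z !pair_scaler// -/(I t') -/(Z t') It' Zt' mulr0 mulVf.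
pose a1 := rI (fun x => f x * t1 x); pose a2 := rI (fun x => f x * t2 x).
pose w x := a1 * cst 1 x + a2 * (z x - cst c x).
have lw : loc_integrable w.
  apply: continuous_loc_integrable => x; apply: cvgD.
    by apply: cvgM; exact: cvg_cst.
  by apply: cvgM; [exact: cvg_cst|apply: cvgB; [exact: cz|exact: cvg_cst]].
have wE b : test1 b -> rI (fun x => w x * b x) = a1 * I b + a2 * Z b.
  move=> tb; rewrite /I /Z -!pair_scalel// -RintegralD//; last 2 first.
  - apply: loc_integrable_test => //; apply: continuous_loc_integrable => x.
    by apply: cvgM; exact: cvg_cst.
  - apply: loc_integrable_test => //; apply: continuous_loc_integrable => x.
    by apply: cvgM; [exact: cvg_cst|apply: cvgB; [exact: cz|exact: cvg_cst]].
  by apply: eq_Rintegral => x _; rewrite -mulrDl.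
have lfw : loc_integrable (fun x => f x - w x) by exact: loc_integrable_sub.
have : {ae leb, forall x, f x - w x = 0}.
  apply: (ae0_of_test lfw) => b tb.
  pose b' x := b x - (I b * t1 x - (- Z b) * t2 x).
  have tb12 : test1 (fun x => I b * t1 x - (- Z b) * t2 x).
    by apply: test1_sub; exact: test1_scale.
  have tb' : test1 b' by exact: test1_sub.
  have E h : loc_integrable h -> rI (fun x => h x * b' x) = rI (fun x => h x * b x)
      - (I b * rI (fun x => h x * t1 x) + Z b * rI (fun x => h x * t2 x)).
    move=> lh; rewrite /b' pair_subr// pair_subr//; [|exact: test1_scale..].
    by rewrite !pair_scaler// mulNr opprK.
  have Ib' : I b' = 0.
    by rewrite /I E// -!/(I _) It1 It2 mulr0 addr0 mulr1 subrr.
  have Zb' : Z b' = 0.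
    by rewrite /Z E// -!/(Z _) Zt1 Zt2 mulr0 add0r mulr1 subrr.
  have zb' : rI (fun x => z x * b' x) = 0.
    have := Zb'; rewrite /Z pair_subl// => /eqP; rewrite subr_eq0 => /eqP ->.
    rewrite -[RHS](mulr0 c) -[in RHS]Ib' /I -pair_scalel//.
    by apply: eq_Rintegral => x _; rewrite mulr1.
  have [a ta b'E] := flux_surjective tb' (etrans (esym (IE b')) Ib') zb'.
  have fb' : rI (fun x => f x * b' x) = 0 by rewrite b'E; exact: f0.
  have := fb'; rewrite E// -/a1 -/a2 => /eqP; rewrite subr_eq0 => /eqP fb.
  by rewrite pair_subl// wE// fb mulrC [Z b * _]mulrC subrr.
move=> fw; exists (a1 - a2 * c), a2; apply: (ae_mono fw) => x /eqP.
by rewrite subr_eq0 => /eqP ->; rewrite /w /=; ring.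
Qed.

(* Integrating the weak equation twice exhibits [v] as [P] plus a solution of
   the homogeneous equation [(A w')' = 0], where [(A P')' = K v]. *)
Lemma weak_solution_regular (K v : R -> R) : continuous K -> loc_integrable v ->
  (forall a, test1 a ->
    rI (fun x => v x * ('D_1 (fun y => A y * 'D_1 a y) x - K x * a x)) = 0) ->
  exists w dw, sturm_solution A K w dw /\ {ae leb, forall x, v x = w x}.
Proof.
move=> cK lv v0.
pose h x := v x * K x; have lh : loc_integrable h by exact: loc_integrable_mul.
pose H := primitive h; have cH : continuous H by exact: continuous_primitive lh.2.
pose HA x := H x / A x.
have cHA : continuous HA.
  by move=> x; apply: cvgM; [exact: cH|exact: (Cn_cont (cAV 0))].
pose P := primitive HA.
have dP x : is_derive x (1 : R) P (HA x) by exact: is_derive_primitive.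
have cP : continuous P.
  move=> x; apply/differentiable_continuous/derivable1_diffP.
  by have [] := dP x.
have lP : loc_integrable P by exact: continuous_loc_integrable.
have lvP : loc_integrable (fun x => v x - P x) by exact: loc_integrable_sub.
have [a ta|c1 [c2 vE]] := du_bois_reymond lvP.
  have tda := test1_derive ta; have tAda := test1_mul CA tda.
  have tDAda := test1_derive tAda.
  have der b : test1 b -> forall x, is_derive x (1 : R) b ('D_1 b x).
    by move=> [cb _] x; exact: (Cn_is_derive x 1 (cb 1%N)).
  rewrite pair_subl//.
  have -> : rI (fun x => P x * 'D_1 (fun y => A y * 'D_1 a y) x) =
      rI (fun x => h x * a x).
    rewrite (ibp_compact dP cHA (der _ tAda) (test1_cont tDAda) tAda.2).
    rewrite -[RHS]opprK -(ibp_primitive lh.1 lh.2 (der _ ta) (test1_cont tda) ta.2).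
    congr (- _); apply: eq_Rintegral => x _; rewrite /HA mulrA divfK//.
    by rewrite gt_eqF.
  rewrite -RintegralB//; [|exact: loc_integrable_test..].
  by rewrite -[RHS](v0 a ta); apply: eq_Rintegral => x _; rewrite /h; ring.
pose w x := P x + (c1 + c2 * z x).
pose dw x := HA x + c2 * (A x)^-1.
have vw : {ae leb, forall x, v x = w x}.
  by apply: (ae_mono vE) => x /eqP; rewrite subr_eq => /eqP ->; rewrite addrC.
exists w, dw; split=> //.
have dw' x : is_derive x (1 : R) w (dw x).
  apply: (is_derive_eq (is_derive_addf (dP x) (is_derive_addf
    (is_derive_cst c1 x (1 : R)) (is_derive_scalef c2 (dz x))))).
  by rewrite add0r.
have cw : continuous w.
  move=> x; apply/differentiable_continuous/derivable1_diffP.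
  by have [] := dw' x.
split=> // x.
have cwK : continuous (fun y => w y * K y).
  by move=> y; apply: cvgM; [exact: cw|exact: cK].
(* Under the integral [v] may be replaced by the continuous [w], so [H] is differentiable everywhere
   and the equation holds at each point. *)
have HE : H = primitive (fun y => w y * K y).
  have e a b : Rintegral leb `[a, b] h = Rintegral leb `[a, b] (fun y => w y * K y).
    congr fine; apply: ae_eq_integral => //.
    - by apply/measurable_EFinP/measurable_funTS; exact: lh.1.
    - by apply/measurable_EFinP/measurable_funTS; exact: continuous_measurable_fun.
    - by apply: (ae_mono vw) => y vwy _ /=; rewrite /h vwy.
  by apply/funext => y; rewrite /H /primitive !e.
rewrite (_ : (fun y => A y * dw y) = (fun y => H y + c2)); last first.
  apply/funext => y; rewrite /dw /HA mulrDr mulrCA mulfV ?gt_eqF// mulr1.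
  by rewrite mulrCA mulfV ?gt_eqF// mulr1.
rewrite HE; have h1 := is_derive_primitive x cwK.
by apply: is_derive_eq; rewrite addr0 mulrC.
Qed.

End WeakSolutions.

(** * Solutions with small growth *)

Section Liouville.
Variables (R : realType) (N : nat).
Local Notation J := (@jbracket R).
Local Notation T := (@profile_root R N).
Local Notation A := (@profile_flux R N).
Local Notation nuJ := (@profile_nu R N).
Local Notation q := (@angular_weight R N).
Local Notation K := (@mode_potential R N).
Implicit Types (x c : R) (v dv f df : R -> R).

Lemma le_of_derive_ge0 f df a b : a <= b ->
  (forall x, is_derive x (1 : R) f (df x)) ->
  (forall x, a <= x -> 0 <= df x) -> f a <= f b.
Proof.
rewrite le_eqVlt => /predU1P[->//|ab] hf f0.
have cf : {within `[a, b], continuous f}.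
  apply: continuous_subspaceT => x.
  apply/differentiable_continuous/derivable1_diffP; by have [] := hf x.
have [c] := MVT ab (fun x _ => hf x) cf.
rewrite in_itv/= => /andP[ac _] fab.
by rewrite -subr_ge0 fab mulr_ge0 ?f0 ?subr_ge0 ?ltW.
Qed.

Lemma cst_of_derive0 f : (forall x, is_derive x (1 : R) f 0) ->
  forall x, f x = f 0.
Proof.
move=> hf x; have hNf y : is_derive y (1 : R) (fun y => - f y) 0.
  by have := is_derive_oppf (hf y); rewrite oppr0.
have [x0|/ltW x0] := leP 0 x; apply/eqP; rewrite eq_le; apply/andP; split.
- rewrite -lerN2; exact: (le_of_derive_ge0 (f := fun y => - f y) x0 hNf).
- exact: (le_of_derive_ge0 x0 hf).
- exact: (le_of_derive_ge0 x0 hf).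
- rewrite -lerN2; exact: (le_of_derive_ge0 (f := fun y => - f y) x0 hNf).
Qed.

Lemma profile_rootN x : T (- x) = T x.
Proof. by rewrite /profile_root /profile_sum jbracketN. Qed.

Lemma profile_fluxN x : A (- x) = A x.
Proof. by rewrite /profile_flux jbracketN profile_rootN. Qed.

Lemma mode_potentialN d x : K d (- x) = K d x.
Proof.
by rewrite /mode_potential /angular_weight /potential jbracketN profile_rootN.
Qed.

Lemma profile_nuN x : nuJ (- x) = nuJ x.
Proof. by rewrite /profile_nu jbracketN. Qed.

Lemma is_derive_reflect f df : (forall x, is_derive x (1 : R) f (df x)) ->
  forall x, is_derive x (1 : R) (fun y => f (- y)) (- df (- x)).
Proof.
move=> hf x; have h := is_derive_oppf (is_derive_id x (1 : R)).
by apply: (is_derive_eq (is_derive_compf (hf (- x)) h)); rewrite mulrN1.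
Qed.

Lemma primitive_even f x : continuous f -> (forall y, f (- y) = f y) ->
  primitive f (- x) = - primitive f x.
Proof.
move=> cf fN; have df y : is_derive y (1 : R) (primitive f) (f y).
  exact: is_derive_primitive.
have h y : is_derive y (1 : R) (fun x => primitive f (- x) + primitive f x) 0.
  apply: (is_derive_eq (is_derive_addf (is_derive_reflect df y) (df y))).
  by rewrite fN addNr.
have := cst_of_derive0 h x; rewrite oppr0 primitive0 addr0 => /eqP.
by rewrite addr_eq0 => /eqP.
Qed.

Lemma continuous_profile_fluxV : continuous (fun x => (A x)^-1).
Proof.
apply: (@Cn_cont R R [set 1] 0); apply: Cn_inv => [x|].
  by rewrite gt_eqF// profile_flux_gt0.
exact: Cn_profile_flux.
Qed.

Lemma sturm_solutionN d v dv : sturm_solution A (K d) v dv ->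
  sturm_solution A (K d) (fun x => v (- x)) (fun x => - dv (- x)).
Proof.
move=> [h1 h2]; split; first exact: is_derive_reflect.
move=> x; have h := is_derive_oppf (is_derive_reflect h2 x).
rewrite (_ : (fun y => _) = (fun y => - (A (- y) * dv (- y)))).
  by apply: (is_derive_eq h); rewrite opprK mode_potentialN.
by apply/funext => y; rewrite profile_fluxN mulrN.
Qed.

Lemma sturm_solution_opp d v dv : sturm_solution A (K d) v dv ->
  sturm_solution A (K d) (fun x => - v x) (fun x => - dv x).
Proof.
move=> [h1 h2]; split=> x; first exact: is_derive_oppf.
rewrite (_ : (fun y => _) = (fun y => - (A y * dv y))).
  by apply: (is_derive_eq (is_derive_oppf (h2 x))); rewrite mulrN.
by apply/funext => y; rewrite mulrN.
Qed.

Lemma sturm_wronskian k1 k2 f df g dg :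
  sturm_solution A k1 f df -> sturm_solution A k2 g dg -> forall x,
  is_derive x (1 : R) (fun y => A y * (df y * g y - f y * dg y))
    ((k1 x - k2 x) * (f x * g x)).
Proof.
move=> [hf hAf] [hg hAg] x.
rewrite (_ : (fun y => _) =
  (fun y => A y * df y * g y - f y * (A y * dg y))); last first.
  by apply/funext => y; ring.
apply: (is_derive_eq (is_derive_subf (is_derive_mulf (hAf x) (hg x))
  (is_derive_mulf (hf x) (hAg x)))); ring.
Qed.

(** The one behaviour at +oo that the weighted L^2 bound excludes directly; neither decay nor
    boundedness is claimed. The end -oo is reached by reflection. *)
Definition no_growth v := forall c (M : R), 0 < c ->
  ~ (forall x, M <= x -> c <= `|v x|).

Lemma profile_root_le x : T x <= Num.sqrt N.+2%:R * J x ^+ N.+1.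
Proof.
rewrite -(ler_pXn2r (_ : (0 < 2)%N)) ?nnegrE ?mulr_ge0 ?exprn_ge0//.
- rewrite profile_root_sqr exprMn sqr_sqrtr// /profile_sum.
  rewrite (le_trans (_ : _ <= \sum_(k < N.+2) J x ^+ (2 * N.+1)))//.
    apply: ler_sum => k _; rewrite ler_weXn2l ?jbracket_ge1//.
    by rewrite leq_mul2l /= -ltnS.
  by rewrite sumr_const card_ord mulr_natl -exprM (mulnC N.+1 2%N).
- exact/ltW/profile_root_gt0.
- exact/ltW/jbracket_gt0.
Qed.

Lemma jbracketV_le c : 0 < c -> forall x, c^-1 <= x -> (J x)^-1 <= c.
Proof.
move=> c0 x cx; rewrite -[leRHS]invrK lef_pV2 ?posrE ?invr_gt0 ?jbracket_gt0//.
by rewrite (le_trans cx)// (le_trans (ler_norm x))// jbracket_ge.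
Qed.

Lemma profile_nu_small c : 0 < c -> forall x, c^-1 <= x -> nuJ x <= c.
Proof.
move=> c0 x cx; apply: le_trans (jbracketV_le c0 cx).
rewrite lef_pV2 ?posrE ?exprn_gt0 ?jbracket_gt0// ler_eXnr//.
exact: jbracket_ge1.
Qed.

Section HighModes.
Variables (d : nat) (d0 : (0 < d)%N).

(** The term from |II|^2 cancels between two modes. The subtraction of natural numbers is exact
    because d > 0. *)
Let gap : K d = fun x => K 1 x + (d * (d + N.+1) - N.+2)%:R * q x.
Proof.
apply/funext => x; rewrite /mode_potential mul1n add1n.
rewrite natrB; first by ring.
by case: d d0 => // e _; rewrite (leq_trans _ (leq_pmull _ _))// addSn addnS ltnS ltnS leq_addl.
Qed.

Let m v dv x := A x * (dv x * nuJ x - v x * - (N.+2%:R * x / J x ^+ N.+4)).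

Let dm v dv : sturm_solution A (K d) v dv -> forall x,
  is_derive x (1 : R) (m v dv)
    ((d * (d + N.+1) - N.+2)%:R * q x * (v x * nuJ x)).
Proof.
move=> hv x; apply: (is_derive_eq (sturm_wronskian hv (solves_mode1 R N) x)).
by rewrite gap addrAC subrr add0r.
Qed.

Let nu0 x : nuJ x != 0. Proof. by rewrite gt_eqF// profile_nu_gt0. Qed.
Let An0 x : A x != 0. Proof. by rewrite gt_eqF// profile_flux_gt0. Qed.

Let dw v dv : sturm_solution A (K d) v dv -> forall x,
  is_derive x (1 : R) (fun x => v x / nuJ x) (m v dv x / (A x * nuJ x ^+ 2)).
Proof.
move=> [hv _] x; have [hn _] := solves_mode1 R N.
apply: (is_derive_eq (is_derive_mulf (hv x) (is_derive_invf (nu0 x) (hn x)))).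
have P0 : J x ^+ N.+4 != 0 by rewrite expf_neq0// gt_eqF// jbracket_gt0.
have := nu0 x; rewrite /m; move: (nuJ x) (J x ^+ N.+4) P0 => n P P0 n0.
by field; rewrite n0 An0 P0.
Qed.

Let F v dv x := m v dv x * (v x / nuJ x).

Let dF v dv : sturm_solution A (K d) v dv -> forall x,
  is_derive x (1 : R) (F v dv) (m v dv x ^+ 2 / (A x * nuJ x ^+ 2) +
    (d * (d + N.+1) - N.+2)%:R * q x * v x ^+ 2).
Proof.
move=> hv x; apply: (is_derive_eq (is_derive_mulf (dm hv x) (dw hv x))).
by field; rewrite nu0 An0.
Qed.

Let F_mono v dv : sturm_solution A (K d) v dv ->
  forall a b, a <= b -> F v dv a <= F v dv b.
Proof.
move=> hv a b ab; apply: (le_of_derive_ge0 ab (dF hv)) => x _.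
rewrite addr_ge0//.
  rewrite divr_ge0 ?sqr_ge0// mulr_ge0 ?sqr_ge0//; exact/ltW/profile_flux_gt0.
rewrite mulr_ge0 ?sqr_ge0// mulr_ge0//; exact/ltW/angular_weight_gt0.
Qed.

(** Let w = v / nu with w(x1) > 0. To the right of x1 the monotone F = m w stays positive, so w
    cannot reach 0; hence v > 0 and m does not decrease. Then w' = m / (A nu^2) is at least of order
    <x>^(n-1), so w is too, and v = w nu is bounded below. *)
Let growth v dv x1 : sturm_solution A (K d) v dv ->
  0 < F v dv x1 -> ~ no_growth v.
Proof.
wlog w1 : v dv / 0 < v x1 / nuJ x1.
  move=> hw hv F1 ng; have [w1|w1|w1] := ltgtP 0 (v x1 / nuJ x1).
  - exact: (hw v dv w1 hv F1 ng).
  - apply: (hw (fun x => - v x) (fun x => - dv x)).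
    + by rewrite mulNr oppr_gt0.
    + exact: sturm_solution_opp.
    + rewrite /F (_ : m _ _ x1 = - m v dv x1); last by rewrite /m; ring.
      by rewrite !mulNr mulrN opprK.
    + move=> c M c0 h; apply: (ng c M c0) => x Mx.
      by rewrite -normrN; exact: h.
  - by move: F1; rewrite /F -w1 mulr0 ltxx.
move=> hv F1 ng.
have FP x : x1 <= x -> 0 < F v dv x.
  by move=> x1x; apply: lt_le_trans F1 _; exact: F_mono.
have cw : continuous (fun x => v x / nuJ x).
  move=> x; apply/differentiable_continuous/derivable1_diffP.
  by have [] := dw hv x.
have wP x : x1 <= x -> 0 < v x / nuJ x.
  move=> x1x; rewrite ltNge; apply/negP => wx.
  have [c] := @IVT _ (fun x => v x / nuJ x) x1 x 0 x1x
    (continuous_subspaceT cw) ltac:(rewrite ge_min wx orbT /= le_max (ltW w1)//).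
  rewrite in_itv/= => /andP[x1c _] wc.
  by have := FP _ x1c; rewrite /F wc mulr0 ltxx.
have vP x : x1 <= x -> 0 < v x.
  by move=> /wP; rewrite pmulr_lgt0// invr_gt0 profile_nu_gt0.
have m1 : 0 < m v dv x1 by rewrite -(pmulr_lgt0 _ w1).
have mP x : x1 <= x -> m v dv x1 <= m v dv x.
  move=> x1x; apply: (le_of_derive_ge0 x1x (dm hv)) => y x1y.
  rewrite mulr_ge0// mulr_ge0//; first exact/ltW/angular_weight_gt0.
    exact/ltW/vP.
  exact/ltW/profile_nu_gt0.
pose s : R := Num.sqrt N.+2%:R.
have s0 : 0 < s by rewrite sqrtr_gt0 ltr0n.
(* As A <= s <x>^(n-1), the lower bound for w' is m(x1) <x>^(n-1) / s = c0 (n-1) <x>^(n-1), which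
   dominates the derivative of c0 <x>^(n-1). *)
pose c0 := m v dv x1 / (N.+2%:R * s).
have c00 : 0 < c0 by rewrite divr_gt0// mulr_gt0// ltr0n.
have dg x : is_derive x (1 : R) (fun x => v x / nuJ x - c0 * J x ^+ N.+2)
    (m v dv x / (A x * nuJ x ^+ 2) - c0 * (N.+2%:R * J x ^+ N.+1 * (x / J x))).
  apply: is_derive_subf; first exact: dw.
  by apply: is_derive_scalef; exact: is_derive_expf (is_derive_jbracket x).
have gP x : x1 <= x -> v x1 / nuJ x1 - c0 * J x1 ^+ N.+2 <=
    v x / nuJ x - c0 * J x ^+ N.+2.
  move=> x1x; apply: (le_of_derive_ge0 x1x dg) => y x1y.
  have J0 := jbracket_gt0 y; have J1 := jbracket_ge1 y.
  rewrite subr_ge0 (@le_trans _ _ (c0 * (N.+2%:R * J y ^+ N.+2)))//.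
    rewrite ler_pM2l// -mulrA ler_pM2l ?ltr0n// [leRHS]exprSr ler_pM2l ?exprn_gt0//.
    rewrite ler_pdivrMr// (le_trans (ler_norm y))// (le_trans (jbracket_ge y))//.
    by rewrite ler_peMr// ltW.
  have -> : c0 * (N.+2%:R * J y ^+ N.+2) = m v dv x1 * (J y ^+ N.+2 / s).
    have s1 : s != 0 by rewrite gt_eqF.
    have n1 : N.+2%:R != 0 :> R by rewrite pnatr_eq0.
    by rewrite /c0; move: (N.+2%:R : R) n1 => c n1; field; rewrite s1 n1.
  have -> : m v dv y / (A y * nuJ y ^+ 2) = m v dv y * (J y ^+ N.+2 ^+ 2 / A y).
    rewrite /profile_nu exprVn invfM invrK; field; exact: An0.
  apply: ler_pM; [exact: ltW| |exact: mP|].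
    by rewrite divr_ge0 ?exprn_ge0// ltW.
  rewrite expr2 -mulrA ler_pM2l ?exprn_gt0// ler_pdivlMr ?profile_flux_gt0//.
  rewrite mulrC ler_pdivrMr// /profile_flux exprS -mulrA ler_pM2l//.
  by rewrite mulrC profile_root_le.
(* Beyond this point nu has dropped to half of nu(x1), so the initial value c0 / nu(x1) that is
   subtracted from w costs v at most c0 / 2. *)
pose M := Num.max x1 (nuJ x1 / 2)^-1.
have c02 : 0 < c0 / 2 by rewrite divr_gt0.
apply: (ng (c0 / 2) M c02) => x; rewrite ge_max => /andP[x1x Mx].
have n1 := profile_nu_gt0 N x1; have nx := profile_nu_gt0 N x.
have nux : nuJ x <= nuJ x1 / 2 by apply: profile_nu_small => //; rewrite divr_gt0.
rewrite (gtr0_norm (vP _ x1x)).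
have JE y : J y ^+ N.+2 = (nuJ y)^-1 by rewrite invrK.
have := gP _ x1x; rewrite !JE => h.
have : v x / nuJ x >= c0 * (nuJ x)^-1 - c0 * (nuJ x1)^-1 by lra.
rewrite ler_pdivlMr// => {}h; apply: le_trans h.
have -> : (c0 / nuJ x - c0 / nuJ x1) * nuJ x = c0 * (1 - nuJ x / nuJ x1).
  by field; rewrite !nu0.
rewrite ler_pM2l//.
have : nuJ x / nuJ x1 <= 2^-1 by rewrite ler_pdivrMr// mulrC.
lra.
Qed.

(** F vanishes identically: a positive value forces growth at +oo, a negative one growth at -oo,
    since reflection changes the sign of F. Hence both nonnegative terms of F' vanish. The first
    gives m = 0, so that v / nu is constant; the second gives v = 0 unless d = 1. *)
Lemma liouville_high v dv : sturm_solution A (K d) v dv ->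
  no_growth v -> no_growth (fun x => v (- x)) ->
  (d != 1%N -> forall x, v x = 0) /\ exists c, forall x, v x = c * nuJ x.
Proof.
move=> hv ngr ngl.
have F0 x : F v dv x = 0.
  have [Fx|Fx|//] := ltgtP (F v dv x) 0; last by have := growth hv Fx.
  exfalso; apply: (@growth _ _ (- x) (sturm_solutionN hv) _ ngl).
  rewrite /F (_ : m _ _ (- x) = - m v dv x).
    by rewrite opprK profile_nuN mulNr oppr_gt0.
  by rewrite /m opprK profile_fluxN profile_nuN jbracketN; ring.
have mv0 x : m v dv x = 0 /\ (d * (d + N.+1) - N.+2)%:R * v x ^+ 2 = 0.
  have := dF hv x; rewrite (_ : F v dv = cst 0); last exact/funext.
  move=> h; have := @derive_val _ _ _ _ _ _ _ h; rewrite derive_cst => /esym/eqP.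
  have A1 : 0 < A x * nuJ x ^+ 2.
    by rewrite mulr_gt0 ?profile_flux_gt0// exprn_gt0// profile_nu_gt0.
  have q1 := angular_weight_gt0 N x.
  have n1 : 0 <= m v dv x ^+ 2 / (A x * nuJ x ^+ 2).
    by rewrite divr_ge0 ?sqr_ge0// ltW.
  have n2 : 0 <= (d * (d + N.+1) - N.+2)%:R * q x * v x ^+ 2.
    by rewrite mulr_ge0 ?sqr_ge0// mulr_ge0// ltW.
  rewrite (paddr_eq0 n1 n2) mulf_eq0 invr_eq0 (gt_eqF A1) orbF sqrf_eq0.
  rewrite mulrAC [_ * q x == 0]mulf_eq0 (gt_eqF q1) orbF.
  by move=> /andP[/eqP -> /eqP ->].
split=> [d1 x|].
  have [_ /eqP] := mv0 x; rewrite mulf_eq0 sqrf_eq0 => /orP[|/eqP//].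
  rewrite pnatr_eq0 subn_eq0; case: d d0 d1 => [|[|e]]// _ _.
  by rewrite leqNgt mulSn addSn addSn ltnS (leq_trans _ (leq_addr _ _))// !addSn !ltnS leq_addl.
exists (v 0 / nuJ 0) => x.
have w' y : is_derive y (1 : R) (fun x => v x / nuJ x) 0.
  by have := dw hv y; rewrite (mv0 y).1 mul0r.
by rewrite -(cst_of_derive0 w' x) divfK.
Qed.

End HighModes.

Section ZeroMode.

Let z := primitive (fun x => (A x)^-1).

Let dz x : is_derive x (1 : R) z (A x)^-1.
Proof. by apply: is_derive_primitive; exact: continuous_profile_fluxV. Qed.

Let zN x : z (- x) = - z x.
Proof.
apply: primitive_even => [|y]; first exact: continuous_profile_fluxV.
by rewrite profile_fluxN.
Qed.

Let z_mono a b : a <= b -> z a <= z b.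
Proof.
move=> ab; apply: (le_of_derive_ge0 ab dz) => x _.
by rewrite invr_ge0 ltW// profile_flux_gt0.
Qed.

Let z1_gt0 : 0 < z 1.
Proof.
rewrite lt_neqAle; have z01 : 0 <= z 1 by rewrite -(primitive0 (fun x => (A x)^-1)) z_mono.
rewrite z01 andbT; apply/negP => /eqP z1.
have cz : {within `[(0 : R), 1], continuous z}.
  apply: continuous_subspaceT => x.
  apply/differentiable_continuous/derivable1_diffP; by have [] := dz x.
have [c _] := MVT ltr01 (fun x _ => dz x) cz.
rewrite -z1 /z primitive0 subrr subr0 mulr1 => /esym/eqP.
by rewrite invr_eq0 gt_eqF// profile_flux_gt0.
Qed.

Local Notation f0 := (@mode0_odd R N).

(** Up to sign [f0] and [nuJ] are the components of the unit normal along the axis and orthogonal to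
    it. *)
Let f0_sqr x : f0 x ^+ 2 = 1 - nuJ x ^+ 2.
Proof.
rewrite /mode0_odd !exprMn profile_root_geom /profile_nu mulrBl mul1r.
by rewrite exprVn -exprM [(N.+2 * 2)%N]mulnC divff ?expf_neq0// gt_eqF// jbracket_gt0.
Qed.

Let f0_ge x : 0 <= x -> nuJ x <= 2^-1 -> 2^-1 <= f0 x.
Proof.
move=> x0 nx; have n0 := profile_nu_gt0 N x.
have f00 : 0 <= f0 x.
  by rewrite !mulr_ge0// ltW// profile_root_gt0.
have := f0_sqr x; have : nuJ x ^+ 2 <= nuJ x * 2^-1.
  by rewrite expr2 ler_pM2l.
move=> h1 h2; rewrite leNgt; apply/negP => h3.
have : f0 x ^+ 2 <= 2^-1 * 2^-1 by rewrite expr2 ler_pM// ltW.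
lra.
Qed.

(** When a b <= 0 the terms b and - a z have the same sign for x > 0 and cannot cancel. Their sum is
    multiplied by f0, eventually at least 1/2, and the remaining term a <x> nu tends to 0. *)
Let growth0 (a b : R) : a * b <= 0 -> (a != 0) || (b != 0) ->
  ~ no_growth (fun x => a * mode0_even N z x + b * f0 x).
Proof.
move=> ab ab0 ng.
(* The main term is at least (|b| + |a| z(1)) / 2, and [M] is chosen to keep the remainder below |a|
   z(1) / 4. *)
pose c := `|b| / 2 + `|a| * z 1 / 4.
have c0 : 0 < c.
  have [a0|a0] := eqVneq a 0.
    rewrite /c a0 normr0 !mul0r addr0 divr_gt0// normr_gt0.
    by move: ab0; rewrite a0 eqxx.
  by rewrite ltr_wpDl// ?divr_ge0// !mulr_gt0// normr_gt0.
have z14 : 0 < z 1 / 4 by rewrite divr_gt0.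
pose M := Num.max 1 (Num.max (2^-1)^-1 (z 1 / 4)^-1).
apply: (ng c M c0) => x; rewrite !ge_max => /andP[x1 /andP[x2 x3]].
have x0 : 0 <= x by rewrite (le_trans _ x1).
have fx : 2^-1 <= f0 x.
  by apply: f0_ge => //; apply: profile_nu_small => //; rewrite invr_gt0.
have Jx : (J x)^-1 <= z 1 / 4 by apply: jbracketV_le.
have zx : z 1 <= z x by exact: z_mono.
have Jnu : `|J x * nuJ x| <= z 1 / 4.
  have Jnu0 : 0 <= J x * nuJ x.
    by rewrite mulr_ge0 ?ltW ?jbracket_gt0 ?profile_nu_gt0.
  rewrite ger0_norm//.
  apply: le_trans Jx; rewrite /profile_nu exprS invfM mulrA mulfV ?gt_eqF ?jbracket_gt0//.
  by rewrite mul1r lef_pV2 ?posrE ?exprn_gt0 ?jbracket_gt0// ler_eXnr// jbracket_ge1.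
have -> : a * mode0_even N z x + b * f0 x = f0 x * (b - a * z x) + a * (J x * nuJ x).
  by rewrite /mode0_even; ring.
have E : `|b - a * z x| = `|b| + `|a| * z x.
  have z0 : 0 <= z x by rewrite (le_trans _ zx)// ltW.
  have [a0|a0] := leP 0 a; have [b0|b0] := leP 0 b.
  - have [->|an0] := eqVneq a 0; first by rewrite !mul0r subr0 normr0 mul0r addr0.
    have -> : b = 0.
      apply/eqP; rewrite eq_le b0 andbT -(pmulr_rle0 _ (_ : 0 < a))//.
      by rewrite lt_neqAle eq_sym an0.
    by rewrite sub0r normrN normr0 add0r normrM (ger0_norm z0).
  - rewrite ler0_norm; last by rewrite subr_le0 (le_trans (ltW b0))// mulr_ge0.
    by rewrite (ltr0_norm b0) (ger0_norm a0); ring.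
  - rewrite ger0_norm; last by rewrite subr_ge0 (le_trans _ b0)// mulr_le0_ge0// ltW.
    by rewrite (ltr0_norm a0) (ger0_norm b0); ring.
  - by exfalso; move: ab; apply/negP; rewrite -ltNge nmulr_lgt0.
have h1 : `|f0 x * (b - a * z x)| >= 2^-1 * (`|b| + `|a| * z 1).
  rewrite normrM E ger0_norm ?(le_trans _ fx)//.
  apply: ler_pM => //; first by rewrite addr_ge0// mulr_ge0// ltW.
  by rewrite lerD2l ler_wpM2l.
have h2 : `|a * (J x * nuJ x)| <= `|a| * (z 1 / 4).
  by rewrite normrM ler_wpM2l.
have := lerB_normD (f0 x * (b - a * z x)) (a * (J x * nuJ x)).
rewrite /c; lra.
Qed.

(** The Wronskians with [mode0_odd] and [mode0_even] are constant, which expresses [v] through these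
    two. One is odd and the other even, so reflection changes the sign of b, and at one of the two
    ends a b <= 0 and [growth0] applies. *)
Lemma liouville_zero v dv : sturm_solution A (K 0) v dv ->
  no_growth v -> no_growth (fun x => v (- x)) -> forall x, v x = 0.
Proof.
move=> hv ngr ngl.
have ho := solves_mode0_odd R N; have he := solves_mode0_even dz.
pose df0 x : R := N.+2%:R / (J x ^+ N.+4 * T x).
pose df2 x := - (N.+2%:R * (f0 x + z x / J x ^+ N.+3)) / A x.
pose W1 x := A x * (dv x * f0 x - v x * df0 x).
pose W2 x := A x * (dv x * mode0_even N z x - v x * df2 x).
have W1c x : W1 x = W1 0.
  apply: cst_of_derive0 => y; have := sturm_wronskian hv ho y.
  by rewrite subrr mul0r.
have W2c x : W2 x = W2 0.
  apply: cst_of_derive0 => y; have := sturm_wronskian hv he y.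
  by rewrite subrr mul0r.
(* The Wronskian of the two explicit solutions; it does not vanish, so they form a basis. *)
have D x : A x * (f0 x * df2 x - df0 x * mode0_even N z x) = - N.+2%:R.
  have A1 : A x != 0 by rewrite gt_eqF// profile_flux_gt0.
  have J1 : J x != 0 by rewrite gt_eqF// jbracket_gt0.
  have T1 : T x != 0 by rewrite gt_eqF// profile_root_gt0.
  have P1 : J x ^+ N != 0 by rewrite expf_neq0.
  have -> : A x * (f0 x * df2 x - df0 x * mode0_even N z x) =
     - N.+2%:R * (f0 x ^+ 2 + nuJ x ^+ 2).
    have h2 : A x * df2 x = - (N.+2%:R * (f0 x + z x / J x ^+ N.+3)).
      by rewrite /df2 mulrC divfK.
    have h0 : A x * df0 x = N.+2%:R / J x ^+ N.+3.
      rewrite /df0 /profile_flux !exprS; move: (J x ^+ N) P1 => P P1.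
      by field; rewrite J1 T1 P1.
    transitivity (f0 x * (A x * df2 x) - A x * df0 x * mode0_even N z x).
      by ring.
    rewrite h2 h0 /mode0_even /profile_nu !exprS expr0.
    move: (f0 x) (J x ^+ N) P1 => f P P1.
    by field; rewrite J1 P1.
  by rewrite f0_sqr subrK mulr1.
pose a := - (W1 0 / N.+2%:R); pose b := W2 0 / N.+2%:R.
have vE x : v x = a * mode0_even N z x + b * f0 x.
  have n0 : N.+2%:R != 0 :> R by rewrite pnatr_eq0.
  apply: (mulfI (_ : - N.+2%:R != 0)); first by rewrite oppr_eq0.
  rewrite -{1}(D x) /a /b -(W1c x) -(W2c x) /W1 /W2 -/(df0 x) -/(df2 x).
  by field.
have vNE x : v (- x) = a * mode0_even N z x + (- b) * f0 x.
  rewrite vE /mode0_even /mode0_odd zN profile_nuN profile_rootN jbracketN; ring.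
have [ab|ab] := boolP ((a != 0) || (b != 0)); last first.
  move: ab; rewrite negb_or !negbK => /andP[/eqP a0 /eqP b0] x.
  by rewrite vE a0 b0 !mul0r addr0.
exfalso; have [ab0|ab0] := leP (a * b) 0.
  apply: (growth0 ab0 ab); rewrite (_ : (fun x => _) = v)//.
  by apply/funext => x; rewrite vE.
apply: (@growth0 a (- b)).
- by rewrite mulrN oppr_le0 ltW.
- by rewrite (oppr_eq0 b).
- by rewrite (_ : (fun x => _) = (fun x => v (- x)))//; apply/funext => x; rewrite vNE.
Qed.

End ZeroMode.

Lemma liouville_mode d v dv : sturm_solution A (K d) v dv ->
  no_growth v -> no_growth (fun x => v (- x)) ->
  (d != 1%N -> forall x, v x = 0) /\ exists c, forall x, v x = c * nuJ x.
Proof.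
case: d => [|d] hv ngr ngl; last exact: (liouville_high _ hv).
have v0 := liouville_zero hv ngr ngl.
by split=> //; exists 0 => x; rewrite mul0r.
Qed.

End Liouville.

(** * Geometry of the stereographic chart *)

Section Rows.
Variables (R : realType) (n : nat).

Definition axes : set 'rV[R]_n := [set v | exists i, v = delta_mx 0 i].

Lemma axesP i : axes (delta_mx 0 i).
Proof. by exists i. Qed.

Lemma is_derive_coordinate (x v : 'rV[R]_n) (j : 'I_n) :
  is_derive x v (fun y : 'rV[R]_n => y 0 j) (v 0 j).
Proof.
have d : derivable (id : 'rV[R]_n -> 'rV[R]_n) x v by exact: derivable_id.
split; first by have /derivable_mxP := d; exact.
have := derive_mx d; rewrite derive_id => /matrixP /(_ 0 j) ->.
by rewrite mxE.
Qed.

Lemma is_derive_axis (x : 'rV[R]_n) (i j : 'I_n) :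
  is_derive x (delta_mx 0 i) (fun y : 'rV[R]_n => y 0 j) (j == i)%:R.
Proof. by apply: (is_derive_eq (is_derive_coordinate _ _ _)); rewrite mxE. Qed.

Lemma Cn_coordinate (D : set 'rV[R]_n) k (j : 'I_n) :
  Cn D k (fun y : 'rV[R]_n => y 0 j).
Proof.
case: k => [|k]; first by split=> //; exact: coord_continuous.
apply: CnS => [x|v _]; first exact: differentiable_coord.
rewrite (_ : 'D_v _ = cst (v 0 j)); first exact: Cn_cst.
by apply/funext => x; have [] := is_derive_coordinate x v j.
Qed.

Lemma smooth_Cn (f : 'rV[R]_n -> R) : smooth f -> forall k, Cn axes k f.
Proof.
move=> sf k.
suff h s : Cn axes k (foldr (@partial R n R^o) f s) by exact: (h [::]).
elim: k s => [|k IH] s.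
  by split=> // x; apply: differentiable_continuous; exact: sf.
apply: CnS => [x|_ [i ->]]; first exact: sf.
exact: (IH (i :: s)).
Qed.

Lemma Cn_smooth (f : 'rV[R]_n -> R) : (forall k, Cn axes k f) -> smooth f.
Proof.
move=> cf s x.
suff h k : Cn axes k (foldr (@partial R n R^o) f s) by exact: (Cn_diff (h 1%N)).
elim: s k => [|i s IH] k; first exact: cf.
by apply: (Cn_derive (axesP i)); exact: IH.
Qed.

Lemma partial_mxE k (F : 'rV[R]_n -> 'rV[R]_k) x i (dF : 'I_k -> R) :
  (forall j, is_derive x (delta_mx 0 i) (fun y => F y 0 j) (dF j)) ->
  partial i F x = \row_j dF j.
Proof.
move=> hF; rewrite /partial derive_mx.
  by apply/rowP => j; rewrite !mxE; have [] := hF j.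
by apply/derivable_mxP => a j; rewrite (ord1 a); have [] := hF j.
Qed.

Lemma dotC k (v w : 'rV[R]_k) : dot v w = dot w v.
Proof. by apply: eq_bigr => i _; rewrite mulrC. Qed.

Lemma dotE k (v w : 'rV[R]_k) : v *m w^T = (dot v w)%:M.
Proof.
apply/matrixP => i j; rewrite !ord1 !mxE eqxx mulr1n.
by apply: eq_bigr => a _; rewrite mxE.
Qed.

Lemma dot_row_mx k (u v : 'rV[R]_k) (a b : R) :
  dot (row_mx u a%:M) (row_mx v b%:M) = dot u v + a * b.
Proof.
rewrite /dot big_split_ord /= big_ord1; congr (_ + _).
  by apply: eq_bigr => i _; rewrite !row_mxEl.
by rewrite !row_mxEr !mxE.
Qed.

Lemma dotZl k (a : R) (v w : 'rV[R]_k) : dot (a *: v) w = a * dot v w.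
Proof. by rewrite /dot mulr_sumr; apply: eq_bigr => i _; rewrite mxE mulrA. Qed.

Lemma dotZr k (a : R) (v w : 'rV[R]_k) : dot v (a *: w) = a * dot v w.
Proof. by rewrite dotC dotZl dotC. Qed.

Lemma dotNr k (v w : 'rV[R]_k) : dot v (- w) = - dot v w.
Proof. by rewrite -scaleN1r dotZr mulN1r. Qed.

End Rows.

Section DiagonalMetric.
Variables (R : realType) (m : nat) (X : 'rV[R]_m -> 'rV[R]_(m + 1)).
Variables (x : 'rV[R]_m) (g h : 'I_m -> R) (N0 : 'rV[R]_(m + 1)).
Hypothesis metric_diag :
  forall i j, dot (partial i X x) (partial j X x) = g i *+ (i == j).
Hypothesis g0 : forall i, g i != 0.
Hypothesis N0_unit : dot N0 N0 = 1.
Hypothesis N0_normal : forall i, dot N0 (partial i X x) = 0.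
Hypothesis second_diag :
  forall i j, dot (partial i (partial j X) x) N0 = h i *+ (i == j).

Lemma metric_diagE : metric X x = diag_mx (\row_i g i).
Proof. by apply/matrixP => i j; rewrite !mxE metric_diag. Qed.

Lemma volume_density_diag : volume_density X x = Num.sqrt (\prod_i g i).
Proof.
rewrite /volume_density metric_diagE det_diag; congr Num.sqrt.
by apply: eq_bigr => i _; rewrite mxE.
Qed.

Lemma invmx_metric_diag : invmx (metric X x) = diag_mx (\row_i (g i)^-1).
Proof.
have h1 : diag_mx (\row_i (g i)^-1) *m metric X x = 1%:M.
  rewrite metric_diagE mulmx_diag -(_ : diag_mx (const_mx 1) = 1%:M); last first.
    by apply/matrixP => i j; rewrite !mxE.
  by congr diag_mx; apply/rowP => i; rewrite !mxE mulVf.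
have [_ um] := mulmx1_unit h1.
by rewrite -[LHS]mul1mx -h1 -mulmxA mulmxV// mulmx1.
Qed.

(** [unit_normal] is an unspecified choice. The tangent vectors and [N0] form an invertible matrix
    M, as M M^T is diagonal with nonzero entries, so a vector orthogonal to all tangent vectors is
    determined by its product with [N0]. *)
Lemma unit_normal_sign :
  unit_normal X x = N0 \/ unit_normal X x = - N0.
Proof.
have : [set v | dot v v = 1 /\ forall i, dot v (partial i X x) = 0]
  (unit_normal X x) by apply: xgetPex; exists N0.
set v := unit_normal X x => -[v1 vo].
pose M : 'M[R]_(m + 1) := col_mx (\matrix_i partial i X x) N0.
have rowM i : row i (\matrix_i partial i X x) = partial i X x by rewrite rowK.
have vM (w : 'rV[R]_(m + 1)) : (forall i, dot w (partial i X x) = 0) ->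
    w *m M^T = row_mx 0 (dot w N0)%:M.
  move=> wo; rewrite tr_col_mx mul_mx_row dotE; congr row_mx.
  apply/rowP => i; rewrite !mxE -[RHS](wo i).
  by apply: eq_bigr => a _; rewrite !mxE.
have MM : M *m M^T = block_mx (diag_mx (\row_i g i)) 0 0 1%:M.
  rewrite tr_col_mx mul_col_row; congr block_mx.
  - apply/matrixP => i j; rewrite !mxE -metric_diag.
    by apply: eq_bigr => a _; rewrite !mxE.
  - apply/matrixP => i j; rewrite !mxE -[RHS](N0_normal i) dotC.
    by apply: eq_bigr => a _; rewrite !mxE !ord1.
  - apply/matrixP => i j; rewrite !mxE -[RHS](N0_normal j).
    by apply: eq_bigr => a _; rewrite !mxE !ord1.
  - by rewrite dotE N0_unit.
have uM : M^T \in unitmx.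
  have : M *m M^T \in unitmx.
    rewrite MM unitmxE det_lblock det1 mulr1 unitfE det_diag.
    by apply/prodf_neq0 => i _; rewrite mxE.
  by rewrite unitmx_mul => /andP[].
have vE : v = dot v N0 *: N0.
  apply: (can_inj (mulmxK uM)); rewrite -scalemxAl !vM// N0_unit.
  by rewrite scale_row_mx scaler0 scale_scalar_mx mulr1.
have : dot v N0 ^+ 2 = 1.
  by move: v1; rewrite {1 2}vE dotZl dotZr N0_unit mulr1.
move/eqP; rewrite sqrf_eq1 => /orP[] /eqP e; rewrite vE e.
  by left; rewrite scale1r.
by right; rewrite scaleN1r.
Qed.

Lemma sqnorm_second_form_diag :
  sqnorm_second_form X x = \sum_i (h i / g i) ^+ 2.
Proof.
have [e e1 hE] : exists2 e : R, e ^+ 2 = 1 &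
    second_form X x = diag_mx (\row_i (e * h i)).
  have [uE|uE] := unit_normal_sign; [exists 1|exists (-1)];
    rewrite ?sqrrN ?expr1n//; apply/matrixP => i j; rewrite !mxE uE.
    by rewrite second_diag mul1r.
  by rewrite dotNr second_diag mulN1r mulNrn.
rewrite /sqnorm_second_form invmx_metric_diag hE mulmx_diag mulmx_diag.
rewrite mxtrace_diag; apply: eq_bigr => i _; rewrite !mxE.
by rewrite -[RHS]mul1r -e1; field.
Qed.

End DiagonalMetric.

Lemma laplace_beltrami_diag (R : realType) (m k : nat)
    (X : 'rV[R]_m -> 'rV[R]_k) (g : 'I_m -> 'rV[R]_m -> R) (f : 'rV[R]_m -> R) x :
  (forall x i j, dot (partial i X x) (partial j X x) = g i x *+ (i == j)) ->
  (forall i x, 0 < g i x) ->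
  volume_density X x * laplace_beltrami X f x =
  \sum_i partial (V := R^o) i
    (fun z => volume_density X z / g i z * partial (V := R^o) i f z) x.
Proof.
move=> hg g0.
have mE z : metric X z = diag_mx (\row_i g i z).
  by apply/matrixP => i j; rewrite !mxE hg.
have v0 : volume_density X x != 0.
  rewrite gt_eqF// sqrtr_gt0 mE det_diag; apply: prodr_gt0 => i _.
  by rewrite mxE.
have iE z : invmx (metric X z) = diag_mx (\row_i (g i z)^-1).
  have h1 : diag_mx (\row_i (g i z)^-1) *m metric X z = 1%:M.
    rewrite mE mulmx_diag -(_ : diag_mx (const_mx 1) = 1%:M); last first.
      by apply/matrixP => i j; rewrite !mxE.
    by congr diag_mx; apply/rowP => i; rewrite !mxE mulVf// gt_eqF.
  have [_ um] := mulmx1_unit h1.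
  by rewrite -[LHS]mul1mx -h1 -mulmxA mulmxV// mulmx1.
rewrite /laplace_beltrami; move: (volume_density X x) v0 => w v0.
apply: (etrans (mulVKf v0 _)).
apply: eq_bigr => i _.
apply: (congr1 (fun F => partial (V := R^o) i F x)).
apply/funext => z; rewrite (bigD1 i)//= big1 ?addr0.
  by rewrite iE !mxE eqxx mulr1n.
by move=> j ji; rewrite iE !mxE eq_sym (negbTE ji) mulr0n mulr0 mul0r.
Qed.

Lemma delta_sum (R : realType) m (i : 'I_m) (F : 'I_m -> R) :
  \sum_k (i == k)%:R * F k = F i.
Proof.
rewrite (bigD1 i)//= eqxx mul1r big1 ?addr0// => k.
by rewrite eq_sym => /negbTE ->; rewrite mul0r.
Qed.

(** The derivatives of omega in the stereographic chart combine a Kronecker delta with a multiple of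
    a coordinate, so their inner products reduce to sums of this form. *)
Lemma kronecker_sum (R : realType) m (i j : 'I_m) (y : 'I_m -> R)
    (a b a' b' : R) :
  \sum_k (a * (i == k)%:R + b * y k) * (a' * (j == k)%:R + b' * y k) =
  a * a' * (i == j)%:R + a * b' * y i + a' * b * y j + b * b' * \sum_k y k ^+ 2.
Proof.
rewrite (eq_bigr (fun k => a * a' * ((i == k)%:R * (j == k)%:R) +
  a * b' * ((i == k)%:R * y k) + a' * b * ((j == k)%:R * y k) +
  b * b' * y k ^+ 2)); last by move=> k _; ring.
rewrite !big_split /= -!mulr_sumr !delta_sum.
by rewrite [j == i]eq_sym.
Qed.

Section Stereographic.
Variables (R : realType) (N : nat).
Local Notation rV := 'rV[R]_N.+3.
Local Notation y i x := ((x : 'rV[R]_N.+3) 0 (lift ord0 i)).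
Local Notation ax i := (delta_mx 0 i : 'rV[R]_N.+3).
Implicit Types (x : rV) (i : 'I_N.+2) (a : 'I_N.+3).

Definition sden x : R := 1 + \sum_(i < N.+2) y i x ^+ 2.

Lemma sden_ge1 x : 1 <= sden x.
Proof. by rewrite lerDl sumr_ge0// => i _; exact: sqr_ge0. Qed.

Lemma sden_gt0 x : 0 < sden x.
Proof. exact: lt_le_trans ltr01 (sden_ge1 x). Qed.

Lemma rho_ofE x : rho_of x = x 0 ord0.
Proof. by rewrite /rho_of big_mkcond big_ord_recl /= big1 ?addr0. Qed.

Let ysqE x : \sum_(i < N.+3 | val i != 0%N) x 0 i ^+ 2 = sden x - 1.
Proof. by rewrite big_mkcond big_ord_recl /= add0r addrAC subrr add0r. Qed.

Lemma omega_of0 x : omega_of x 0 ord0 = 1 - 2 / sden x.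
Proof.
rewrite mxE /= ysqE subrK; have := sden_gt0 x; set s := sden x => s0.
by field; rewrite gt_eqF.
Qed.

Lemma omega_ofS x i : omega_of x 0 (lift ord0 i) = 2 * y i x / sden x.
Proof. by rewrite mxE /= ysqE subrK. Qed.

Definition domega i a x : R :=
  if unlift ord0 a is Some b then
    2 * (i == b)%:R / sden x - 4 * y b x * y i x / sden x ^+ 2
  else 4 * y i x / sden x ^+ 2.

Lemma domega0 i x : domega i ord0 x = 4 * y i x / sden x ^+ 2.
Proof. by rewrite /domega unlift_none. Qed.

Lemma domegaS i j x : domega i (lift ord0 j) x =
  2 * (i == j)%:R / sden x - 4 * y j x * y i x / sden x ^+ 2.
Proof. by rewrite /domega liftK. Qed.

Lemma is_derive_sden x i : is_derive x (ax (lift ord0 i)) sden (2 * y i x).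
Proof.
have h := is_derive_addf (is_derive_cst (1 : R) x (ax (lift ord0 i)))
  (@is_derive_sumf _ _ _ (index_enum _) predT
    (fun k (z : rV) => y k z ^+ 2) x (ax (lift ord0 i)) _
    (fun k _ => is_derive_expf 2 (is_derive_axis x (lift ord0 i) (lift ord0 k)))).
apply: (is_derive_eq h); rewrite add0r.
under eq_bigr do rewrite (inj_eq (@lift_inj _ _)) mulrC eq_sym.
by rewrite delta_sum expr1.
Qed.

Lemma is_derive_sden0 x : is_derive x (ax ord0) sden 0.
Proof.
have h := is_derive_addf (is_derive_cst (1 : R) x (ax ord0))
  (@is_derive_sumf _ _ _ (index_enum _) predT
    (fun k (z : rV) => y k z ^+ 2) x (ax ord0) _
    (fun k _ => is_derive_expf 2 (is_derive_axis x ord0 (lift ord0 k)))).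
apply: (is_derive_eq h); rewrite add0r big1// => k _.
by rewrite mulr0.
Qed.

Let s0 x : sden x != 0. Proof. by rewrite gt_eqF// sden_gt0. Qed.

Lemma is_derive_omega x i a :
  is_derive x (ax (lift ord0 i)) (fun z => omega_of z 0 a) (domega i a x).
Proof.
have hs := is_derive_sden x i; have hi := is_derive_invf (s0 x) hs.
case: (unliftP ord0 a) => [b ->|->].
  under eq_fun do rewrite omega_ofS.
  have hb := is_derive_scalef 2 (is_derive_axis x (lift ord0 i) (lift ord0 b)).
  apply: (is_derive_eq (is_derive_mulf hb hi)).
  rewrite domegaS (inj_eq (@lift_inj _ _)) eq_sym; field; exact: s0.
under eq_fun do rewrite omega_of0.
apply: (is_derive_eq (is_derive_subf (is_derive_cst (1 : R) x _)
  (is_derive_scalef 2 hi))).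
by rewrite domega0; field; exact: s0.
Qed.

Lemma is_derive_omega0 x a :
  is_derive x (ax ord0) (fun z => omega_of z 0 a) 0.
Proof.
have hs := is_derive_sden0 x; have hi := is_derive_invf (s0 x) hs.
case: (unliftP ord0 a) => [b ->|->].
  under eq_fun do rewrite omega_ofS.
  have hb := is_derive_scalef 2 (is_derive_axis x ord0 (lift ord0 b)).
  apply: (is_derive_eq (is_derive_mulf hb hi)).
  by rewrite /= oppr0 mul0r !mulr0 addr0.
under eq_fun do rewrite omega_of0.
apply: (is_derive_eq (is_derive_subf (is_derive_cst (1 : R) x _)
  (is_derive_scalef 2 hi))).
by rewrite oppr0 mul0r mulr0 subr0.
Qed.

Lemma dot_omega x : dot (omega_of x) (omega_of x) = 1.
Proof.
rewrite /dot big_ord_recl omega_of0.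
under eq_bigr do rewrite omega_ofS.
rewrite (eq_bigr (fun i => 4 / sden x ^+ 2 * y i x ^+ 2));
  last by move=> i _; field; exact: s0.
rewrite -mulr_sumr (_ : \sum_(i < _) _ = sden x - 1); last first.
  by rewrite /sden addrAC subrr add0r.
by field; exact: s0.
Qed.

Let ysum x : \sum_(i < N.+2) y i x ^+ 2 = sden x - 1.
Proof. by rewrite /sden addrAC subrr add0r. Qed.

Let domegaS' i j x : domega i (lift ord0 j) x =
  2 / sden x * (i == j)%:R + (- 4 * y i x / sden x ^+ 2) * y j x.
Proof. by rewrite domegaS; field; exact: s0. Qed.

Let domegaS'' i j x : domega i (lift ord0 j) x =
  2 / sden x * (j == i)%:R + (- 4 * y j x / sden x ^+ 2) * y i x.
Proof. by rewrite domegaS eq_sym; field; exact: s0. Qed.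

Lemma dot_omega_domega x i :
  dot (omega_of x) (\row_a domega i a x) = 0.
Proof.
rewrite /dot big_ord_recl mxE omega_of0 domega0.
under eq_bigr do rewrite mxE omega_ofS domegaS'.
rewrite (eq_bigr (fun k => (0 * (i == k)%:R + 2 / sden x * y k x) *
  (2 / sden x * (i == k)%:R + (- 4 * y i x / sden x ^+ 2) * y k x)));
  last by move=> k _; field; exact: s0.
rewrite kronecker_sum ysum eqxx.
by field; exact: s0.
Qed.

Lemma dot_domega x i j :
  dot (\row_a domega i a x) (\row_a domega j a x) =
  (2 / sden x) ^+ 2 * (i == j)%:R.
Proof.
rewrite /dot big_ord_recl !mxE !domega0.
under eq_bigr do rewrite !mxE !domegaS'.
rewrite kronecker_sum ysum.
by field; exact: s0.
Qed.

(** On the sphere the gradient of omega_a is the tangential part of the a-th basis vector; (2 /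
    sden)^2 is the conformal factor of the chart. *)
Lemma omega_gradient x a b :
  \sum_i domega i a x * domega i b x =
  (2 / sden x) ^+ 2 * ((a == b)%:R - omega_of x 0 a * omega_of x 0 b).
Proof.
(* The zero coefficient brings the component of index 0 into the shape required by
   [kronecker_sum]. *)
have E0 (c : R) i k : 4 * y i x / sden x ^+ 2 =
    0 * (k == i)%:R + (4 / sden x ^+ 2) * y i x by field; exact: s0.
case: (unliftP ord0 a) => [k ->|->]; case: (unliftP ord0 b) => [l ->|->];
  rewrite ?omega_ofS ?omega_of0 ?(inj_eq (@lift_inj _ _)).
- under eq_bigr do rewrite !domegaS''.
  rewrite kronecker_sum ysum; field; exact: s0.
- under eq_bigr do rewrite domegaS'' domega0 (E0 0 _ k).
  by rewrite kronecker_sum ysum /=; field; exact: s0.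
- under eq_bigr do rewrite domegaS'' domega0 (E0 0 _ l).
  by rewrite kronecker_sum ysum /=; field; exact: s0.
- under eq_bigr do rewrite !domega0 (E0 0 _ ord0).
  by rewrite kronecker_sum ysum /=; field; exact: s0.
Qed.

(** The volume density of the round (n-1)-sphere in the chart; [tau] is this density times the
    inverse metric coefficient, the weight of the Dirichlet form. *)
Definition sigma x : R := (2 / sden x) ^+ N.+2.
Definition tau x : R := (2 / sden x) ^+ N.

Lemma sigmaE x : sigma x = (2 / sden x) ^+ 2 * tau x.
Proof. by rewrite /sigma /tau -exprD. Qed.

Lemma sigma_gt0 x : 0 < sigma x.
Proof. by rewrite exprn_gt0// divr_gt0// sden_gt0. Qed.

Lemma is_derive_tau x i : is_derive x (ax (lift ord0 i)) tau
  (- (N%:R * tau x * (2 * y i x / sden x))).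
Proof.
have hi := is_derive_scalef 2 (is_derive_invf (s0 x) (is_derive_sden x i)).
apply: (is_derive_eq (is_derive_expf N hi)).
have e (r : R) k : k%:R * r ^+ k = k%:R * (r ^+ k.-1 * r).
  by case: k => [|k]; rewrite ?mul0r// exprSr.
rewrite /tau e; move: (_ ^+ N.-1) => p.
by field; exact: s0.
Qed.

Lemma is_derive_sigma0 x : is_derive x (ax ord0) sigma 0.
Proof.
have hi := is_derive_scalef 2 (is_derive_invf (s0 x) (is_derive_sden0 x)).
by apply: (is_derive_eq (is_derive_expf N.+2 hi)); rewrite oppr0 mul0r !mulr0.
Qed.

Definition d2omega i a x : R :=
  if unlift ord0 a is Some b then
    - 4 * ((i == b)%:R * y i x *+ 2 + y b x) / sden x ^+ 2 +
    16 * y b x * y i x ^+ 2 / sden x ^+ 3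
  else 4 / sden x ^+ 2 - 16 * y i x ^+ 2 / sden x ^+ 3.

Lemma is_derive_domega x i a :
  is_derive x (ax (lift ord0 i)) (domega i a) (d2omega i a x).
Proof.
have hs := is_derive_sden x i; have hi := is_derive_invf (s0 x) hs.
have hi2 := @is_derive_invf _ _ (fun z : rV => sden z ^+ 2) _ _ _
  (expf_neq0 2 (s0 x)) (is_derive_expf 2 hs).
have hyi := is_derive_axis x (lift ord0 i) (lift ord0 i); rewrite eqxx in hyi.
rewrite /d2omega; case: (unliftP ord0 a) => [b ->|->].
  rewrite (_ : domega i (lift ord0 b) = fun z : rV =>
    2 * (i == b)%:R * (sden z)^-1 - 4 * y b z * y i z * (sden z ^+ 2)^-1);
    last by apply/funext => z; rewrite domegaS.
  have hb := is_derive_axis x (lift ord0 i) (lift ord0 b).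
  apply: (is_derive_eq (is_derive_subf (is_derive_scalef (2 * (i == b)%:R) hi)
    (is_derive_mulf (is_derive_mulf (is_derive_scalef 4 hb) hyi) hi2))).
  rewrite (inj_eq (@lift_inj _ _)) [b == i]eq_sym expr1 mulr2n.
  rewrite [true%:R](_ : _ = 1)//; move: ((i == b)%:R : R) => e.
  by field; exact: s0.
rewrite (_ : domega i ord0 = fun z : rV => 4 * y i z * (sden z ^+ 2)^-1);
  last by apply/funext => z; rewrite domega0.
apply: (is_derive_eq (is_derive_mulf (is_derive_scalef 4 hyi) hi2)).
by rewrite expr1 [true%:R](_ : _ = 1)//; field; exact: s0.
Qed.

(** The coordinates are eigenfunctions of the sphere with eigenvalue n - 1. The left side is the
    divergence of [tau] times the gradient, expanded by the product rule. *)
Lemma omega_divergence x a :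
  \sum_i (tau x * d2omega i a x + domega i a x *
    - (N%:R * tau x * (2 * y i x / sden x))) =
  - (N.+2%:R * sigma x * omega_of x 0 a).
Proof.
rewrite sigmaE -!natr1 /d2omega; case: (unliftP ord0 a) => [b ->|->].
  rewrite omega_ofS.
  rewrite (eq_bigr (fun i =>
    (b == i)%:R * (- (8 + 4 * N%:R) * tau x * y i x / sden x ^+ 2) +
    (16 + 8 * N%:R) * tau x * y b x / sden x ^+ 3 * y i x ^+ 2 -
    4 * tau x * y b x / sden x ^+ 2)); last first.
    by move=> i _; rewrite domegaS [b == i]eq_sym mulr2n; field; exact: s0.
  rewrite !big_split /= delta_sum -mulr_sumr ysum sumr_const card_ord.
  by rewrite -mulr_natl -!natr1; field; exact: s0.
rewrite omega_of0.
rewrite (eq_bigr (fun i => 4 * tau x / sden x ^+ 2 -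
    (16 + 8 * N%:R) * tau x / sden x ^+ 3 * y i x ^+ 2)); last first.
  by move=> i _; rewrite domega0; field; exact: s0.
rewrite sumrB sumr_const card_ord -mulr_natl -mulr_sumr ysum -!natr1.
by field; exact: s0.
Qed.

Local Notation CnD := (Cn (@axes R N.+3)).

Lemma Cn_sden k : CnD k sden.
Proof.
apply: Cn_add; first exact: Cn_cst.
by apply: Cn_sum => i _; apply: Cn_exp; exact: Cn_coordinate.
Qed.

Lemma Cn_sdenV k : CnD k (fun x => (sden x)^-1).
Proof. by apply: Cn_inv => //; exact: Cn_sden. Qed.

Lemma Cn_omega k a : CnD k (fun x => omega_of x 0 a).
Proof.
case: (unliftP ord0 a) => [b ->|->].
  under eq_fun do rewrite omega_ofS; apply: Cn_mul; last exact: Cn_sdenV.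
  by apply: Cn_mul; [exact: Cn_cst|exact: Cn_coordinate].
under eq_fun do rewrite omega_of0; apply: Cn_sub; first exact: Cn_cst.
by apply: Cn_mul; [exact: Cn_cst|exact: Cn_sdenV].
Qed.

Lemma Cn_tau k : CnD k tau.
Proof. by apply: Cn_exp; apply: Cn_mul; [exact: Cn_cst|exact: Cn_sdenV]. Qed.

Lemma Cn_sigma k : CnD k sigma.
Proof. by apply: Cn_exp; apply: Cn_mul; [exact: Cn_cst|exact: Cn_sdenV]. Qed.

Lemma Cn_domega k i a : CnD k (domega i a).
Proof.
have cy j : CnD k (fun x : rV => y j x) by exact: Cn_coordinate.
have c2 : CnD k (fun x => (sden x ^+ 2)^-1).
  by apply: Cn_inv => [x|]; [rewrite expf_neq0|apply: Cn_exp; exact: Cn_sden].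
case: (unliftP ord0 a) => [b ->|->].
  rewrite (_ : domega i (lift ord0 b) = fun z : rV =>
    2 * (i == b)%:R * (sden z)^-1 - 4 * y b z * y i z * (sden z ^+ 2)^-1);
    last by apply/funext => z; rewrite domegaS.
  apply: Cn_sub; apply: Cn_mul => //; [exact: Cn_cst|exact: Cn_sdenV|].
  apply: Cn_mul; last exact: cy.
  by apply: Cn_mul; [exact: Cn_cst|exact: cy].
rewrite (_ : domega i ord0 = fun z : rV => 4 * y i z * (sden z ^+ 2)^-1);
  last by apply/funext => z; rewrite domega0.
apply: Cn_mul => //; apply: Cn_mul; [exact: Cn_cst|exact: cy].
Qed.

End Stereographic.

Section CatenoidGeometry.
Variables (R : realType) (N : nat).
Local Notation rV := 'rV[R]_N.+3.
Local Notation rho x := ((x : 'rV[R]_N.+3) 0 ord0).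
Local Notation ax i := (delta_mx 0 i : 'rV[R]_N.+3).
Local Notation J := (@jbracket R).
Local Notation T := (profile_root N).
Local Notation A := (profile_flux N).
Local Notation nuJ := (profile_nu N).
Local Notation W := (profile_volume N).
Local Notation q := (angular_weight N).
Local Notation V := (potential N).
Local Notation X := (@catenoid_chart R N.+3).
Implicit Types (x : rV) (i j : 'I_N.+2).

Let J0 (r : R) : J r != 0. Proof. by rewrite gt_eqF// jbracket_gt0. Qed.
Let T0 (r : R) : T r != 0. Proof. by rewrite gt_eqF// profile_root_gt0. Qed.
Let s0 x : sden x != 0. Proof. by rewrite gt_eqF// sden_gt0. Qed.
Let P0 (r : R) : J r ^+ N != 0. Proof. by rewrite expf_neq0. Qed.

Lemma is_derive_rho0 (a : R -> R) da x : is_derive (rho x) (1 : R) a da ->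
  is_derive x (ax ord0) (fun z : rV => a (rho z)) da.
Proof.
move=> ha; apply: (is_derive_eq (is_derive_compf ha (is_derive_axis x _ _))).
by rewrite eqxx mulr1.
Qed.

Lemma is_derive_rhoS (a : R -> R) da x i : is_derive (rho x) (1 : R) a da ->
  is_derive x (ax (lift ord0 i)) (fun z : rV => a (rho z)) 0.
Proof.
move=> ha; apply: (is_derive_eq (is_derive_compf ha (is_derive_axis x _ _))).
by rewrite mulr0.
Qed.

(** Sign and absolute value in [profile_height] only encode an odd extension. It agrees with the
    primitive of the even function 1 / A, and so is differentiable at 0 too. *)
Lemma is_derive_profile_height (r : R) :
  is_derive r (1 : R) (profile_height N.+3) (A r)^-1.
Proof.
rewrite (_ : profile_height N.+3 = primitive (fun r => (A r)^-1)).
  exact: is_derive_primitive (@continuous_profile_fluxV R N).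
apply/funext => t; rewrite /profile_height.
rewrite (_ : profile_slope N.+3 = fun r => (A r)^-1)//.
have pE u : 0 < u -> primitive (fun r => (A r)^-1) u =
    Rintegral (@lebesgue_measure R) `[0, u] (fun r => (A r)^-1).
  move=> u0; rewrite /primitive [X in _ - X](_ : _ = 0) ?subr0//.
  by rewrite set_itv_ge ?Rintegral_set0// bnd_simp -ltNge.
have [t0|t0|->] := ltgtP t 0.
- rewrite ltr0_sg// ltr0_norm// mulN1r -pE ?oppr_gt0// primitive_even ?opprK//.
    exact: continuous_profile_fluxV.
  by move=> u; rewrite profile_fluxN.
- by rewrite gtr0_sg// gtr0_norm// mul1r pE.
- by rewrite sgr0 mul0r primitive0.
Qed.

Lemma partial_row_mx m (i : 'I_N.+3) (u : rV -> 'rV[R]_m) (w : rV -> R) x du dw :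
  (forall k, is_derive x (ax i) (fun z => u z 0 k) (du k)) ->
  is_derive x (ax i) w dw ->
  partial i (fun z => row_mx (u z) (w z)%:M : 'rV[R]_(m + 1)) x =
  row_mx (\row_k du k) dw%:M.
Proof.
move=> hu hw.
set dX : 'rV[R]_(m + 1) := RHS.
rewrite -[RHS](_ : \row_k dX 0 k = _); last by apply/rowP => k; rewrite mxE.
apply: partial_mxE => k; rewrite {}/dX; case: (split_ordP k) => l ->.
  rewrite row_mxEl mxE (_ : (fun _ => _) = (fun z => u z 0 l)).
    exact: hu.
  by apply/funext => z; rewrite row_mxEl.
rewrite row_mxEr mxE ord1 eqxx mulr1n (_ : (fun _ => _) = w)//.
by apply/funext => z; rewrite row_mxEr mxE eqxx mulr1n.
Qed.

Lemma partial_chart0 x : partial ord0 X x =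
  row_mx ((rho x / J (rho x)) *: omega_of x) ((A (rho x))^-1)%:M.
Proof.
rewrite [X in partial _ X](_ : _ = fun z => row_mx (J (rho z) *: omega_of z)
    (profile_height N.+3 (rho z))%:M); last first.
  by apply/funext => z; rewrite /catenoid_chart rho_ofE.
have h a : is_derive x (ax ord0) (fun z : rV => (J (rho z) *: omega_of z) 0 a)
    (rho x / J (rho x) * omega_of x 0 a).
  under eq_fun do rewrite mxE.
  apply: (is_derive_eq (is_derive_mulf (is_derive_rho0 (is_derive_jbracket _))
    (is_derive_omega0 x a))).
  by rewrite mulr0 add0r mulrC.
rewrite (partial_row_mx h (is_derive_rho0 (is_derive_profile_height _))).
by congr row_mx; apply/rowP => a; rewrite !mxE.
Qed.

Lemma partial_chartS x i : partial (lift ord0 i) X x =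
  row_mx (J (rho x) *: \row_a domega i a x) 0%:M.
Proof.
rewrite [X in partial _ X](_ : _ = fun z => row_mx (J (rho z) *: omega_of z)
    (profile_height N.+3 (rho z))%:M); last first.
  by apply/funext => z; rewrite /catenoid_chart rho_ofE.
have h a : is_derive x (ax (lift ord0 i))
    (fun z : rV => (J (rho z) *: omega_of z) 0 a) (J (rho x) * domega i a x).
  under eq_fun do rewrite mxE.
  apply: (is_derive_eq (is_derive_mulf (is_derive_rhoS i (is_derive_jbracket _))
    (is_derive_omega x i a))).
  by rewrite mulr0 addr0.
rewrite (partial_row_mx h (is_derive_rhoS i (is_derive_profile_height _))).
by congr row_mx; apply/rowP => a; rewrite !mxE.
Qed.

Definition radial_metric (r : R) : R := (J r ^+ N.+1 / T r) ^+ 2.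
Definition angular_metric x : R := (J (rho x) * (2 / sden x)) ^+ 2.
Definition chart_metric (k : 'I_N.+3) x : R :=
  if unlift ord0 k is Some _ then angular_metric x else radial_metric (rho x).

Lemma radial_metricE (r : R) : (r / J r) ^+ 2 + (A r)^-1 ^+ 2 = radial_metric r.
Proof.
have := profile_root_geom N r; rewrite -[N.+2]addn2 mulnDr exprD.
rewrite mul2n -addnn exprD /= => e.
have r2 : r ^+ 2 = (J r ^+ N * J r ^+ N * J r ^+ 4 - 1) / T r ^+ 2.
  by rewrite -[4%N]/(2 * 2)%N -e; field.
rewrite /radial_metric /profile_flux exprMn r2 [J r ^+ N.+1]exprS.
by move: (J r ^+ N) => P; field; rewrite J0 T0.
Qed.

Lemma chart_metric_gt0 k x : 0 < chart_metric k x.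
Proof.
rewrite /chart_metric; case: unliftP => [j|] _; apply: exprn_gt0.
  by rewrite mulr_gt0 ?jbracket_gt0// divr_gt0// sden_gt0.
by rewrite divr_gt0 ?exprn_gt0 ?jbracket_gt0 ?profile_root_gt0.
Qed.

Lemma metric_chart x (k l : 'I_N.+3) :
  dot (partial k X x) (partial l X x) = chart_metric k x *+ (k == l).
Proof.
rewrite /chart_metric; case: (unliftP ord0 k) => [i ->|->];
  case: (unliftP ord0 l) => [j ->|->];
  rewrite ?partial_chart0 ?partial_chartS dot_row_mx dotZl dotZr.
- rewrite mul0r addr0 dot_domega (inj_eq (@lift_inj _ _)) /angular_metric.
  by rewrite -mulr_natr exprMn; ring.
- by rewrite dotC dot_omega_domega !mulr0 mul0r addr0.
- by rewrite dot_omega_domega !mulr0 addr0.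
- by rewrite dot_omega eqxx mulr1n -radial_metricE; ring.
Qed.

Lemma volume_chart x : volume_density X x = W (rho x) * sigma x.
Proof.
rewrite (volume_density_diag (metric_chart x)) big_ord_recl /chart_metric.
rewrite unlift_none; under eq_bigr do rewrite liftK.
rewrite prodr_const card_ord /radial_metric /angular_metric -exprM mulnC exprM.
rewrite -exprMn sqrtr_sqr ger0_norm; last first.
  rewrite mulr_ge0 ?divr_ge0 ?exprn_ge0 ?mulr_ge0 ?divr_ge0// ltW//
    ?jbracket_gt0 ?invr_gt0 ?sden_gt0 ?profile_root_gt0//.
rewrite /sigma exprMn /profile_volume.
rewrite (_ : (2 * N).+3 = (N.+1 + N.+2)%N) ?exprD; last by rewrite mul2n -addnn addSn !addnS.
by ring.
Qed.

(** The tangent (rho / <rho>, 1 / A) of the profile curve, rotated by a right angle and divided by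
    its length. *)
Definition chart_normal x : 'rV[R]_(N.+3 + 1) :=
  row_mx (nuJ (rho x) *: omega_of x) (- mode0_odd N (rho x))%:M.

Lemma chart_normal_unit x : dot (chart_normal x) (chart_normal x) = 1.
Proof.
rewrite dot_row_mx dotZl dotZr dot_omega mulr1.
have := profile_root_geom N (rho x); set r := rho x => e.
rewrite mulrNN -!expr2 [mode0_odd _ _ ^+ 2]exprMn [(r * _) ^+ 2]exprMn e /nuJ.
rewrite exprVn -exprM [(2 * _)%N]mulnC mulrBl mulfV ?expf_neq0// mul1r.
by rewrite addrC subrK.
Qed.

Lemma chart_normal_orth x (k : 'I_N.+3) :
  dot (chart_normal x) (partial k X x) = 0.
Proof.
case: (unliftP ord0 k) => [i ->|->]; rewrite ?partial_chart0 ?partial_chartS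
  dot_row_mx dotZl dotZr ?dot_omega_domega ?dot_omega.
  by rewrite !mulr0 add0r.
rewrite /mode0_odd /profile_flux mulr1; move: (rho x) (nuJ _) => r v.
by field; rewrite J0 T0.
Qed.

Local Notation CnD := (Cn (@axes R N.+3)).

Lemma Cn_rho k (a : R -> R) : @Cn R R [set 1] k a -> CnD k (fun x => a (rho x)).
Proof. by move=> ca; apply: Cn_comp => //; exact: Cn_coordinate. Qed.

Lemma Cn_partial_chart d (k : 'I_N.+3) l :
  CnD d (fun x => partial k X x 0 l).
Proof.
have cV : @Cn R R [set 1] d (fun r => (A r)^-1).
  apply: Cn_inv => [r|]; last exact: Cn_profile_flux.
  by rewrite gt_eqF// profile_flux_gt0.
have cJV : @Cn R R [set 1] d (fun r => r / J r).
  apply: Cn_mul; first exact: Cn_id1.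
  by apply: Cn_inv => //; exact: Cn_jbracket.
have [i ->|->] := unliftP ord0 k.
  under eq_fun do rewrite partial_chartS.
  case: (split_ordP l) => a ->.
    under eq_fun do rewrite row_mxEl mxE mxE.
    by apply: Cn_mul; [apply: Cn_rho; exact: Cn_jbracket|exact: Cn_domega].
  under eq_fun do rewrite row_mxEr mxE mul0rn.
  exact: Cn_cst.
under eq_fun do rewrite partial_chart0.
case: (split_ordP l) => a ->.
  under eq_fun do rewrite row_mxEl mxE.
  by apply: Cn_mul; [exact: Cn_rho cJV|exact: Cn_omega].
rewrite (_ : (fun _ => _) = fun x : rV => (A (rho x))^-1); first exact: Cn_rho cV.
by apply/funext => x; rewrite row_mxEr mxE (ord1 a) mulr1n.
Qed.

(** The radial principal curvature. It is -(n-1) times each of the n - 1 angular ones in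
    [partial_chart_normalS], in accordance with minimality. *)
Lemma partial_chart_normal0 x : partial ord0 chart_normal x =
  - (N.+2%:R * nuJ (rho x) / J (rho x)) *: partial ord0 X x.
Proof.
have h a : is_derive x (ax ord0) (fun z : rV => (nuJ (rho z) *: omega_of z) 0 a)
    (- (N.+2%:R * rho x / J (rho x) ^+ N.+4) * omega_of x 0 a).
  under eq_fun do rewrite mxE.
  apply: (is_derive_eq (is_derive_mulf
    (is_derive_rho0 (is_derive_jbracketXV N.+2 _)) (is_derive_omega0 x a))).
  by rewrite mulr0 add0r mulrC.
have [hf _] := @solves_mode0_odd R N.
rewrite (partial_row_mx h (is_derive_oppf (is_derive_rho0 (hf _)))) partial_chart0.
rewrite scale_row_mx scale_scalar_mx scalerA; congr row_mx.
  apply/rowP => a; rewrite [LHS]mxE [RHS]mxE; congr (_ * _).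
  rewrite /profile_nu !exprS; have := P0 (rho x); set r := rho x.
  by move: (J r ^+ N) => P ?; field; rewrite J0.
congr (_%:M); rewrite /profile_nu /profile_flux !exprS.
have := P0 (rho x); set r := rho x.
by move: (J r ^+ N) => P ?; field; rewrite J0 T0.
Qed.

Lemma partial_chart_normalS x i : partial (lift ord0 i) chart_normal x =
  (nuJ (rho x) / J (rho x)) *: partial (lift ord0 i) X x.
Proof.
have h a : is_derive x (ax (lift ord0 i))
    (fun z : rV => (nuJ (rho z) *: omega_of z) 0 a) (nuJ (rho x) * domega i a x).
  under eq_fun do rewrite mxE.
  apply: (is_derive_eq (is_derive_mulf
    (is_derive_rhoS i (is_derive_jbracketXV N.+2 _)) (is_derive_omega x i a))).
  by rewrite mulr0 addr0.
have [hf _] := @solves_mode0_odd R N.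
rewrite (partial_row_mx h (is_derive_oppf (is_derive_rhoS i (hf _)))) partial_chartS.
rewrite scale_row_mx scale_scalar_mx mulr0 oppr0 scalerA; congr row_mx.
by apply/rowP => a; rewrite [LHS]mxE [RHS]mxE [in RHS]mxE divfK.
Qed.

(* The principal curvatures of the chart, times the metric coefficients. *)
Definition chart_second (k : 'I_N.+3) x : R :=
  (if unlift ord0 k is Some _ then -1 else N.+2%:R) *
  (nuJ (rho x) / J (rho x)) * chart_metric k x.

(** Differentiating the orthogonality of [chart_normal] and the tangent vectors moves the second
    derivatives of the chart onto the normal, whose derivatives are multiples of tangent vectors. *)
Lemma second_form_chart x (k l : 'I_N.+3) :
  dot (partial k (partial l X) x) (chart_normal x) = chart_second k x *+ (k == l).
Proof.
pose F m (z : rV) : R := partial l X z 0 m.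
pose G m (z : rV) : R := chart_normal z 0 m.
have cF m : CnD 1%N (F m) by exact: Cn_partial_chart.
have hF m := Cn_is_derive x (ax k) (cF m).
have cG m : CnD 1%N (G m).
  rewrite /G /chart_normal; case: (split_ordP m) => a ->.
    under eq_fun do rewrite row_mxEl mxE.
    by apply: Cn_mul; [apply: Cn_rho; exact: Cn_profile_nu|exact: Cn_omega].
  rewrite (_ : (fun _ => _) = fun x : rV => - mode0_odd N (rho x)); last first.
    by apply/funext => z; rewrite row_mxEr mxE (ord1 a) mulr1n.
  apply: Cn_opp; apply: Cn_rho; apply: Cn_mul; last exact: Cn_profile_nu.
  by apply: Cn_mul; [exact: Cn_id1|exact: Cn_profile_root].
have hG m := Cn_is_derive x (ax k) (cG m).
have pG : partial k chart_normal x = \row_m 'D_(ax k) (G m) x.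
  exact: partial_mxE.
have h := @is_derive_sumf _ _ _ (index_enum _) predT
    (fun m z => F m z * G m z) x (ax k) _ (fun m _ => is_derive_mulf (hF m) (hG m)).
have : \sum_m (F m x * 'D_(ax k) (G m) x + G m x * 'D_(ax k) (F m) x) = 0.
  have [_ <-] := h; rewrite (_ : (fun _ => _) = cst 0) ?derive_cst//.
  by apply/funext => z; rewrite -[RHS](chart_normal_orth z l) dotC.
rewrite big_split /= => /eqP; rewrite addrC addr_eq0 => /eqP e.
rewrite (partial_mxE hF) dotC.
transitivity (- dot (partial l X x) (partial k chart_normal x)).
  rewrite -[LHS](_ : \sum_m G m x * 'D_(ax k) (F m) x = _); last first.
    by apply: eq_bigr => m _; rewrite [in RHS]mxE.
  by rewrite e pG; congr (- _); apply: eq_bigr => m _; rewrite [in RHS]mxE.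
rewrite /chart_second; case: (unliftP ord0 k) => [i ->|->];
  rewrite ?partial_chart_normalS ?partial_chart_normal0 dotZr metric_chart.
  by case: eqVneq => [->|_]; rewrite ?eqxx ?mulr1n ?mulr0n; ring.
by case: eqVneq => [->|_]; rewrite ?eqxx ?mulr1n ?mulr0n; ring.
Qed.

Lemma volume_sqnorm_second_form x :
  volume_density X x * sqnorm_second_form X x = V (rho x) * sigma x.
Proof.
rewrite (sqnorm_second_form_diag (metric_chart x) _ (chart_normal_unit x)
  (chart_normal_orth x) (second_form_chart x)); last first.
  by move=> k; rewrite gt_eqF// chart_metric_gt0.
have e k : chart_second k x / chart_metric k x =
    (if unlift ord0 k is Some _ then -1 else N.+2%:R) * (nuJ (rho x) / J (rho x)).
  by rewrite mulfK// gt_eqF// chart_metric_gt0.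
under eq_bigr do rewrite e.
rewrite big_ord_recl unlift_none; under eq_bigr do rewrite liftK.
rewrite sumr_const card_ord -[_ *+ N.+2]mulr_natl volume_chart.
rewrite /profile_volume /potential /profile_nu mul2n -addnn natrM -!natr1 !exprS exprD.
have := P0 (rho x); set r := rho x; move: (J r ^+ N) => P ?.
by field; rewrite J0 T0.
Qed.

Lemma volume_stability (f : rV -> R) x :
  volume_density X x * stability_operator X f x =
  partial (V := R^o) ord0
    (fun z => A (rho z) * sigma z * partial (V := R^o) ord0 f z) x +
  \sum_i partial (V := R^o) (lift ord0 i)
    (fun z => q (rho z) * tau z * partial (V := R^o) (lift ord0 i) f z) x +
  V (rho x) * sigma x * f x.
Proof.
rewrite /stability_operator mulrDr mulrA volume_sqnorm_second_form; congr (_ + _).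
rewrite (laplace_beltrami_diag _ _ (g := chart_metric)); last 2 first.
- by move=> z k l; exact: metric_chart.
- exact: chart_metric_gt0.
rewrite big_ord_recl; congr (_ + _).
  apply: (congr1 (fun F => partial (V := R^o) ord0 F x)).
  apply/funext => z; congr (_ * _).
  rewrite volume_chart /chart_metric unlift_none /radial_metric /profile_volume.
  rewrite /profile_flux mul2n -addnn !(exprS (J _)) exprD.
  have := P0 (rho z); set r := rho z; move: (J r ^+ N) => P P1.
  by field; rewrite J0 T0 P1.
apply: eq_bigr => i _.
apply: (congr1 (fun F => partial (V := R^o) (lift ord0 i) F x)).
apply/funext => z; congr (_ * _).
rewrite volume_chart /chart_metric liftK /angular_metric /profile_volume sigmaE.
rewrite /angular_weight mul2n -addnn !(exprS (J _)) exprD.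
have := P0 (rho z); set r := rho z; move: (J r ^+ N) => P ?.
by field; rewrite J0 T0 s0.
Qed.

End CatenoidGeometry.

(** * Separation of variables *)

Section Monomials.
Variables (R : realType) (N : nat).
Local Notation rV := 'rV[R]_N.+3.
Local Notation rho x := ((x : 'rV[R]_N.+3) 0 ord0).
Local Notation ax i := (delta_mx 0 i : 'rV[R]_N.+3).
Local Notation CnD := (Cn (@axes R N.+3)).
Local Notation D i f := ('D_(ax (lift ord0 i)) f).
Implicit Types (x : rV) (i : 'I_N.+2) (f g : rV -> R) (w : seq 'I_N.+3).

Let CD i k f : CnD k.+1 f -> CnD k (D i f).
Proof. by move=> cf; exact: (Cn_derive (axesP _ _) cf). Qed.

Let dD i k f x : CnD k.+1 f -> is_derive x (ax (lift ord0 i)) f (D i f x).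
Proof. by move=> cf; exact: Cn_is_derive cf. Qed.

(* Both are those of the round sphere multiplied by [sigma]. *)
Definition sphere_laplacian f x : R := \sum_i D i (fun z => tau z * D i f z) x.
Definition sphere_gradients f g x : R := tau x * \sum_i D i f x * D i g x.

Let derive_mulf i f g x : CnD 1%N f -> CnD 1%N g ->
  D i (fun z => f z * g z) x = f x * D i g x + g x * D i f x.
Proof.
by move=> cf cg; have [] := is_derive_mulf (dD i x cf) (dD i x cg).
Qed.

Lemma sphere_laplacianM f g x : CnD 2%N f -> CnD 2%N g ->
  sphere_laplacian (fun z => f z * g z) x = f x * sphere_laplacian g x +
    g x * sphere_laplacian f x + 2 * sphere_gradients f g x.
Proof.
move=> cf cg; rewrite /sphere_laplacian /sphere_gradients !mulr_sumr -!big_split.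
apply: eq_bigr => i _ /=.
have cf1 := CnW cf; have cg1 := CnW cg; have ct k := @Cn_tau R N k.
have cdf := CD i cf; have cdg := CD i cg.
have ctf : CnD 1%N (fun z => tau z * D i f z) by exact: Cn_mul (ct 1%N) cdf.
have ctg : CnD 1%N (fun z => tau z * D i g z) by exact: Cn_mul (ct 1%N) cdg.
rewrite (_ : (fun z => tau z * D i (fun z => f z * g z) z) =
  (fun z => f z * (tau z * D i g z) + g z * (tau z * D i f z))); last first.
  apply/funext => z; rewrite derive_mulf//.
  by move: (D i f z) (D i g z) => *; ring.
have h1 := is_derive_mulf (dD i x cf1) (dD i x ctg).
have h2 := is_derive_mulf (dD i x cg1) (dD i x ctf).
have [_ ->] := is_derive_addf h1 h2.
move: (D i (fun z => tau z * D i g z) x) (D i (fun z => tau z * D i f z) x).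
by move: (D i f x) (D i g x) (f x) (g x) (tau x) => *; ring.
Qed.

Lemma sphere_gradientsM f g h x : CnD 1%N g -> CnD 1%N h ->
  sphere_gradients f (fun z => g z * h z) x =
  g x * sphere_gradients f h x + h x * sphere_gradients f g x.
Proof.
move=> cg ch; rewrite /sphere_gradients !mulr_sumr -!big_split.
apply: eq_bigr => i _ /=; rewrite derive_mulf//.
by move: (D i f x) (D i g x) (D i h x) (g x) (h x) (tau x) => *; ring.
Qed.

Lemma sphere_laplacian_omega a x : sphere_laplacian (fun z => omega_of z 0 a) x =
  - (N.+2%:R * sigma x * omega_of x 0 a).
Proof.
rewrite -omega_divergence; apply: eq_bigr => i _.
transitivity (D i (fun z => tau z * domega i a z) x).
  apply: (congr1 (fun F : rV -> R => D i F x)); apply/funext => z.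
  by have [_ e] := is_derive_omega z i a; congr (_ * _).
by have [_ ->] := is_derive_mulf (is_derive_tau x i) (is_derive_domega x i a).
Qed.

Lemma sphere_gradients_omega a b x :
  sphere_gradients (fun z => omega_of z 0 a) (fun z => omega_of z 0 b) x =
  sigma x * ((a == b)%:R - omega_of x 0 a * omega_of x 0 b).
Proof.
rewrite sigmaE -mulrA [in RHS]mulrCA -omega_gradient; congr (_ * _).
apply: eq_bigr => i _.
by have [_ ->] := is_derive_omega x i a; have [_ ->] := is_derive_omega x i b.
Qed.

Definition monomial w (v : rV) : R := \prod_(a <- w) v 0 a.
Definition omega_monomial w x : R := monomial w (omega_of x).
Local Notation P := omega_monomial.

Lemma omega_monomial_nil : P [::] = cst 1.
Proof. by apply/funext => x; rewrite /P /monomial big_nil. Qed.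

Lemma omega_monomial_cons a w : P (a :: w) = fun x => omega_of x 0 a * P w x.
Proof. by apply/funext => x; rewrite /P /monomial big_cons. Qed.

Lemma Cn_monomial (B : set rV) k w : Cn B k (monomial w).
Proof.
elim: w => [|a w IH]; first by rewrite (_ : monomial _ = cst 1); [exact: Cn_cst|apply/funext => v; rewrite /monomial big_nil].
rewrite (_ : monomial _ = fun v => v 0 a * monomial w v).
  by apply: Cn_mul => //; exact: Cn_coordinate.
by apply/funext => v; rewrite /monomial big_cons.
Qed.

Lemma Cn_omega_monomial k w : CnD k (P w).
Proof.
elim: w => [|a w IH]; first by rewrite omega_monomial_nil; exact: Cn_cst.
by rewrite omega_monomial_cons; apply: Cn_mul => //; exact: Cn_omega.
Qed.

Let D_cst i x : D i (cst (1 : R)) x = 0.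
Proof. exact: derive_cst. Qed.

(** For P homogeneous of degree d on R^n, the inner product on the sphere of the gradients of
    omega_a and P is the a-th partial derivative of P minus d omega_a P, by Euler's identity. [L]
    lists the monomials of that partial derivative with multiplicity. *)
Lemma sphere_gradients_monomial a w : exists2 L : seq (seq 'I_N.+3),
  all (fun v => (size v).+1 == size w) L &
  forall x, sphere_gradients (fun z => omega_of z 0 a) (P w) x =
    sigma x * (\sum_(v <- L) P v x - (size w)%:R * (omega_of x 0 a * P w x)).
Proof.
elim: w => [|b w [L sL hL]].
  exists [::] => // x; rewrite big_nil /sphere_gradients omega_monomial_nil.
  by rewrite big1 => [|i _]; rewrite ?D_cst ?mul0r ?subr0 !mulr0.
exists ([seq b :: v | v <- L] ++ nseq (a == b) w).
  rewrite all_cat all_map; apply/andP; split.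
    by apply: sub_all sL => v /= /eqP <-.
  by rewrite all_nseq eqxx orbT.
move=> x; rewrite omega_monomial_cons sphere_gradientsM; last 2 first.
- exact: Cn_omega.
- exact: Cn_omega_monomial.
rewrite hL sphere_gradients_omega big_cat big_map /=.
under [in RHS]eq_bigr do rewrite omega_monomial_cons.
rewrite -mulr_sumr (_ : \sum_(v <- nseq (a == b) w) P v x = (a == b)%:R * P w x).
  rewrite -natr1; move: (P w x) (\sum_(v <- L) _) ((a == b)%:R).
  by move: (omega_of x 0 a) (omega_of x 0 b) (sigma x) => *; ring.
by case: (a == b); rewrite /= ?big_cons big_nil ?mul1r ?addr0// mul0r.
Qed.

(** For P homogeneous of degree d, the spherical Laplacian of P is its Laplacian in R^n minus d (d +
    n - 2) P. [L] lists the monomials of the former with multiplicity. *)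
Lemma sphere_laplacian_monomial w : exists2 L : seq (seq 'I_N.+3),
  all (fun v => (size v).+2 == size w) L &
  forall x, sphere_laplacian (P w) x =
    sigma x * (\sum_(v <- L) P v x - (size w * (size w + N.+1))%:R * P w x).
Proof.
elim: w => [|a w [L sL hL]].
  exists [::] => // x; rewrite big_nil mul0n mul0r subr0 mulr0.
  rewrite omega_monomial_nil; apply: big1 => i _.
  rewrite (_ : (fun _ => _) = cst 0); first exact: derive_cst.
  by apply/funext => z; rewrite D_cst mulr0.
have [L' sL' hL'] := sphere_gradients_monomial a w.
exists ([seq a :: v | v <- L] ++ L' ++ L').
  rewrite !all_cat all_map; apply/andP; split.
    by apply: sub_all sL => v /= /eqP <-.
  by rewrite andbb; apply: sub_all sL' => v /= /eqP <-.
move=> x; rewrite omega_monomial_cons sphere_laplacianM; last 2 first.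
- exact: Cn_omega.
- exact: Cn_omega_monomial.
rewrite hL hL' sphere_laplacian_omega !big_cat big_map /=.
under [in RHS]eq_bigr do rewrite omega_monomial_cons.
rewrite -mulr_sumr !natrM !natrD -!natr1.
move: (\sum_(v <- L) _) (\sum_(v <- L') _) (P w x) (omega_of x 0 a) (sigma x).
by move=> *; ring.
Qed.

Local Notation A := (profile_flux N).
Local Notation q := (angular_weight N).
Local Notation V := (potential N).

Definition jacobi_density f x : R :=
  'D_(ax ord0) (fun z => A (rho z) * sigma z * 'D_(ax ord0) f z) x +
  \sum_i D i (fun z => q (rho z) * tau z * D i f z) x +
  V (rho x) * sigma x * f x.

Lemma jacobi_densityE f x : volume_density (@catenoid_chart R N.+3) x *
  stability_operator (@catenoid_chart R N.+3) f x = jacobi_density f x.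
Proof. exact: volume_stability. Qed.

Lemma is_derive_omega_monomial0 x w : is_derive x (ax ord0) (P w) 0.
Proof.
elim: w => [|a w IH]; first by rewrite omega_monomial_nil; exact: is_derive_cst.
rewrite omega_monomial_cons.
apply: (is_derive_eq (is_derive_mulf (is_derive_omega0 x a) IH)).
by rewrite !mulr0 addr0.
Qed.

Lemma Cn_angular_weight k : @Cn R R [set 1] k q.
Proof.
apply: Cn_mul; first by apply: Cn_exp; exact: Cn_jbracket.
apply: Cn_inv => [r|]; last exact: Cn_profile_root.
by rewrite gt_eqF// profile_root_gt0.
Qed.

Lemma jacobi_density_mode w : exists2 L : seq (seq 'I_N.+3),
  all (fun v => (size v).+2 == size w) L &
  forall (b db c : R -> R) x,
    (forall r, is_derive r (1 : R) b (db r)) ->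
    (forall r, is_derive r (1 : R) (fun r => A r * db r) (c r)) ->
    jacobi_density (fun z => b (rho z) * P w z) x =
    sigma x * ((c (rho x) - mode_potential N (size w) (rho x) * b (rho x)) * P w x +
      q (rho x) * b (rho x) * \sum_(v <- L) P v x).
Proof.
have [L sL hL] := sphere_laplacian_monomial w; exists L => // b db c x hb hc.
transitivity (c (rho x) * (sigma x * P w x) +
  \sum_i q (rho x) * b (rho x) * D i (fun z => tau z * D i (P w) z) x +
  V (rho x) * sigma x * (b (rho x) * P w x)).
  congr (_ + _ + _).
    transitivity ('D_(ax ord0) (fun z : rV => A (rho z) * db (rho z) * (sigma z * P w z)) x).
      apply: (congr1 (fun F : rV -> R => 'D_(ax ord0) F x)); apply/funext => z.
      have [_ e] := is_derive_mulf (is_derive_rho0 (hb _)) (is_derive_omega_monomial0 z w).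
      rewrite e mulr0 add0r.
      by move: (db _) (P w z) (A _) (sigma z) => *; ring.
    have h0 := is_derive_mulf (is_derive_rho0 (x := x) (hc _))
      (is_derive_mulf (is_derive_sigma0 x) (is_derive_omega_monomial0 x w)).
    have [_ e] := h0; rewrite e.
    by move: (c _) (P w x) (A _) (sigma x) (db _) => *; ring.
  apply: eq_bigr => i _.
  transitivity (D i (fun z : rV => (q (rho z) * b (rho z)) * (tau z * D i (P w) z)) x).
    apply: (congr1 (fun F : rV -> R => D i F x)); apply/funext => z.
    have [_ e] := is_derive_mulf (is_derive_rhoS i (hb _))
      (dD i z (Cn_omega_monomial 1 w)).
    rewrite e mulr0 addr0.
    by move: (b _) (D i _ z) (tau z) (q _) => *; ring.
  have hqb : is_derive (rho x) (1 : R) (fun r => q r * b r) _ :=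
    is_derive_mulf (Cn_is_derive _ _ (Cn_angular_weight 1)) (hb _).
  have ct : CnD 1%N (fun z => tau z * D i (P w) z).
    by apply: Cn_mul; [exact: Cn_tau|apply: CD; exact: Cn_omega_monomial].
  have [_ e] := is_derive_mulf (is_derive_rhoS i hqb) (dD i x ct).
  by rewrite e mulr0 addr0.
rewrite -mulr_sumr -/(sphere_laplacian (P w) x) hL /mode_potential.
move: (b _) (c _) (P w x) (\sum_(v <- L) _) (q _) (V _) (sigma x) => *.
by ring.
Qed.

End Monomials.

(** * Green's formula in the chart *)

Section Decay.
Variable R : realType.
Local Notation leb := (@lebesgue_measure R).
Local Notation Rm := (measurableTypeR R).
Local Notation tup := (lebesgue_tuple R).
Local Notation u t := (Num.sqrt (1 + `|t|)).
Implicit Types t : R.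

(* The exponent 3/2 makes [\prod_i decay (y_i)] dominate [|y| ^ - (2 n - 3)] on
   the (n - 1)-dimensional space of stereographic coordinates. *)
Definition decay t : R := (u t ^+ 3)^-1.

Let u_ge1 t : 1 <= u t.
Proof. by rewrite -[leLHS]sqrtr1 ler_wsqrtr// lerDl. Qed.

Let u_gt0 t : 0 < u t.
Proof. exact: lt_le_trans (u_ge1 t). Qed.

Lemma decay_gt0 t : 0 < decay t.
Proof. by rewrite invr_gt0 exprn_gt0. Qed.

Lemma decay_le1 t : decay t <= 1.
Proof. by rewrite invf_le1 ?exprn_gt0// exprn_ege1. Qed.

Lemma decayN t : decay (- t) = decay t.
Proof. by rewrite /decay normrN. Qed.

Lemma decay_ler s t : `|s| <= `|t| -> decay t <= decay s.
Proof.
move=> st; rewrite lef_pV2 ?posrE ?exprn_gt0// ler_pXn2r ?nnegrE ?(ltW (u_gt0 _))//.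
by rewrite ler_wsqrtr// lerD2l.
Qed.

Let continuous_u : continuous (fun t => u t).
Proof.
move=> t; apply: continuous_comp; last exact: sqrt_continuous.
by apply: cvgD; [exact: cvg_cst|apply: cvg_norm; exact: cvg_id].
Qed.

Lemma continuous_decay : continuous decay.
Proof.
move=> t; apply: cvgV; first by rewrite expf_neq0// gt_eqF.
by apply: (@continuous_comp _ _ _ (fun t => u t) (fun x => x ^+ 3));
  [exact: continuous_u|exact: exprn_continuous].
Qed.

Let decay_le t : decay t <= (u t)^-1.
Proof.
by rewrite lef_pV2 ?posrE ?exprn_gt0// -[leLHS]expr1 ler_weXn2l.
Qed.

Let uV_small (e : R) : 0 < e -> forall t, (e^-1) ^+ 2 < `|t| -> (u t)^-1 < e.
Proof.
move=> e0 t et; rewrite invf_plt ?posrE//.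
rewrite -[ltLHS](@ger0_norm _ e^-1) ?invr_ge0 ?ltW// -sqrtr_sqr.
rewrite ltr_sqrt; last by rewrite ltr_pwDl.
by rewrite (lt_trans et)// ltrDr.
Qed.

Lemma decay_cvgy0 : decay t @[t --> +oo] --> (0 : R).
Proof.
apply/cvgrPdist_lt => e e0; near=> t.
rewrite sub0r normrN gtr0_norm ?decay_gt0// (le_lt_trans (decay_le _))//.
apply: uV_small => //; apply: lt_le_trans (ler_norm t).
by near: t; apply: nbhs_pinfty_gt; exact: num_real.
Unshelve. all: by end_near. Qed.

Lemma decay_cvgNy0 : decay t @[t --> -oo] --> (0 : R).
Proof.
apply/cvgNy_compNP; rewrite (_ : decay \o -%R = decay); first exact: decay_cvgy0.
by apply/funext => t; rewrite /= decayN.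
Qed.

Lemma integral_decay_lty : (\int[leb]_t (decay t)%:E < +oo)%E.
Proof.
have dF (t : R) : -1 < t -> is_derive t (1 : R) (fun t => - 2 * (Num.sqrt (1 + t))^-1)
    ((Num.sqrt (1 + t) ^+ 3)^-1).
  rewrite -subr_gt0 opprK addrC => t0.
  have h1 : is_derive t (1 : R) (fun t => 1 + t) 1.
    apply: (is_derive_eq (is_derive_addf (is_derive_cst (1 : R) t (1 : R))
      (is_derive_id t (1 : R)))).
    by rewrite add0r.
  have s0 : Num.sqrt (1 + t) != 0 by rewrite gt_eqF// sqrtr_gt0.
  have h2 := @is_derive_sqrtf R R (fun t => 1 + t) t _ _ t0 h1.
  have h3 := @is_derive_invf R R (fun t => Num.sqrt (1 + t)) t _ _ s0 h2.
  apply: (is_derive_eq (is_derive_scalef (- 2) h3)).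
  by field.
rewrite ge0_symfun_integralT; last 3 first.
- by move=> t; exact: ltW (decay_gt0 t).
- exact: continuous_decay.
- by move=> t /=; rewrite decayN.
rewrite (_ : [set x | _] = `[0, +oo[%classic); last first.
  by apply/seteqP; split => x/=; rewrite in_itv/= andbT.
rewrite (@ge0_continuous_FTC2y R decay (fun t => - 2 * (Num.sqrt (1 + t))^-1) 0 0).
- by rewrite -EFinB -EFinM ltry.
- by move=> t _; exact: ltW (decay_gt0 t).
- by apply: continuous_subspaceT; exact: continuous_decay.
- rewrite -(mulr0 (- 2)); apply: cvgM; first exact: cvg_cst.
  apply/cvgrPdist_lt => e e0; near=> t.
  have t0 : 0 <= t by near: t; apply: nbhs_pinfty_ge; exact: num_real.
  rewrite sub0r normrN gtr0_norm ?invr_gt0 ?sqrtr_gt0 ?ltr_pwDl//.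
  have := uV_small e0 (t := t); rewrite ger0_norm//; apply.
  by near: t; apply: nbhs_pinfty_gt; exact: num_real.
- by move=> t t0; have [] := dF t (lt_trans (ltrN10 R) t0).
- have [d _] := dF 0 (ltrN10 R).
  move/derivable1_diffP/differentiable_continuous : d => h.
  by apply: cvg_at_right_filter; exact: h.
- move=> t; rewrite in_itv /= andbT => t0; rewrite derive1E.
  by have [_ ->] := dF t (lt_trans (ltrN10 R) t0); rewrite /decay gtr0_norm.
Unshelve. all: by end_near. Qed.

Definition majorant n (x : 'rV[R]_n) : R := \prod_i decay (x 0 i).

Lemma majorant_gt0 n (x : 'rV[R]_n) : 0 < majorant x.
Proof. by apply: prodr_gt0 => i _; exact: decay_gt0. Qed.

Lemma majorant_row n (t : n.-tuple Rm) :
  majorant (row_of_tuple t) = \prod_(i < n) decay (tnth t i).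
Proof. by apply: eq_bigr => i _; rewrite mxE. Qed.

Let measurable_decay : measurable_fun setT (decay : Rm -> R).
Proof. exact: continuous_measurable_fun continuous_decay. Qed.

Lemma measurable_majorant n :
  measurable_fun setT (fun t : n.-tuple Rm => majorant (row_of_tuple t)).
Proof.
under eq_fun do rewrite majorant_row.
apply: measurable_prod => i _; apply: (measurableT_comp measurable_decay).
exact: measurable_tnth.
Qed.

Lemma integrable_majorant n (F : n.-tuple Rm -> R) C :
  measurable_fun setT F ->
  (forall p, `|F p| <= C * majorant (row_of_tuple p)) ->
  (tup n).-integrable setT (EFin \o F).
Proof.
move=> mF FC.
apply: (integrable_le mF FC).
rewrite (_ : EFin \o _ =
  fun p => (C%:E * (EFin \o (fun p => majorant (row_of_tuple p))) p)%E);
  last by apply/funext => p /=; rewrite EFinM.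
have mm := @measurable_majorant n.
apply: integrableZl => //.
apply: ge0_integrable => //; first by move=> p; exact: ltW (majorant_gt0 _).
under eq_integral do rewrite majorant_row.
rewrite (@ge0_integral_prod_tuple R n (fun _ => decay)) => [|//|i t];
  last exact: ltW (decay_gt0 t).
have I0 : (0 <= \int[leb]_t (decay t)%:E)%E.
  by apply: integral_ge0 => t _; rewrite lee_fin ltW// decay_gt0.
suff : (0 <= \prod_(i < n) \int[leb]_t (decay t)%:E < +oo)%E by case/andP.
elim/big_ind : _ => [|x y /andP[x0 xy] /andP[y0 yy]|i _].
- by rewrite lee01 ltry.
- by rewrite mule_ge0// lte_mul_pinfty// ge0_fin_numE.
- by rewrite I0 integral_decay_lty.
Qed.

Let row_tset n (i : 'I_n) (t : n.-tuple Rm) (h s : R) :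
  row_of_tuple (tset t i (h + s)) =
  h *: delta_mx 0 i + row_of_tuple (tset t i s).
Proof.
apply/rowP => j; rewrite !mxE !tnth_mktuple eqxx.
by case: eqVneq => _; rewrite ?mulr1 // mulr0 add0r.
Qed.

Lemma is_derive_tset n (i : 'I_n) (G : 'rV[R]_n -> R) (t : n.-tuple Rm) s dG :
  is_derive (row_of_tuple (tset t i s)) (delta_mx 0 i) G dG ->
  is_derive s (1 : R) (fun s => G (row_of_tuple (tset t i s))) dG.
Proof.
have tE (h : R) : row_of_tuple (tset t i (h *: 1 + s)) =
    h *: delta_mx 0 i + row_of_tuple (tset t i s).
  by rewrite -row_tset [h *: 1]mulr1.
have e : (fun h : R => h^-1 *: ((G \o shift (row_of_tuple (tset t i s)))
      (h *: delta_mx 0 i) - G (row_of_tuple (tset t i s)))) =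
    (fun h : R => h^-1 *: (((fun s => G (row_of_tuple (tset t i s))) \o shift s)
      (h *: 1) - G (row_of_tuple (tset t i s)))).
  by apply/funext => h /=; rewrite tE.
move=> [h1 h2]; split; first by rewrite /derivable -e; exact: h1.
by rewrite /derive -e; exact: h2.
Qed.

(** Two kinds of decay are combined: of [G] in the one coordinate [i], for the boundary terms, and
    of [g] in all coordinates, for Fubini. *)
Lemma integral_partial_derive0 n (i : 'I_n) (G g : 'rV[R]_n -> R) C C' :
  (forall x, is_derive x (delta_mx 0 i) G (g x)) -> continuous g ->
  (forall x, `|G x| <= C * decay (x 0 i)) ->
  (forall x, `|g x| <= C' * majorant x) ->
  (tup n).-integrable setT (fun p => (g (row_of_tuple p))%:E) /\
  (\int[tup n]_p (g (row_of_tuple p))%:E = 0)%E.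
Proof.
move=> dG cg GC gC.
have ig : (tup n).-integrable setT (EFin \o (fun p => g (row_of_tuple p))).
  by apply: (@integrable_majorant _ _ C') => [|p]; [exact: measurable_row_of_tuple|].
split=> //.
have lim0 (Fl : set_system R) (t : n.-tuple Rm) : Filter Fl -> decay s @[s --> Fl] --> (0 : R) ->
    G (row_of_tuple (tset t i s)) @[s --> Fl] --> (0 : R).
  move=> FF d0.
  have Cd : C * decay s @[s --> Fl] --> (0 : R).
    by rewrite -(mulr0 C); have h := cvgM (cvg_cst C) d0; exact: h.
  have CdN : - (C * decay s) @[s --> Fl] --> (0 : R).
    by rewrite -oppr0; exact: cvgN Cd.
  apply: squeeze_cvgr CdN Cd; near=> s; rewrite -ler_norml.
  by rewrite (le_trans (GC _))// mxE tnth_mktuple eqxx.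
apply: (@integral_coord_derive0 R n i (fun p => G (row_of_tuple p))) => //.
- by move=> t s; exact: is_derive_tset.
- move=> t s; apply: continuous_comp; last exact: cg.
  rewrite (_ : (fun s => _) =
    fun s : R => s *: (delta_mx 0 i : 'rV[R]_n) + row_of_tuple (tset t i 0)).
    by apply: cvgD; [apply: cvgZl; exact: cvg_id|exact: cvg_cst].
  by apply/funext => r; rewrite -row_tset addr0.
- by move=> t; apply: lim0; exact: decay_cvgy0.
- by move=> t; apply: lim0; exact: decay_cvgNy0.
Unshelve. all: by end_near. Qed.

End Decay.

Lemma is_derive_comp_row (R : realType) m (V : normedModType R)
    (F : 'rV[R]_m -> R) (G : V -> 'rV[R]_m) (x v : V) (dG : 'I_m -> R) :
  differentiable F (G x) ->
  (forall a, is_derive x v (fun y => G y 0 a) (dG a)) ->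
  is_derive x v (fun y => F (G y)) (\sum_a 'D_(delta_mx 0 a) F (G x) * dG a).
Proof.
move=> dF hG.
have dGx : derivable G x v.
  by apply/derivable_mxP => i j; rewrite (ord1 i); have [] := hG j.
have GE : 'D_v G x = \row_a dG a.
  rewrite derive_mx//; apply/rowP => a; rewrite !mxE.
  by have [_ e] := hG a; exact: e.
pose p (h : R) := G (h *: v + x).
have p0 : p 0 = G x by rewrite /p scale0r add0r.
have dp : derivable p 0 1 by move/derivable1P : dGx.
have dpf : differentiable p 0 by exact/derivable1_diffP.
have dpE : 'D_1 p 0 = \row_a dG a.
  rewrite -GE /derive.
  set g1 := fun h => h^-1 *: _; set g2 := fun h => h^-1 *: _.
  suff -> : g1 = g2 by []; apply/funext => h; rewrite /g1 /g2.
  by rewrite /p /= addr0 scale0r add0r [h%:A]mulr1.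
have dFp : differentiable F (p 0) by rewrite p0.
have dFG : differentiable (F \o p) 0 by exact: differentiable_comp.
have h1 : 'D_1 (F \o p) 0 = \sum_a 'D_(delta_mx 0 a) F (G x) * dG a.
  have e : 'd p (0 : R) 1 = \row_a dG a by rewrite -deriveE.
  rewrite deriveE// diff_comp// [LHS]/= e p0.
  rewrite [in LHS](_ : \row_a dG a = \sum_a dG a *: delta_mx 0 a); last first.
    by rewrite [LHS]row_sum_delta; apply: eq_bigr => a _; rewrite mxE.
  rewrite linear_sum; apply: eq_bigr => a _.
  by rewrite linearZ /= -deriveE// mulrC.
split; first by apply/derivable1P; have /derivable1_diffP := dFG.
rewrite -h1 /derive.
set g1 := fun h => h^-1 *: _; set g2 := fun h => h^-1 *: _.
suff -> : g1 = g2 by []; apply/funext => h; rewrite /g1 /g2.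
by rewrite /p /= addr0 scale0r add0r [h%:A]mulr1.
Qed.

Lemma Cn_comp_row (R : realType) m (V : normedModType R) (D : set V) k
    (F : 'rV[R]_m -> R) (G : V -> 'rV[R]_m) :
  (forall l, Cn (@axes R m) l F) -> (forall a, Cn D k (fun x => G x 0 a)) ->
  Cn D k (fun x => F (G x)).
Proof.
have GE : G = \sum_a (fun x => G x 0 a *: (delta_mx 0 a : 'rV[R]_m)).
  by apply/funext => x; rewrite fct_sumE -row_sum_delta.
elim: k F => [|k IH] F cF cG.
  split=> // x; apply: (@continuous_comp _ _ _ G F); last exact: Cn_cont (cF 0%N) _.
  rewrite GE; elim/big_ind : _ => [|f g cf cg|a _].
  - exact: cst_continuous.
  - exact: cvgD.
  - by apply: cvgZl; exact: Cn_cont (cG a) _.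
have dG x : differentiable G x.
  by rewrite GE; apply: differentiable_sum => a; apply: differentiableZl;
    exact: Cn_diff (cG a) _.
have dF x : differentiable F x by exact: Cn_diff (cF 1%N) x.
apply: CnS => [x|v Dv]; first exact: differentiable_comp.
rewrite (_ : 'D_v _ = fun x =>
    \sum_a 'D_(delta_mx 0 a) F (G x) * 'D_v (fun x => G x 0 a) x).
  apply: Cn_sum => a _; apply: Cn_mul; last exact: (Cn_derive Dv (cG a)).
  exact: (IH _ (fun l => Cn_derive (axesP _ _) (cF l.+1)) (fun b => CnW (cG b))).
apply/funext => x.
have [_ e] := is_derive_comp_row (dF (G x)) (fun a => Cn_is_derive x v (cG a)).
exact: e.
Qed.

Lemma bounded_on_box (R : realType) m (F : 'rV[R]_m -> R) (M : R) :
  continuous F -> exists C, forall v : 'rV[R]_m, (forall a, `|v 0 a| <= M) -> `|F v| <= C.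
Proof.
move=> cF; pose K := [set v : 'rV[R]_m | forall a, `[- M, M]%classic (v 0 a)].
have cK : compact K by apply: (@rV_compact _ _ (fun=> `[- M, M]%classic)) => _;
  exact: segment_compact.
have cFK : compact ((fun v => `|F v|) @` K).
  apply: continuous_compact => //; apply: continuous_subspaceT => v.
  by apply: (@continuous_comp _ _ _ F (fun z => `|z|)); [exact: cF|exact: norm_continuous].
have [C [_ CF]] := compact_bounded cFK; exists (C + 1) => v vM.
rewrite -[leLHS]ger0_norm//; apply: (CF (C + 1)); first by rewrite ltrDl.
by exists v => // a /=; rewrite in_itv /= -ler_norml.
Qed.

Section Green.
Variables (R : realType) (N : nat).
Local Notation rV := 'rV[R]_N.+3.
Local Notation rho x := ((x : 'rV[R]_N.+3) 0 ord0).
Local Notation y i x := ((x : 'rV[R]_N.+3) 0 (lift ord0 i)).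
Local Notation ax i := (delta_mx 0 i : 'rV[R]_N.+3).
Local Notation CnD := (Cn (@axes R N.+3)).
Local Notation D0 f := ('D_(ax ord0) f).
Local Notation D i f := ('D_(ax (lift ord0 i)) f).
Implicit Types (x : rV) (i : 'I_N.+2) (f g h : rV -> R).

Definition sroot x : R := Num.sqrt (sden x).
Local Notation r := sroot.

Lemma sroot_sqr x : r x ^+ 2 = sden x.
Proof. by rewrite sqr_sqrtr// ltW// sden_gt0. Qed.

Lemma sroot_gt0 x : 0 < r x.
Proof. by rewrite sqrtr_gt0 sden_gt0. Qed.

Lemma sroot_ge1 x : 1 <= r x.
Proof. by rewrite -[leLHS]sqrtr1 ler_wsqrtr// sden_ge1. Qed.

Lemma sroot_ge x i : `|y i x| <= r x.
Proof.
rewrite -sqrtr_sqr ler_wsqrtr// /sden (bigD1 i)//= addrCA lerDl.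
by rewrite addr_ge0// sumr_ge0// => j _; exact: sqr_ge0.
Qed.

(** Uniform only for bounded rho: test functions restrict rho, but in general stay nonzero as the
    stereographic coordinates tend to infinity, that is, near the omitted point of the sphere. *)
Definition decays (k : nat) h := forall B : R, exists C : R,
  forall x, `|rho x| <= B -> `|h x| * r x ^+ k <= C.

Lemma decaysM k l f g : decays k f -> decays l g ->
  decays (k + l) (fun x => f x * g x).
Proof.
move=> df dg B; have [C Cf] := df B; have [C' Cg] := dg B.
exists (C * C') => x xB; rewrite normrM exprD mulrACA.
by apply: ler_pM; rewrite ?Cf ?Cg// mulr_ge0// exprn_ge0// ltW// sroot_gt0.
Qed.

Lemma decaysD k f g : decays k f -> decays k g -> decays k (fun x => f x + g x).
Proof.
move=> df dg B; have [C Cf] := df B; have [C' Cg] := dg B.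
exists (C + C') => x xB; apply: le_trans (lerD (Cf x xB) (Cg x xB)).
by rewrite -mulrDl ler_wpM2r ?ler_normD// exprn_ge0// ltW// sroot_gt0.
Qed.

Lemma decaysN k f : decays k f -> decays k (fun x => - f x).
Proof.
by move=> df B; have [C Cf] := df B; exists C => x xB; rewrite normrN Cf.
Qed.

Lemma decaysB k f g : decays k f -> decays k g -> decays k (fun x => f x - g x).
Proof. by move=> df dg; apply: decaysD => //; exact: decaysN. Qed.

Lemma decaysW k l f : (k <= l)%N -> decays l f -> decays k f.
Proof.
move=> kl df B; have [C Cf] := df B; exists C => x xB.
apply: le_trans (Cf x xB); rewrite ler_wpM2l// ler_weXn2l// sroot_ge1//.
Qed.

Lemma decays_sum k (I : Type) (s : seq I) (F : I -> rV -> R) :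
  (forall a, decays k (F a)) -> decays k (fun x => \sum_(a <- s) F a x).
Proof.
move=> dF; elim: s => [|a s IH].
  by move=> B; exists 0 => x _; rewrite big_nil normr0 mul0r.
by under eq_fun do rewrite big_cons; exact: decaysD.
Qed.

Lemma decays_rho (b : R -> R) : continuous b -> decays 0 (fun x => b (rho x)).
Proof.
move=> cb B; have [C Cb] := bounded_on_segment (normr_ge0 B) cb.
by exists C => x xB; rewrite mulr1 Cb// (le_trans xB)// ler_norm.
Qed.

Let s0 x : sden x != 0. Proof. by rewrite gt_eqF// sden_gt0. Qed.
Let r0 x : r x != 0. Proof. by rewrite gt_eqF// sroot_gt0. Qed.

Lemma decaysMl k f g : decays 0 f -> decays k g -> decays k (fun x => f x * g x).
Proof. exact: decaysM. Qed.

Lemma decays_cst (c : R) : decays 0 (cst c).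
Proof. by move=> B; exists `|c| => x _; rewrite mulr1. Qed.

Lemma decays_srootV k : decays k (fun x => (r x ^+ k)^-1).
Proof.
move=> B; exists 1 => x _; rewrite normfV ger0_norm; last first.
  by rewrite exprn_ge0// ltW// sroot_gt0.
by rewrite mulVf// expf_neq0.
Qed.

Lemma decays_ratio i : decays 0 (fun x => y i x / r x).
Proof.
move=> B; exists 1 => x _; rewrite mulr1 normrM normfV.
rewrite (ger0_norm (ltW (sroot_gt0 x))).
by rewrite ler_pdivrMr ?sroot_gt0// mul1r sroot_ge.
Qed.

Lemma omega_le1 x a : `|omega_of x 0 a| <= 1.
Proof.
rewrite -(@ler_pXn2r _ 2%N) ?nnegrE// expr1n real_normK ?num_real//.
rewrite -[leRHS](dot_omega x) /dot (bigD1 a)//= expr2 lerDl.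
by apply: sumr_ge0 => j _; rewrite -expr2 sqr_ge0.
Qed.

Lemma decays_domega i a : decays 2 (domega i a).
Proof.
have [b ->|->] := unliftP ord0 a.
  rewrite (_ : domega i (lift ord0 b) = fun x =>
    (2 * (i == b)%:R - 4 * (y b x / r x * (y i x / r x))) * (r x ^+ 2)^-1).
    apply: decaysMl; last exact: decays_srootV.
    apply: decaysB; first exact: decays_cst.
    apply: decaysMl; first exact: decays_cst.
    by apply: decaysMl; exact: decays_ratio.
  by apply/funext => x; rewrite domegaS -sroot_sqr; field.
apply: (@decaysW _ 3) => //.
rewrite (_ : domega i ord0 = fun x => 4 * (y i x / r x) * (r x ^+ 3)^-1).
  apply: decaysMl; last exact: decays_srootV.
  by apply: decaysMl; [exact: decays_cst|exact: decays_ratio].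
by apply/funext => x; rewrite domega0 -sroot_sqr; field.
Qed.

Lemma decays_d2omega i a : decays 3 (d2omega i a).
Proof.
have [b ->|->] := unliftP ord0 a.
  rewrite (_ : d2omega i _ = fun x =>
    (- 4 * (2 * (i == b)%:R * (y i x / r x) + y b x / r x) +
     16 * (y b x / r x * (y i x / r x * (y i x / r x)))) * (r x ^+ 3)^-1); last first.
    by apply/funext => x; rewrite /d2omega liftK -sroot_sqr mulr2n; field.
  apply: decaysMl; last exact: decays_srootV.
  apply: decaysD; (apply: decaysMl; first exact: decays_cst).
    apply: decaysD; last exact: decays_ratio.
    by apply: decaysMl; [exact: decays_cst|exact: decays_ratio].
  by do 2!(apply: decaysMl; first exact: decays_ratio); exact: decays_ratio.
apply: (@decaysW _ 4) => //.
rewrite (_ : d2omega i _ = fun x =>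
  (4 - 16 * (y i x / r x * (y i x / r x))) * (r x ^+ 4)^-1); last first.
  by apply/funext => x; rewrite /d2omega unlift_none -sroot_sqr; field.
apply: decaysMl; last exact: decays_srootV.
apply: decaysB; first exact: decays_cst.
apply: decaysMl; first exact: decays_cst.
by apply: decaysMl; exact: decays_ratio.
Qed.

Let tauE m x : (2 / sden x) ^+ m = 2 ^+ m * (r x ^+ (2 * m))^-1.
Proof. by rewrite exprMn exprVn -sroot_sqr -exprM. Qed.

Lemma decays_tau : decays (2 * N) (@tau R N).
Proof.
rewrite (_ : @tau R N = fun x => 2 ^+ N * (r x ^+ (2 * N))^-1).
  by apply: decaysMl; [exact: decays_cst|exact: decays_srootV].
by apply/funext => x; rewrite -tauE.
Qed.

Lemma decays_sigma : decays (2 * N.+2) (@sigma R N).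
Proof.
rewrite (_ : @sigma R N = fun x => 2 ^+ N.+2 * (r x ^+ (2 * N.+2))^-1).
  by apply: decaysMl; [exact: decays_cst|exact: decays_srootV].
by apply/funext => x; rewrite -tauE.
Qed.

Lemma decays_dtau i :
  decays (2 * N).+1 (fun x => - (N%:R * tau x * (2 * y i x / sden x))).
Proof.
rewrite (_ : (fun _ => _) = fun x =>
  - 2 * N%:R * (y i x / r x) * (tau x * (r x ^+ 1)^-1)).
  apply: decaysMl.
    by apply: decaysMl; [exact: decays_cst|exact: decays_ratio].
  rewrite -addn1; apply: decaysM; [exact: decays_tau|exact: decays_srootV].
by apply/funext => x; rewrite -sroot_sqr; move: (tau x) => c; field.
Qed.

(** Test functions are given on R x R^n. In the chart they become compositions with this map, whose
    values stay bounded for bounded rho. *)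
Definition lift_chart x : 'rV[R]_(1 + N.+3) := row_mx (rho x)%:M (omega_of x).

Lemma in_chartE (phi : R -> rV -> R) x : in_chart phi x =
  (fun p : 'rV[R]_(1 + N.+3) => phi (lsubmx p 0 0) (rsubmx p)) (lift_chart x).
Proof.
by rewrite /in_chart rho_ofE /= row_mxKl row_mxKr !mxE eqxx mulr1n.
Qed.

Lemma lift_chart_bound x B a : `|rho x| <= B -> `|lift_chart x 0 a| <= Num.max B 1.
Proof.
move=> xB; have [k ->|k ->] := split_ordP a.
  by rewrite row_mxEl ord1 mxE eqxx mulr1n le_max xB.
by rewrite row_mxEr le_max omega_le1 orbT.
Qed.

Lemma decays_lift (F : 'rV[R]_(1 + N.+3) -> R) : continuous F ->
  decays 0 (fun x => F (lift_chart x)).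
Proof.
move=> cF B; have [C CF] := bounded_on_box (Num.max B 1) cF.
by exists C => x xB; rewrite mulr1 CF// => a; exact: lift_chart_bound.
Qed.

Let dlift i x (a : 'I_(1 + N.+3)) : R :=
  if fintype.split a is inr k then domega i k x else 0.

Let is_derive_lift i x a : is_derive x (ax (lift ord0 i))
  (fun z => lift_chart z 0 a) (dlift i x a).
Proof.
rewrite /dlift; case: (split_ordP a) => k ->.
  rewrite (_ : (fun _ => _) = fun z : rV => rho z).
    by apply: (is_derive_eq (is_derive_axis x _ _)).
  by apply/funext => z; rewrite row_mxEl ord1 mxE eqxx mulr1n.
rewrite (_ : (fun _ => _) = fun z : rV => omega_of z 0 k).
  exact: is_derive_omega.
by apply/funext => z; rewrite row_mxEr.
Qed.

Let is_derive_lift0 x a : is_derive x (ax ord0)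
  (fun z => lift_chart z 0 a) (a == 0)%:R.
Proof.
have [k ->|k ->] := split_ordP a.
  rewrite (_ : (fun _ => _) = fun z : rV => rho z).
    by apply: (is_derive_eq (is_derive_axis x _ _)); rewrite !ord1.
  by apply/funext => z; rewrite row_mxEl ord1 mxE eqxx mulr1n.
rewrite (_ : (fun _ => _) = fun z : rV => omega_of z 0 k).
  exact: is_derive_omega0.
by apply/funext => z; rewrite row_mxEr.
Qed.

(* The decay which makes the boundary terms of Green's formula vanish once one
   of the two functions is supported in a bounded range of [rho]. *)
Definition tame f := [/\ CnD 2%N f, decays 0 f,
  decays 0 (D0 f) /\ decays 0 (D0 (D0 f)) &
  forall i, decays 2 (D i f) /\ decays 3 (D i (D i f))].

Section lift_tame.
Variable F : 'rV[R]_(1 + N.+3) -> R.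
Hypothesis cF : forall k, Cn (@axes R (1 + N.+3)) k F.
Local Notation Ff := (fun x : rV => F (lift_chart x)).
Local Notation pF a := ('D_(delta_mx 0 a) F).

Let cpF a k : Cn (@axes R (1 + N.+3)) k (pF a).
Proof. exact: (Cn_derive (axesP _ _) (cF k.+1)). Qed.

Let cppF a b k : Cn (@axes R (1 + N.+3)) k ('D_(delta_mx 0 b) (pF a)).
Proof. exact: (Cn_derive (axesP _ _) (cpF a k.+1)). Qed.

Let D_comp (H : 'rV[R]_(1 + N.+3) -> R) i x : (forall k, Cn (@axes R (1 + N.+3)) k H) ->
  is_derive x (ax (lift ord0 i)) (fun z => H (lift_chart z))
  (\sum_a 'D_(delta_mx 0 a) H (lift_chart x) * dlift i x a).
Proof.
move=> cH; apply: is_derive_comp_row; last exact: is_derive_lift.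
exact: Cn_diff (cH 1%N) _.
Qed.

Let D0_comp (H : 'rV[R]_(1 + N.+3) -> R) x : (forall k, Cn (@axes R (1 + N.+3)) k H) ->
  is_derive x (ax ord0) (fun z => H (lift_chart z))
  ('D_(delta_mx 0 0) H (lift_chart x)).
Proof.
move=> cH.
apply: (is_derive_eq (is_derive_comp_row (Cn_diff (cH 1%N) _) (is_derive_lift0 x))).
under eq_bigr do rewrite mulrC eq_sym.
exact: delta_sum.
Qed.

(** By the chain rule a first derivative along the sphere carries a factor [domega] of order 2, and
    a second one either [d2omega] of order 3 or two factors [domega] of total order 4. *)
Lemma tame_lift : tame Ff.
Proof.
have cG k a : CnD k (fun x => lift_chart x 0 a).
  have [b ->|b ->] := split_ordP a.
    rewrite (_ : (fun _ => _) = fun z : rV => rho z); first exact: Cn_coordinate.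
    by apply/funext => z; rewrite row_mxEl ord1 mxE eqxx mulr1n.
  rewrite (_ : (fun _ => _) = fun z : rV => omega_of z 0 b); first exact: Cn_omega.
  by apply/funext => z; rewrite row_mxEr.
have cont (H : 'rV[R]_(1 + N.+3) -> R) : (forall k, Cn (@axes R (1 + N.+3)) k H) ->
    continuous H.
  by move=> cH; exact: Cn_cont (cH 0%N).
have D0E (H : 'rV[R]_(1 + N.+3) -> R) : (forall k, Cn (@axes R (1 + N.+3)) k H) ->
    D0 (fun z => H (lift_chart z)) = fun z => 'D_(delta_mx 0 0) H (lift_chart z).
  by move=> cH; apply/funext => x; have [_ e] := D0_comp x cH; exact: e.
have DE (H : 'rV[R]_(1 + N.+3) -> R) i : (forall k, Cn (@axes R (1 + N.+3)) k H) ->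
    D i (fun z => H (lift_chart z)) =
    fun z => \sum_a 'D_(delta_mx 0 a) H (lift_chart z) * dlift i z a.
  by move=> cH; apply/funext => x; have [_ e] := D_comp i x cH; exact: e.
have ddl i a : decays 2 (fun x => dlift i x a).
  rewrite /dlift; case: (fintype.split a) => b; last exact: decays_domega.
  by move=> B; exists 0 => x _; rewrite normr0 mul0r.
split.
- by apply: Cn_comp_row => // a; exact: cG.
- exact: decays_lift (cont _ cF).
- by rewrite (D0E _ cF) (D0E _ (cpF 0)); split;
    [exact: (decays_lift (cont _ (cpF 0)))|exact: (decays_lift (cont _ (cppF 0 0)))].
move=> i; rewrite (DE _ _ cF); split.
  apply: decays_sum => a; apply: decaysMl; last exact: ddl.
  exact: (decays_lift (cont _ (cpF a))).
pose d2lift x (a : 'I_(1 + N.+3)) : R :=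
  if fintype.split a is inr k then d2omega i k x else 0.
have hdl x a : is_derive x (ax (lift ord0 i)) (fun z => dlift i z a) (d2lift x a).
  rewrite /dlift /d2lift; case: (fintype.split a) => b; last exact: is_derive_domega.
  exact: is_derive_cst.
have -> : D i (fun z => \sum_a pF a (lift_chart z) * dlift i z a) = fun x =>
    \sum_a (pF a (lift_chart x) * d2lift x a + dlift i x a *
      \sum_b 'D_(delta_mx 0 b) (pF a) (lift_chart x) * dlift i x b).
  apply/funext => x.
  have h a := is_derive_mulf (D_comp i x (cpF a)) (hdl x a).
  have [_ e] := @is_derive_sumf _ _ _ (index_enum _) predT _ _ _ _ (fun a _ => h a).
  exact: e.
apply: decays_sum => a; apply: decaysD.
  apply: decaysMl; first exact: (decays_lift (cont _ (cpF a))).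
  rewrite /d2lift; case: (fintype.split a) => b; last exact: decays_d2omega.
  by move=> B; exists 0 => x _; rewrite normr0 mul0r.
apply: (@decaysW _ 4) => //; apply: (@decaysM 2 2); first exact: ddl.
apply: decays_sum => b; apply: decaysMl; last exact: ddl.
exact: (decays_lift (cont _ (cppF a b))).
Qed.

End lift_tame.
End Green.

Section GreenFormula.
Variables (R : realType) (N : nat).
Local Notation rV := 'rV[R]_N.+3.
Local Notation tup := (lebesgue_tuple R).
Local Notation rho x := ((x : 'rV[R]_N.+3) 0 ord0).
Local Notation y i x := ((x : 'rV[R]_N.+3) 0 (lift ord0 i)).
Local Notation ax i := (delta_mx 0 i : 'rV[R]_N.+3).
Local Notation CnD := (Cn (@axes R N.+3)).
Local Notation D0 f := ('D_(ax ord0) f).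
Local Notation D i f := ('D_(ax (lift ord0 i)) f).
Local Notation r := (@sroot R N).
Local Notation A := (profile_flux N).
Local Notation q := (angular_weight N).
Implicit Types (x : rV) (i : 'I_N.+2) (f g h : rV -> R).

Let r_gt0 x : 0 < r x. Proof. exact: sroot_gt0. Qed.
Let r_ge0 x : 0 <= r x. Proof. exact: ltW. Qed.

Let decay_sqr_ge x i : (2 * r x) ^- 3 <= decay (y i x) ^+ 2.
Proof.
have r2 : 0 < 2 * r x by rewrite mulr_gt0.
rewrite /decay exprVn -!exprM mulnC exprM sqr_sqrtr ?addr_ge0//.
have y1 : 0 < 1 + `|y i x| by rewrite ltr_pwDl.
rewrite lef_pV2 ?posrE ?exprn_gt0// ler_pXn2r ?nnegrE ?(ltW r2) ?(ltW y1)//.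
by rewrite mulr_natl mulr2n lerD ?sroot_ge1 ?sroot_ge.
Qed.

(** Squared, each of the n - 1 factors of the product is at least (2 r)^-3, and 2 (2 n - 3) >= 3 (n
    - 1) because n >= 3. *)
Lemma srootV_le_prod_decay x :
  (r x ^+ (2 * N).+3)^-1 <= 2 ^+ (2 * N.+2) * \prod_i decay (y i x).
Proof.
have P0 : 0 <= \prod_i decay (y i x).
  by apply: prodr_ge0 => i _; rewrite ltW// decay_gt0.
rewrite -ler_pdivrMl ?exprn_gt0//.
rewrite -(@ler_pXn2r _ 2%N) ?nnegrE ?mulr_ge0 ?invr_ge0 ?exprn_ge0//.
rewrite -prodrXl; apply: (@le_trans _ _ (\prod_(i < N.+2) (2 * r x) ^- 3)); last first.
  apply: ler_prod => i _; rewrite invr_ge0 exprn_ge0 ?mulr_ge0//=; exact: decay_sqr_ge.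
rewrite prodr_const card_ord exprVn -exprM exprMn exprVn -exprM exprVn -exprM.
rewrite [(2 * r x) ^+ _]exprMn [leRHS]invfM.
apply: ler_pM; rewrite ?invr_ge0 ?exprn_ge0//.
  rewrite lef_pV2 ?posrE ?exprn_gt0// ler_weXn2l ?ler1n//.
  by rewrite mulnAC leq_mul2r orbT.
rewrite lef_pV2 ?posrE ?exprn_gt0// ler_weXn2l ?sroot_ge1//.
rewrite (_ : ((2 * N).+3 * 2 = 3 * N.+2 + N)%N) ?leq_addr//.
by rewrite -addn3 -addn2; ring.
Qed.

Lemma sigma_le_prod_decay : exists2 C, 0 <= C &
  forall z : rV, sigma z <= C * \prod_i decay (y i z).
Proof.
have [C hC] : exists C, forall z : rV, (sroot z ^+ (2 * N).+3)^-1 <= C * \prod_i decay (y i z).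
  by eexists; exact: srootV_le_prod_decay.
have Cp : 0 <= C.
  have r0 : 0 <= (sroot (0 : rV) ^+ (2 * N).+3)^-1.
    by rewrite invr_ge0 exprn_ge0// ltW// sroot_gt0.
  have := le_trans r0 (hC 0); rewrite pmulr_lge0//.
  by apply: prodr_gt0 => i _; exact: decay_gt0.
exists (2 ^+ N.+2 * C) => [|z]; first by rewrite mulr_ge0 ?exprn_ge0.
rewrite /sigma exprMn -[leRHS]mulrA ler_wpM2l ?exprn_ge0//.
apply: le_trans (hC z).
rewrite exprVn -sroot_sqr -exprM lef_pV2 ?posrE ?exprn_gt0 ?sroot_gt0//.
by rewrite ler_weXn2l ?sroot_ge1// !mulnS !addnS !addSn leqnSn.
Qed.

Lemma srootV_le_decay x i : (r x ^+ 2)^-1 <= 4 * decay (y i x).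
Proof.
rewrite -ler_pdivrMl//.
rewrite -(@ler_pXn2r _ 2%N) ?nnegrE ?mulr_ge0 ?invr_ge0 ?exprn_ge0 ?(ltW (decay_gt0 _))//.
apply: le_trans (decay_sqr_ge x i).
rewrite exprMn !exprVn -!exprM [(2 * r x) ^+ _]exprMn [leRHS]invfM.
apply: ler_pM; rewrite ?invr_ge0 ?exprn_ge0// lef_pV2 ?posrE ?exprn_gt0//.
  by rewrite -!natrX ler_nat.
by rewrite ler_weXn2l ?sroot_ge1.
Qed.

Definition rho_supported (B : R) f := forall x, B < `|rho x| -> f x = 0.

Lemma rho_supported_derive B f v : rho_supported B f -> rho_supported B ('D_v f).
Proof.
move=> fB x xB.
have h : is_derive x v f 0.
  apply: (@near_eq_is_derive R rV R (cst 0)).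
  near=> z; rewrite fB//; near: z.
  have : `|rho z| @[z --> x] --> `|rho x|.
    by apply: (@continuous_comp _ _ _ (fun z : rV => rho z) (fun z => `|z|));
      [exact: coord_continuous|exact: norm_continuous].
  by move/cvgr_gt; apply.
by have [_ e] := h; exact: e.
Unshelve. all: by end_near. Qed.

Lemma rho_supportedMl B f g : rho_supported B g -> rho_supported B (fun x => f x * g x).
Proof. by move=> gB x /gB ->; rewrite mulr0. Qed.

Lemma decays_le k f B : decays k f -> rho_supported B f ->
  exists2 C, 0 <= C & forall x, `|f x| <= C * decay (rho x) * (r x ^+ k)^-1.
Proof.
move=> df fB; have [C Cf] := df `|B|.
have dB : 0 < decay B := decay_gt0 B.
exists (`|C| / decay B); first by rewrite divr_ge0// ltW.
move=> x; rewrite ler_pdivlMr ?exprn_gt0//.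
have [xB|xB] := leP `|rho x| `|B|; last first.
  rewrite fB ?(le_lt_trans (ler_norm B))// normr0 mul0r mulr_ge0 ?divr_ge0// ltW//.
  exact: decay_gt0.
apply: le_trans (Cf x xB) _; apply: le_trans (ler_norm C) _.
rewrite -mulrA ler_peMr// mulrC ler_pdivlMr// mul1r.
by apply: decay_ler.
Qed.

Lemma majorant_of_decays f B : decays (2 * N).+3 f -> rho_supported B f ->
  exists C, forall x, `|f x| <= C * majorant x.
Proof.
move=> df fB; have [C C0 Cf] := decays_le df fB.
have [K hK] : exists K, forall x,
    (r x ^+ (2 * N).+3)^-1 <= K * \prod_i decay (y i x).
  by eexists; exact: srootV_le_prod_decay.
exists (C * K) => x; apply: le_trans (Cf x) _.
rewrite /majorant big_ord_recl -!mulrA ler_wpM2l//.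
by rewrite mulrCA ler_wpM2l ?(ltW (decay_gt0 _)).
Qed.

(** The integrand is the derivative in direction [k] of h c f' - f c h', as the products of two
    first derivatives cancel. *)
Let green_term (k : 'I_N.+3) (c f h : rV -> R) B :
  CnD 1%N c -> tame f -> tame h -> rho_supported B f ->
  (exists C, forall x, `|h x * (c x * 'D_(ax k) f x) -
     f x * (c x * 'D_(ax k) h x)| <= C * decay (x 0 k)) ->
  (forall g, tame g -> decays (2 * N).+3 ('D_(ax k) (fun z => c z * 'D_(ax k) g z))) ->
  let F x := h x * 'D_(ax k) (fun z => c z * 'D_(ax k) f z) x -
     f x * 'D_(ax k) (fun z => c z * 'D_(ax k) h z) x in
  (tup N.+3).-integrable setT (fun p => (F (row_of_tuple p))%:E) /\
  (\int[tup N.+3]_p (F (row_of_tuple p))%:E = 0)%E.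
Proof.
move=> cc tf th fB Gd dd F.
have [cf df0 _ _] := tf; have [ch dh0 _ _] := th.
have Ck (g : rV -> R) l : CnD l.+1 g -> CnD l ('D_(ax k) g).
  by move=> cg; exact: (Cn_derive (axesP _ _) cg).
have ccf : CnD 1%N (fun z => c z * 'D_(ax k) f z) by exact: Cn_mul cc (Ck _ 1%N _).
have cch : CnD 1%N (fun z => c z * 'D_(ax k) h z) by exact: Cn_mul cc (Ck _ 1%N _).
have [C GC] := Gd.
have [C' FC'] : exists C', forall x, `|F x| <= C' * majorant x.
  apply: (@majorant_of_decays _ B).
    apply: decaysB; (apply: decaysMl; [by []|exact: dd]).
  move=> x xB; rewrite /F (fB _ xB) mul0r subr0.
  rewrite (_ : 'D_(ax k) _ x = 0) ?mulr0//; apply: rho_supported_derive xB.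
  by apply: rho_supportedMl; exact: rho_supported_derive.
apply: (@integral_partial_derive0 R N.+3 k
    (fun x => h x * (c x * 'D_(ax k) f x) - f x * (c x * 'D_(ax k) h x)) F C C') => //.
- move=> x; have h1 := is_derive_mulf (Cn_is_derive x (ax k) (CnW ch))
    (Cn_is_derive x (ax k) ccf).
  have h2 := is_derive_mulf (Cn_is_derive x (ax k) (CnW cf))
    (Cn_is_derive x (ax k) cch).
  apply: (is_derive_eq (is_derive_subf h1 h2)); rewrite /F.
  move: ('D_(ax k) (fun z => c z * 'D_(ax k) f z) x).
  move: ('D_(ax k) (fun z => c z * 'D_(ax k) h z) x) => u1 u2.
  by move: ('D_(ax k) f x) ('D_(ax k) h x) (f x) (h x) (c x) => *; ring.
- have c0 (a b : rV -> R) : CnD 2%N a -> CnD 1%N b ->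
      CnD 0%N (fun x => a x * 'D_(ax k) b x).
    by move=> ca cb; apply: Cn_mul; [exact: Cn_ler ca|exact: Ck].
  exact: Cn_cont (Cn_sub (c0 _ _ ch ccf) (c0 _ _ cf cch)).
Qed.

Let sum_skew m (E1 E2 : 'I_m.+1 -> R) (a b v L1 L2 : R) :
  L1 = E1 ord0 + \sum_i E1 (lift ord0 i) + v * a ->
  L2 = E2 ord0 + \sum_i E2 (lift ord0 i) + v * b ->
  L2 = 0 -> b * L1 = \sum_k (b * E1 k - a * E2 k).
Proof.
move=> e1 e2 e; transitivity (b * L1 - a * L2); first by rewrite e mulr0 subr0.
rewrite sumrB -!mulr_sumr !(@big_ord_recl _ _ _ m) e1 e2.
by ring.
Qed.

(** Subtracting f times the vanishing density of [h] cancels the potential terms and leaves one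
    exact derivative per coordinate. *)
Lemma green_formula f h B : tame f -> tame h -> rho_supported B f ->
  (forall x, jacobi_density h x = 0) ->
  (tup N.+3).-integrable setT (fun p =>
    (h (row_of_tuple p) * jacobi_density f (row_of_tuple p))%:E) /\
  (\int[tup N.+3]_p (h (row_of_tuple p) * jacobi_density f (row_of_tuple p))%:E
   = 0)%E.
Proof.
move=> tf th fB Lh.
have [cf df0 [df1 df2] df3] := tf; have [ch dh0 [dh1 dh2] dh3] := th.
pose c (k : 'I_N.+3) x : R :=
  if unlift ord0 k is Some _ then q (rho x) * tau x else A (rho x) * sigma x.
have cA k : CnD k (fun x : rV => A (rho x)).
  by apply: Cn_rho; exact: Cn_profile_flux.
have cq k : CnD k (fun x : rV => q (rho x)).
  by apply: Cn_rho; exact: Cn_angular_weight.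
have dA : decays 0 (fun x : rV => A (rho x)).
  have cA0 : continuous (A : R -> R) by exact: Cn_cont (Cn_profile_flux R N 0%N).
  exact: (decays_rho N cA0).
have dq : decays 0 (fun x : rV => q (rho x)).
  by apply: decays_rho; exact: continuous_angular_weight.
pose E k g x := 'D_(ax k) (fun z => c k z * 'D_(ax k) g z) x.
pose F k x := h x * E k f x - f x * E k h x.
have hF k : (tup N.+3).-integrable setT (fun p => (F k (row_of_tuple p))%:E) /\
  (\int[tup N.+3]_p (F k (row_of_tuple p))%:E = 0)%E.
  have suppG k' (w : rV -> R) : rho_supported B (fun x => h x * (w x * 'D_(ax k') f x) -
      f x * (w x * 'D_(ax k') h x)).
    move=> x xB; rewrite (fB _ xB) mul0r subr0.
    by rewrite (rho_supported_derive _ fB xB) !mulr0.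
  rewrite /F /E; case: (unliftP ord0 k) => [i ->|->].
    rewrite (_ : c (lift ord0 i) = fun x => q (rho x) * tau x); last first.
      by apply/funext => x; rewrite /c liftK.
    apply: (@green_term _ (fun x => q (rho x) * tau x) f h B) => //.
    - by apply: Cn_mul; [exact: cq|exact: Cn_tau].
    - have dc : decays 0 (fun x : rV => q (rho x) * tau x).
        by apply: decaysMl => //; exact: decaysW (@decays_tau R N).
      have dG : decays 2 (fun x => h x * (q (rho x) * tau x * D i f x) -
          f x * (q (rho x) * tau x * D i h x)).
        apply: decaysB.
          exact: (decaysMl dh0 (decaysMl dc (df3 i).1)).
        exact: (decaysMl df0 (decaysMl dc (dh3 i).1)).
      have [C C0 CG] := decays_le dG (suppG _ _).
      exists (C * 4) => x; apply: le_trans (CG x) _.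
      rewrite -!mulrA ler_wpM2l// -[leRHS]mul1r.
      by apply: ler_pM; rewrite ?decay_le1 ?srootV_le_decay ?invr_ge0 ?exprn_ge0
        ?(ltW (decay_gt0 _)).
    move=> g [cg _ _ /(_ i)[dg1 dg2]].
    have Dg : CnD 1%N (D i g) by exact: (Cn_derive (axesP _ _) cg).
    have -> : D i (fun z => q (rho z) * tau z * D i g z) = fun x => q (rho x) *
      (tau x * D i (D i g) x + D i g x * - (N%:R * tau x * (2 * y i x / sden x))).
      apply/funext => x.
      have h1 := is_derive_mulf (is_derive_mulf
        (is_derive_rhoS i (Cn_is_derive (rho x) 1 (Cn_angular_weight R N 1)))
        (is_derive_tau x i)) (Cn_is_derive x (ax (lift ord0 i)) Dg).
      have [_ e] := h1; rewrite e.
      move: (D i (D i g) x) (D i g x) (tau x) (q _) (- (N%:R * tau x * _)) => *.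
      by ring.
    (* Both terms have order 2 n - 3, as [majorant_of_decays] requires: 2 N + 3 for [tau] times a
       second derivative, (2 N + 1) + 2 for the product of the first derivatives. *)
    apply: decaysMl => //; apply: decaysD.
      by rewrite -addn3; apply: decaysM => //; exact: decays_tau.
    by rewrite -[(2 * N).+3]/(2 + (2 * N).+1)%N; apply: decaysM => //; exact: decays_dtau.
  rewrite (_ : c ord0 = fun x => A (rho x) * sigma x); last first.
    by apply/funext => x; rewrite /c unlift_none.
  apply: (@green_term _ (fun x => A (rho x) * sigma x) f h B) => //.
  - by apply: Cn_mul; [exact: cA|exact: Cn_sigma].
  - have dc : decays 0 (fun x : rV => A (rho x) * sigma x).
      by apply: decaysMl => //; exact: decaysW (@decays_sigma R N).
    have dG : decays 0 (fun x => h x * (A (rho x) * sigma x * D0 f x) -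
        f x * (A (rho x) * sigma x * D0 h x)).
      exact: (decaysB (decaysMl dh0 (decaysMl dc df1)) (decaysMl df0 (decaysMl dc dh1))).
    have [C C0 CG] := decays_le dG (suppG _ _).
    by exists C => x; apply: le_trans (CG x) _; rewrite expr0 invr1 mulr1.
  move=> g [cg _ [dg1 dg2] _].
  have Dg : CnD 1%N (D0 g) by exact: (Cn_derive (axesP _ _) cg).
  have dA' : decays 0 (fun x : rV => 'D_1 A (rho x)).
    have cA1 : @Cn R R [set 1] 0%N ('D_1 A).
      exact: (Cn_derive (erefl : [set 1] (1 : R)) (Cn_profile_flux R N 1%N)).
    exact: (decays_rho N (Cn_cont cA1)).
  have -> : D0 (fun z => A (rho z) * sigma z * D0 g z) = fun x => 
      (A (rho x) * D0 (D0 g) x + D0 g x * 'D_1 A (rho x)) * sigma x.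
    apply/funext => x.
    have h1 := is_derive_mulf (is_derive_mulf
      (is_derive_rho0 (Cn_is_derive (rho x) 1 (Cn_profile_flux R N 1%N)))
      (is_derive_sigma0 x)) (Cn_is_derive x (ax ord0) Dg).
    have [_ e] := h1; rewrite e.
    move: (D0 (D0 g) x) (D0 g x) ('D_1 A _) (sigma x) (A _) => *.
    by ring.
  apply: decaysMl; first by apply: decaysD; apply: decaysMl.
  apply: decaysW (@decays_sigma R N).
  by rewrite !mulnS.
have jE g x : jacobi_density g x = E ord0 g x + \sum_i E (lift ord0 i) g x +
    potential N (rho x) * sigma x * g x.
  congr (_ + _ + _).
    apply: (congr1 (fun w : rV -> R => D0 w x)); apply/funext => z.
    by rewrite /c unlift_none.
  apply: eq_bigr => i _.
  apply: (congr1 (fun w : rV -> R => D i w x)); apply/funext => z.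
  by rewrite /c liftK.
rewrite (_ : (fun p => _) = fun p => (\sum_k (F k (row_of_tuple p))%:E)%E).
  split; first by apply: integrable_sum => // k _; have [] := hF k.
  rewrite integral_sum//; last by move=> k; have [] := hF k.
  by apply: big1 => k _; have [] := hF k.
apply/funext => p; rewrite sumEFin; move: (row_of_tuple p) => x.
congr (_%:E).
exact: (sum_skew (E1 := fun k => E k f x) (E2 := fun k => E k h x) (jE f x) (jE h x) (Lh x)).
Qed.

End GreenFormula.

(** * Combinations of the functions nu^j belong to the null space *)

Section NuNullSpace.
Variables (R : realType) (N : nat).
Local Notation rV := 'rV[R]_N.+3.
Local Notation Rm := (measurableTypeR R).
Local Notation tup := (lebesgue_tuple R).
Local Notation tupn := (N.+3.-tuple Rm).
Local Notation rho x := ((x : 'rV[R]_N.+3) 0 ord0).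
Local Notation y i x := ((x : 'rV[R]_N.+3) 0 (lift ord0 i)).
Local Notation ax i := (delta_mx 0 i : 'rV[R]_N.+3).
Local Notation CnD := (Cn (@axes R N.+3)).
Local Notation J := (@jbracket R).
Local Notation T := (profile_root N).
Local Notation A := (profile_flux N).
Local Notation nuJ := (profile_nu N).
Local Notation W := (profile_volume N).
Local Notation q := (angular_weight N).
Local Notation V := (potential N).
Local Notation X := (@catenoid_chart R N.+3).
Local Notation row := (@row_of_tuple R N.+3).
Implicit Types (x : rV) (i : 'I_N.+2) (f g h : rV -> R) (u : R -> rV -> R).

Lemma in_chart_nu (j : 'I_N.+3) x :
  in_chart (@nu R N.+3 j) x = nuJ (rho x) * omega_monomial [:: j] x.
Proof.
by rewrite /in_chart /nu rho_ofE /omega_monomial /monomial big_seq1 mulrC.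
Qed.

Lemma jacobi_density_nu j x : jacobi_density (in_chart (@nu R N.+3 j)) x = 0.
Proof.
have [L sL hL] := jacobi_density_mode R [:: j].
have L0 : L = [::] by case: L sL {hL} => [//|v L] /=; case: (size v).
have [h1 h2] := @solves_mode1 R N.
rewrite (_ : in_chart _ = fun z => nuJ (rho z) * omega_monomial [:: j] z); last first.
  by apply/funext => z; rewrite in_chart_nu.
by rewrite (hL _ _ _ x h1 h2) L0 big_nil mulr0 addr0 subrr mul0r mulr0.
Qed.

Lemma continuous_jacobi_density f : CnD 2%N f -> continuous (jacobi_density f).
Proof.
move=> cf; have Ck (k : 'I_N.+3) l (g : rV -> R) : CnD l.+1 g -> CnD l ('D_(ax k) g).
  by move=> cg; exact: (Cn_derive (axesP _ _) cg).
have cA l : CnD l (fun x : rV => A (rho x)) by apply: Cn_rho; exact: Cn_profile_flux.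
have cq l : CnD l (fun x : rV => q (rho x)) by apply: Cn_rho; exact: Cn_angular_weight.
have cV : CnD 0%N (fun x : rV => V (rho x)).
  apply: Cn_rho; apply: Cn_mul; first exact: Cn_cst.
  apply: Cn_inv => [r|].
    by rewrite mulf_neq0 ?expf_neq0 ?gt_eqF ?jbracket_gt0 ?profile_root_gt0.
  by apply: Cn_mul; [apply: Cn_exp; exact: Cn_jbracket|exact: Cn_profile_root].
apply: (@Cn_cont _ _ (@axes R N.+3) 0%N); apply: Cn_add; first apply: Cn_add.
- exact: (Ck _ _ _ (Cn_mul (Cn_mul (cA 1%N) (@Cn_sigma R N 1)) (Ck _ _ _ cf))).
- apply: Cn_sum => i _.
  exact: (Ck _ _ _ (Cn_mul (Cn_mul (cq 1%N) (@Cn_tau R N 1)) (Ck _ _ _ cf))).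
- apply: Cn_mul; last exact: Cn_ler cf.
  by apply: Cn_mul; [exact: cV|exact: Cn_sigma].
Qed.

Lemma catenoid_integral_jacobi u f :
  catenoid_integral (fun x => in_chart u x * stability_operator X f x) =
  (\int[tup N.+3]_p (in_chart u (row p) * jacobi_density f (row p))%:E)%E.
Proof.
apply: eq_integral => p _; congr (_%:E).
by rewrite -jacobi_densityE; move: (stability_operator _ _ _) => s; ring.
Qed.

Lemma tame_test (phi : R -> rV -> R) : test_function phi -> tame (in_chart phi).
Proof.
move=> [sphi _].
rewrite (_ : in_chart phi = fun x => (fun p : 'rV[R]_(1 + N.+3) =>
  phi (lsubmx p 0 0) (rsubmx p)) (lift_chart x)).
  exact: (@tame_lift R N (fun p : 'rV[R]_(1 + N.+3) => phi (lsubmx p 0 0) (rsubmx p))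
    (smooth_Cn sphi)).
by apply/funext => x; exact: in_chartE.
Qed.

Lemma rho_supported_test (phi : R -> rV -> R) : test_function phi ->
  exists B, rho_supported B (in_chart phi).
Proof.
move=> [_ [B hB]]; exists B => x xB; apply: hB; first exact: dot_omega.
by rewrite rho_ofE.
Qed.

Lemma tame_nu j : tame (in_chart (@nu R N.+3 j)).
Proof.
rewrite (_ : in_chart _ = fun x =>
  (fun p : 'rV[R]_(1 + N.+3) => p 0 (rshift 1 j) * nuJ (p 0 (lshift N.+3 0)))
  (lift_chart x)).
  apply: (@tame_lift R N (fun p : 'rV[R]_(1 + N.+3) =>
    p 0 (rshift 1 j) * nuJ (p 0 (lshift N.+3 0)))) => k.
  apply: Cn_mul; first exact: Cn_coordinate.
  by apply: Cn_comp; [exact: Cn_profile_nu|exact: Cn_coordinate].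
apply/funext => x; rewrite in_chart_nu /omega_monomial /monomial big_seq1 mulrC.
rewrite row_mxEr (_ : lift_chart x 0 (lshift N.+3 0) = rho x)//.
by rewrite row_mxEl mxE.
Qed.

Lemma in_chart_sum (c : 'I_N.+3 -> R) x :
  in_chart (fun rho omega => \sum_j c j * nu j rho omega) x =
  \sum_j c j * in_chart (@nu R N.+3 j) x.
Proof. by []. Qed.

Lemma weak_jacobi_nu (c : 'I_N.+3 -> R) :
  weak_jacobi (fun rho omega => \sum_j c j * nu j rho omega).
Proof.
move=> phi tphi; rewrite catenoid_integral_jacobi.
have [B fB] := rho_supported_test tphi.
have hj j := green_formula (tame_test tphi) (tame_nu j) fB (jacobi_density_nu j).
rewrite (_ : (fun p => _) = fun p => (\sum_j (c j)%:E *
  (in_chart (@nu R N.+3 j) (row p) * jacobi_density (in_chart phi) (row p))%:E)%E).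
  rewrite integral_sum//; last by move=> j; apply: integrableZl => //; have [] := hj j.
  apply: big1 => j _; rewrite integralZl//; last by have [] := hj j.
  by have [_ e] := hj j; rewrite e mule0.
apply/funext => p; rewrite in_chart_sum mulr_suml -sumEFin.
by apply: eq_bigr => j _; rewrite -EFinM -mulrA.
Qed.

Lemma measurable_volume :
  measurable_fun setT (fun p : tupn => volume_density X (row p)).
Proof.
rewrite (_ : (fun p => _) = fun p => W (rho (row p)) * sigma (row p)); last first.
  by apply/funext => p; rewrite volume_chart.
apply: (@measurable_row_of_tuple R N.+3 (fun x => W (rho x) * sigma x)).
have c : CnD 0%N (fun x => W (rho x) * sigma x).
  apply: Cn_mul; last exact: Cn_sigma.
  apply: Cn_rho; apply: Cn_mul; first by apply: Cn_exp; exact: Cn_jbracket.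
  apply: Cn_inv => [r|]; last exact: Cn_profile_root.
  by rewrite gt_eqF// profile_root_gt0.
exact: Cn_cont c.
Qed.

Lemma measurable_H0 delta u : catenoid_measurable u ->
  measurable_fun setT (fun p : tupn => J (rho_of (row p)) `^ (2 * delta) *
    in_chart u (row p) ^+ 2 * volume_density X (row p)).
Proof.
move=> mu; apply: measurable_funM; last exact: measurable_volume.
apply: measurable_funM; last exact: measurable_funX.
apply: (@measurableT_comp _ _ _ _ _ _ (@powR R ^~ (2 * delta))).
  exact: measurable_powR.
under eq_fun do rewrite rho_ofE.
apply: (@measurable_row_of_tuple R N.+3 (fun x => J (rho x))).
have c : CnD 0%N (fun x => J (rho x)) by apply: Cn_rho; exact: Cn_jbracket.
exact: Cn_cont c.
Qed.

Lemma catenoid_measurable_nu (c : 'I_N.+3 -> R) :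
  catenoid_measurable (fun rho omega => \sum_j c j * nu j rho omega).
Proof.
apply: (@measurable_row_of_tuple R N.+3
  (fun x => \sum_j c j * in_chart (@nu R N.+3 j) x)).
have cc : CnD 0%N (fun x => \sum_j c j * in_chart (@nu R N.+3 j) x).
  apply: Cn_sum => j _; apply: Cn_mul; first exact: Cn_cst.
  by have [ch _ _ _] := tame_nu j; exact: Cn_ler ch.
exact: Cn_cont cc.
Qed.

Lemma profile_root_ge r : J r ^+ N.+1 <= T r.
Proof.
have J0 := jbracket_gt0 r.
rewrite -(@ler_pXn2r _ 2%N) ?nnegrE ?exprn_ge0 ?(ltW J0) ?(ltW (profile_root_gt0 _ _))//.
rewrite profile_root_sqr /profile_sum big_ord_recr /= -exprM mulnC lerDr.
by apply: sumr_ge0 => k _; rewrite exprn_ge0// ltW.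
Qed.

(** Here delta < n / 2 - 2 enters: <r>^(2 delta) <= <r>^(n-4) and nu^2 W <= <r>^(1-n), so the
    product is at most <r>^-3. The factor 8 comes from sqrt(1 + |r|) <= 2 <r>. *)
Lemma weighted_profile_le delta r : delta < N.+3%:R / 2 - 2 ->
  J r `^ (2 * delta) * (nuJ r ^+ 2 * W r) <= 8 * decay r.
Proof.
move=> hd; have J0 := jbracket_gt0 r; have J1 := jbracket_ge1 r.
have Jn : J r != 0 by rewrite gt_eqF.
have P0 : 0 < J r ^+ N by rewrite exprn_gt0.
have h1 : J r `^ (2 * delta) * J r <= J r ^+ N.
  rewrite -[X in _ * X <= _](powRr1 (ltW J0)) -powRD ?Jn ?implybT//.
  rewrite -powR_mulrn ?(ltW J0)//; apply: (ler_powR J1).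
  have : 2 * delta < 2 * (N.+3%:R / 2 - 2) by rewrite ltr_pM2l.
  rewrite mulrBr mulrCA divff// mulr1 -[N.+3]addn3 natrD => h.
  by lra.
have h2 : nuJ r ^+ 2 * W r <= (J r ^+ N)^-1 * (J r ^+ 2)^-1.
  have TW : W r <= J r ^+ N.+2.
    rewrite ler_pdivrMr ?profile_root_gt0//.
    rewrite (_ : (2 * N).+3 = (N.+2 + N.+1)%N); last by rewrite mul2n -addnn !addnS !addSn.
    by rewrite exprD ler_wpM2l ?profile_root_ge// exprn_ge0// (ltW J0).
  apply: (@le_trans _ _ (nuJ r ^+ 2 * J r ^+ N.+2)).
    by rewrite ler_wpM2l ?sqr_ge0.
  rewrite /profile_nu exprVn expr2 invfM -mulrA mulVf ?expf_neq0// mulr1.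
  by rewrite -addn2 exprD invfM.
have h3 : (J r ^+ 3)^-1 <= 8 * decay r.
  have u0 : 0 < Num.sqrt (1 + `|r|) by rewrite sqrtr_gt0 ltr_pwDl.
  rewrite -ler_pdivrMl// /decay -invfM lef_pV2 ?posrE ?mulr_gt0 ?exprn_gt0//.
  rewrite (_ : 8 = 2 ^+ 3 :> R); last by rewrite -natrX.
  rewrite -exprMn ler_pXn2r ?nnegrE ?mulr_ge0 ?(ltW J0)//.
  have a1 : 1 <= 1 + `|r| by rewrite lerDl.
  apply: (@le_trans _ _ (1 + `|r|)).
    have a0 := le_trans ler01 a1.
    apply: (@le_trans _ _ (Num.sqrt ((1 + `|r|) ^+ 2))).
      by rewrite ler_wsqrtr// expr2 ler_peMr.
    by rewrite sqrtr_sqr ger0_norm.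
  by rewrite mulr_natl mulr2n lerD// jbracket_ge.
apply: le_trans h3.
apply: (@le_trans _ _ ((J r ^+ N / J r) * ((J r ^+ N)^-1 * (J r ^+ 2)^-1))).
  have q1 : 0 <= nuJ r ^+ 2 * W r.
    exact: mulr_ge0 (sqr_ge0 _) (ltW (profile_volume_gt0 _ _)).
  by apply: ler_pM => //; rewrite ?powR_ge0// ler_pdivlMr.
rewrite le_eqVlt; apply/orP; left; apply/eqP; rewrite !exprS.
by move: (J r ^+ N) P0 => P P0; field; rewrite Jn gt_eqF.
Qed.

Lemma in_H0_nu delta (c : 'I_N.+3 -> R) : delta < N.+3%:R / 2 - 2 ->
  in_H0 delta (fun rho omega => \sum_j c j * nu j rho omega).
Proof.
move=> hd; split; first exact: catenoid_measurable_nu.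
pose C := \sum_j `|c j|.
have C0 : 0 <= C by exact: sumr_ge0.
have hu x : `|in_chart (fun rho omega => \sum_j c j * nu j rho omega) x| <= C * nuJ (rho x).
  rewrite in_chart_sum /C mulr_suml; apply: le_trans (ler_norm_sum _ _ _) _.
  apply: ler_sum => j _; rewrite normrM ler_wpM2l// in_chart_nu normrM.
  rewrite (gtr0_norm (profile_nu_gt0 _ _)) ler_piMr ?(ltW (profile_nu_gt0 _ _))//.
  by rewrite /omega_monomial /monomial big_seq1 omega_le1.
have [K K0 hK] := @sigma_le_prod_decay R N.
have mF := measurable_H0 delta (catenoid_measurable_nu c).
have hF p : `|J (rho_of (row p)) `^ (2 * delta) *
    in_chart (fun rho omega => \sum_j c j * nu j rho omega) (row p) ^+ 2 *
    volume_density X (row p)| <= C ^+ 2 * 8 * K * majorant (row p).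
  move: (row p) => x; rewrite volume_chart rho_ofE normrM normrM.
  rewrite [`|_ `^ _|]ger0_norm ?powR_ge0// [`|W _ * _|]ger0_norm; last first.
    by rewrite mulr_ge0// ltW// ?profile_volume_gt0 ?sigma_gt0.
  rewrite normrX.
  apply: (@le_trans _ _ (J (rho x) `^ (2 * delta) * (C * nuJ (rho x)) ^+ 2 *
      (W (rho x) * sigma x))).
    have p1 : 0 <= W (rho x) * sigma x.
      by rewrite mulr_ge0// ltW// ?profile_volume_gt0 ?sigma_gt0.
    have p2 : 0 <= C * nuJ (rho x) by rewrite mulr_ge0// ltW// profile_nu_gt0.
    apply: ler_wpM2r => //; apply: ler_wpM2l; first exact: powR_ge0.
    by rewrite ler_pXn2r ?nnegrE.
  rewrite [leLHS](_ : _ = C ^+ 2 * ((J (rho x) `^ (2 * delta) *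
    (nuJ (rho x) ^+ 2 * W (rho x))) * sigma x)); last by ring.
  apply: (@le_trans _ _ (C ^+ 2 * ((8 * decay (rho x)) *
      (K * \prod_i decay (y i x))))).
    rewrite ler_wpM2l ?sqr_ge0//; apply: ler_pM (weighted_profile_le _ hd) (hK x);
      last exact: ltW (sigma_gt0 x).
    apply: mulr_ge0; first exact: powR_ge0.
    exact: mulr_ge0 (sqr_ge0 _) (ltW (profile_volume_gt0 _ _)).
  rewrite /majorant [in leRHS]big_ord_recl.
  move: (decay _) (\prod_(i < _) _) (C ^+ 2) => a b c2.
  by rewrite (_ : c2 * _ = c2 * 8 * K * (a * b))//; ring.
have := integrable_majorant mF hF; move=> /integrableP[_].
rewrite (_ : (\int[_]_p `|_|)%E = catenoid_integral (fun x =>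
  J (rho_of x) `^ (2 * delta) *
  in_chart (fun rho omega => \sum_j c j * nu j rho omega) x ^+ 2))//.
apply: eq_integral => p _; rewrite /= ger0_norm//.
exact: mulr_ge0 (mulr_ge0 (powR_ge0 _ _) (sqr_ge0 _)) (sqrtr_ge0 _).
Qed.

Lemma nu_null_space delta u (c : 'I_N.+3 -> R) : delta < N.+3%:R / 2 - 2 ->
  catenoid_measurable u ->
  catenoid_ae_eq u (fun rho omega => \sum_j c j * nu j rho omega) ->
  null_space delta u.
Proof.
move=> hd mu uE; have mw := catenoid_measurable_nu c.
have [_ w2] := in_H0_nu c hd.
split; first split=> //.
  apply: le_lt_trans w2; rewrite le_eqVlt; apply/orP; left; apply/eqP.
  apply: ae_eq_integral => //.
  - by apply/measurable_EFinP; exact: measurable_H0.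
  - by apply/measurable_EFinP; exact: measurable_H0.
  - by apply: filterS uE => p e _; rewrite e.
move=> phi tphi; rewrite -[RHS](weak_jacobi_nu c tphi) !catenoid_integral_jacobi.
have mj : measurable_fun setT (fun p : tupn => jacobi_density (in_chart phi) (row p)).
  apply: measurable_row_of_tuple; apply: continuous_jacobi_density.
  by have [] := tame_test tphi.
apply: ae_eq_integral => //.
- by apply/measurable_EFinP; exact: measurable_funM.
- by apply/measurable_EFinP; exact: measurable_funM.
- by apply: filterS uE => p e _; rewrite e.
Qed.

End NuNullSpace.

(** * Moments of a null function *)

Section Modes.
Variables (R : realType) (N : nat).
Local Notation rV := 'rV[R]_N.+3.
Local Notation leb := (@lebesgue_measure R).
Local Notation Rm := (measurableTypeR R).
Local Notation tup := (lebesgue_tuple R).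
Local Notation tupn := (N.+3.-tuple Rm).
Local Notation rho x := ((x : 'rV[R]_N.+3) 0 ord0).
Local Notation y i x := ((x : 'rV[R]_N.+3) 0 (lift ord0 i)).
Local Notation CnD := (Cn (@axes R N.+3)).
Local Notation J := (@jbracket R).
Local Notation W := (profile_volume N).
Local Notation row := (@row_of_tuple R N.+3).
Local Notation P := (@omega_monomial R N).
Local Notation cons x t := (cons_pair ((x : Rm), t) : tupn).
Local Notation wt delta p := (J (rho (row p)) `^ (2 * delta) * W (rho (row p)) * sigma (row p)).
Implicit Types (w : seq 'I_N.+3) (p : tupn) (t : N.+2.-tuple Rm).

Lemma row_cons0 (x : R) t : rho (row (cons x t)) = x.
Proof. by rewrite mxE. Qed.

Let row_consS (x : R) t i : y i (row (cons x t)) = tnth t i.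
Proof. by rewrite mxE /cons_pair tnthS. Qed.

Let sden_cons (x : R) t : sden (row (cons x t)) = sden (row (cons 0 t)).
Proof.
by congr (1 + _); apply: eq_bigr => i _; rewrite !row_consS.
Qed.

Lemma sigma_cons (x : R) t : sigma (row (cons x t)) = sigma (row (cons 0 t)).
Proof. by rewrite /sigma sden_cons. Qed.

Lemma omega_cons (x : R) t : omega_of (row (cons x t)) = omega_of (row (cons 0 t)).
Proof.
apply/rowP => a; have [b ->|->] := unliftP ord0 a.
  by rewrite !omega_ofS sden_cons !row_consS.
by rewrite !omega_of0 sden_cons.
Qed.

Lemma omega_monomial_rho (x : R) t w : P w (row (cons x t)) = P w (row (cons 0 t)).
Proof. by rewrite /omega_monomial omega_cons. Qed.

Lemma omega_monomial_le1 w (z : rV) : `|P w z| <= 1.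
Proof.
elim: w => [|a w IH]; first by rewrite omega_monomial_nil normr1.
rewrite omega_monomial_cons normrM -[leRHS]mulr1.
by apply: ler_pM => //; exact: omega_le1.
Qed.

Lemma measurable_chart (f : rV -> R) : CnD 0%N f ->
  measurable_fun setT (fun p => f (row p)).
Proof. by move=> cf; apply: measurable_row_of_tuple; exact: Cn_cont cf. Qed.

Lemma measurable_rho (b : R -> R) : measurable_fun setT (b : Rm -> R) ->
  measurable_fun setT (fun p => b (rho (row p))).
Proof.
move=> mb; apply: (@measurableT_comp _ _ _ _ _ _ b) => //.
exact: (measurable_chart (f := fun z : rV => rho z) (Cn_coordinate _ _ _)).
Qed.

Lemma measurable_cons (x : R) d (T' : measurableType d) (f : tupn -> T') :
  measurable_fun setT f -> measurable_fun setT (fun t => f (cons x t)).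
Proof.
move=> mf; apply: measurableT_comp mf _.
apply: measurableT_comp (@measurable_cons_pair R _) _.
exact: pair1_measurable.
Qed.

Lemma integrable_sigma :
  (tup N.+2).-integrable setT (fun t => (sigma (row (cons 0 t)))%:E).
Proof.
have [C C0 hC] := @sigma_le_prod_decay R N.
apply: (@integrable_majorant R N.+2 (fun t => sigma (row (cons 0 t))) C).
  apply: (measurable_cons 0 (f := fun p => sigma (row p))).
  by apply: measurable_chart; exact: Cn_sigma.
move=> t; rewrite gtr0_norm ?sigma_gt0//; apply: le_trans (hC _) _.
rewrite /majorant; rewrite (eq_bigr (fun i => decay (row_of_tuple t 0 i)))//.
by move=> i _; rewrite row_consS [in RHS]mxE.
Qed.

(** Here delta > - n / 2 enters: <r>^(2 delta) >= <r>^-n, while W is at least of order <r>^(n-1).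
    What remains, <r>^-1, is just large enough for its integral to diverge. *)
Lemma weight_ge delta r : - (N.+3%:R / 2) < delta ->
  (J r * Num.sqrt N.+2%:R)^-1 <= J r `^ (2 * delta) * W r.
Proof.
move=> hd; have J0 := jbracket_gt0 r; have J1 := jbracket_ge1 r.
have Jn : J r != 0 by rewrite gt_eqF.
have s0 : 0 < Num.sqrt N.+2%:R :> R by rewrite sqrtr_gt0 ltr0n.
have h1 : (J r ^+ N.+3)^-1 <= J r `^ (2 * delta).
  rewrite -powR_mulrn ?(ltW J0)// -powRN; apply: (ler_powR J1).
  have : 2 * - (N.+3%:R / 2) < 2 * delta by rewrite ltr_pM2l.
  by rewrite mulrN mulrCA divff// mulr1 => /ltW.
have h2 : J r ^+ N.+2 / Num.sqrt N.+2%:R <= W r.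
  rewrite ler_pdivrMr// /profile_volume -mulrA [_^-1 * _]mulrC mulrA.
  rewrite ler_pdivlMr ?profile_root_gt0//.
  apply: le_trans (ler_wpM2l (exprn_ge0 _ (ltW J0)) (profile_root_le N r)) _.
  rewrite mulrCA -exprD (_ : (N.+2 + N.+1 = (2 * N).+3)%N) 1?mulrC//.
  by rewrite mul2n -addnn !addnS !addSn.
apply: le_trans (ler_pM _ _ h1 h2); last 2 first.
- by rewrite invr_ge0 exprn_ge0// ltW.
- by rewrite divr_ge0 ?exprn_ge0// ltW.
rewrite le_eqVlt; apply/orP; left; apply/eqP; rewrite exprS.
have := expf_neq0 N.+2 Jn; move: (J r ^+ N.+2) => Q Q0.
by field; rewrite Jn Q0 gt_eqF.
Qed.

Section Coefficients.
Variables (delta : R) (U : tupn -> R).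
Hypothesis hd : - (N.+3%:R / 2) < delta.
Hypothesis mU : measurable_fun setT U.
Hypothesis U2 : (\int[tup N.+3]_p (wt delta p * U p ^+ 2)%:E < +oo)%E.

Lemma measurable_weight : measurable_fun setT (fun p => wt delta p).
Proof.
apply: measurable_funM; last by apply: measurable_chart; exact: Cn_sigma.
apply: (measurable_rho (b := fun r => J r `^ (2 * delta) * W r)).
apply: measurable_funM; last first.
  exact: continuous_measurable_fun (@continuous_profile_volume R N).
apply: (@measurableT_comp _ _ _ _ _ _ (@powR R ^~ (2 * delta))).
  exact: measurable_powR.
exact: continuous_measurable_fun (@continuous_jbracket R).
Qed.

(** By |U h| <= U^2 |h| + |h|: for bounded rho the weight is bounded below, so the first term is
    controlled by the weighted norm of [U], and the second is at most a multiple of [majorant]. *)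
Lemma integrable_modal (h : tupn -> R) B C : measurable_fun setT h ->
  (forall p, `|h p| <= C * sigma (row p)) ->
  (forall p, B < `|rho (row p)| -> h p = 0) ->
  (tup N.+3).-integrable setT (fun p => (U p * h p)%:E).
Proof.
move=> mh hC hB; have [C1 C10 hC1] := @sigma_le_prod_decay R N.
pose k := Num.sqrt N.+2%:R : R.
have k0 : 0 < k by rewrite sqrtr_gt0 ltr0n.
have d0 : 0 < decay B := decay_gt0 B.
pose a := `|C| * ((1 + `|B|) * k); pose b := `|C| * C1 / decay B.
have i1 : (tup N.+3).-integrable setT (EFin \o (fun p => wt delta p * U p ^+ 2)).
  apply: ge0_integrable U2.
    by apply: measurable_funM; [exact: measurable_weight|exact: measurable_funX].
  move=> p; apply: mulr_ge0; last exact: sqr_ge0.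
  rewrite mulr_ge0 ?(ltW (sigma_gt0 _))//.
  by rewrite mulr_ge0 ?powR_ge0 ?(ltW (profile_volume_gt0 _ _)).
have i2 : (tup N.+3).-integrable setT (EFin \o (fun p => majorant (row p))).
  apply: (@integrable_majorant R N.+3 _ 1); first exact: measurable_majorant.
  by move=> p; rewrite mul1r ger0_norm// ltW// majorant_gt0.
apply: (integrable_le (g := fun p => a * (wt delta p * U p ^+ 2) + b * majorant (row p))).
- exact: measurable_funM.
- move=> p; rewrite normrM; have s0 := sigma_gt0 (row p).
  have w0 : 0 <= wt delta p.
    rewrite mulr_ge0 ?(ltW s0)//.
    by rewrite mulr_ge0 ?powR_ge0 ?(ltW (profile_volume_gt0 _ _)).
  have hC' : `|h p| <= `|C| * sigma (row p).
    by apply: le_trans (hC p) _; rewrite ler_wpM2r ?ler_norm// ltW.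
  have m0 := majorant_gt0 (row p).
  have a0 : 0 <= a by rewrite !mulr_ge0// ltW.
  have b0 : 0 <= b by rewrite divr_ge0 ?mulr_ge0// ltW.
  have [xB|xB] := leP `|rho (row p)| B; last first.
    rewrite (hB p xB) normr0 mulr0 addr_ge0// mulr_ge0// ?sqr_ge0//; last exact: ltW.
    by rewrite mulr_ge0// sqr_ge0.
  apply: (@le_trans _ _ (U p ^+ 2 * `|h p| + `|h p|)).
    rewrite -[X in _ + X]mul1r -mulrDl ler_wpM2r//.
    rewrite -(real_normK (num_real (U p))); have := sqr_ge0 (`|U p| - 1).
    by have := normr_ge0 (U p); move: `|U p| => z; nra.
  apply: lerD.
    rewrite [leRHS]mulrA [leRHS]mulrC ler_wpM2l ?sqr_ge0//.
    apply: le_trans hC' _; rewrite /a -mulrA ler_wpM2l//.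
    rewrite mulrA -[leLHS]mul1r ler_wpM2r ?(ltW s0)//.
    apply: le_trans (ler_wpM2l _ (weight_ge (rho (row p)) hd)); last first.
      by rewrite mulr_ge0// ltW.
    rewrite ler_pdivlMr ?mulr_gt0 ?jbracket_gt0// mul1r ler_wpM2r ?(ltW k0)//.
    apply: le_trans (jbracket_le _) _; rewrite lerD2l (le_trans xB)//.
    exact: ler_norm.
  apply: le_trans hC' _; rewrite /b -!mulrA ler_wpM2l//.
  apply: le_trans (hC1 _) _; rewrite ler_wpM2l//.
  have -> : majorant (row p) = decay (rho (row p)) * \prod_i decay (y i (row p)).
    exact: big_ord_recl.
  rewrite mulrA -[leLHS]mul1r ler_wpM2r//.
    by apply: prodr_ge0 => i _; rewrite ltW// decay_gt0.
  rewrite mulrC ler_pdivlMr// mul1r; apply: decay_ler.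
  exact: le_trans xB (ler_norm B).
- rewrite (_ : EFin \o _ = fun p => (a%:E * (EFin \o (fun p => (wt delta p * U p ^+ 2)%R)) p +
    b%:E * (EFin \o (fun p => majorant (row p))) p)%E); last first.
    by apply/funext => p /=; rewrite EFinD !EFinM.
  by apply: integrableD => //; apply: integrableZl.
Qed.

(** The moment over the sphere at rho = x. Where the slice is not integrable the value carries no
    information, so identities between moments are stated almost everywhere. *)
Definition mode w (x : R) : R := Rintegral (tup N.+2) setT
  (fun t => U (cons x t) * P w (row (cons x t)) * sigma (row (cons x t))).

Let mode_density w p : R := U p * P w (row p) * sigma (row p).

Let measurable_mode_density w : measurable_fun setT (mode_density w).
Proof.
apply: measurable_funM; last by apply: measurable_chart; exact: Cn_sigma.
by apply: measurable_funM => //; apply: measurable_chart; exact: Cn_omega_monomial.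
Qed.

Lemma measurable_mode w : measurable_fun setT (mode w : Rm -> R).
Proof.
pose g p := (mode_density w p)%:E.
have mg : measurable_fun setT g by exact/measurable_EFinP.
have mgc (k : tupn -> \bar R) : measurable_fun setT k -> (forall p, 0 <= k p)%E ->
    measurable_fun setT (fun x : Rm => \int[tup N.+2]_t k (cons x t))%E.
  move=> mk k0; apply: (@measurable_fun_fubini_tonelli_F _ _ _ _ _ (tup N.+2)
    (k \o @cons_pair R N.+2)) => [|z]; last exact: k0.
  exact: measurableT_comp mk (@measurable_cons_pair R N.+2).
rewrite (_ : mode w = fun x => fine ((\int[tup N.+2]_t g^\+ (cons x t)) -
    (\int[tup N.+2]_t g^\- (cons x t)))%E).
  apply: (@measurableT_comp _ _ _ _ _ _ (@fine R)) => //.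
  apply: emeasurable_funB; apply: mgc => //.
  - exact: measurable_funepos.
  - exact: measurable_funeneg.
apply/funext => x.
rewrite /mode /Rintegral; congr fine; rewrite [LHS]integralE.
by congr (_ - _)%E; apply: eq_integral => t _; rewrite ?funeposE ?funenegE.
Qed.

Lemma mode_fubini w (b : R -> R) B C : measurable_fun setT (b : Rm -> R) ->
  (forall x, `|b x| <= C) -> (forall x, B < `|x| -> b x = 0) ->
  leb.-integrable setT (fun x => (b x * mode w x)%:E) /\
  (\int[tup N.+3]_p (U p * (b (rho (row p)) * P w (row p) * sigma (row p)))%:E =
   \int[leb]_x (b x * mode w x)%:E)%E.
Proof.
move=> mb bC bB.
pose h p := b (rho (row p)) * P w (row p) * sigma (row p).
have mh : measurable_fun setT h.
  apply: measurable_funM; last by apply: measurable_chart; exact: Cn_sigma.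
  apply: measurable_funM; first exact: measurable_rho.
  by apply: measurable_chart; exact: Cn_omega_monomial.
have hC p : `|h p| <= C * sigma (row p).
  rewrite normrM (gtr0_norm (sigma_gt0 _)) ler_wpM2r ?(ltW (sigma_gt0 _))//.
  by rewrite normrM -[leRHS]mulr1; apply: ler_pM => //; exact: omega_monomial_le1.
have hB p : B < `|rho (row p)| -> h p = 0 by move=> xB; rewrite /h bB// !mul0r.
have iUh := integrable_modal mh hC hB.
have /integrable_tupleS[_ i2] := iUh.
pose F (x : Rm) := (\int[tup N.+2]_t (U (cons x t) * h (cons x t))%:E)%E.
have iF : leb.-integrable setT F := integrable_fubini_F i2.
have FE : {ae leb, forall x, F x = (b x * mode w x)%:E}.
  apply: (ae_mono (ae_integrable1 i2)) => x ix.
  (* Integrability of the slice of [U] is recovered by dividing by b(x), so the zeros of b are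
     treated apart. *)
  have [b0|b0] := eqVneq (b x) 0.
    rewrite b0 mul0r /F -[RHS](@integral0 _ _ _ (tup N.+2) setT).
    by apply: eq_integral => t _; rewrite /h row_cons0 b0 !mul0r mulr0.
  have ihx : (tup N.+2).-integrable setT (fun t => (mode_density w (cons x t))%:E).
    rewrite (_ : (fun t => _) = fun t => ((b x)^-1%:E *
      (U (cons x t) * h (cons x t))%:E)%E); first exact: integrableZl.
    apply/funext => t; rewrite -EFinM /h /mode_density row_cons0; congr (_%:E).
    by move: (U _) (P _ _) (sigma _) => *; field.
  rewrite EFinM /mode -(Rintegral_EFin ihx) -integralZl//.
  apply: eq_integral => t _; rewrite -EFinM /h /mode_density row_cons0.
  by congr (_%:E); ring.
have mbm : measurable_fun setT (fun x : Rm => b x * mode w x).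
  exact: measurable_funM mb (measurable_mode w).
split.
  apply/integrableP; split; first exact/measurable_EFinP.
  have /integrableP[mF] := iF; apply: le_lt_trans; rewrite le_eqVlt.
  apply/orP; left; apply/eqP; apply: ae_eq_integral => //.
  - by apply: measurableT_comp => //; exact/measurable_EFinP.
  - exact: measurableT_comp.
  - by apply: (ae_mono FE) => x -> _.
transitivity (\int[leb]_x F x)%E.
  rewrite -(integral_tupleS iUh); apply: eq_integral => p _.
  by rewrite /h mulrA.
apply: ae_eq_integral => //; first by have /integrableP[] := iF.
  exact/measurable_EFinP.
by apply: (ae_mono FE) => x -> _.
Qed.

End Coefficients.
End Modes.

(** * Divergence of the integral of 1 / <x> at both ends *)

Section Divergence.
Variable R : realType.
Local Notation leb := (@lebesgue_measure R).
Local Notation J := (@jbracket R).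

(** The inverse hyperbolic sine, an odd primitive of 1 / <x>. *)
Let g (x : R) := ln (x + J x).

Let g_gt0 (x : R) : 0 < x + J x.
Proof.
rewrite -ltrBlDl sub0r; apply: le_lt_trans (ler_norm _) _; rewrite normrN.
rewrite -sqrtr_sqr ltr_sqrt; last by rewrite ltr_pwDl// sqr_ge0.
by rewrite ltrDr.
Qed.

Let is_derive_g (x : R) : is_derive x (1 : R) g (J x)^-1.
Proof.
have h := is_derive_addf (is_derive_id x (1 : R)) (is_derive_jbracket x).
have h1 := @is_derive_compf R R (@ln R) _ (fun y => y + J y) x _ _ (is_derive1_ln (g_gt0 x)) h.
apply: (is_derive_eq h1).
have := g_gt0 x; have := jbracket_gt0 x; move: (J x) => j j0 xj.
by field; rewrite !gt_eqF.
Qed.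

Let integral_jbracketV (a b : R) : a <= b ->
  (\int[leb]_(x in `[a, b]) ((J x)^-1)%:E = (g b - g a)%:E)%E.
Proof.
move=> ab; apply: integral_FTC => // x.
apply: cvgV; first by rewrite gt_eqF// jbracket_gt0.
exact: continuous_jbracket.
Qed.

Let gN (x : R) : g (- x) = - g x.
Proof.
rewrite /g jbracketN -lnV ?posrE//; congr ln.
apply: (mulfI (lt0r_neq0 (g_gt0 x))); rewrite divff ?gt_eqF//.
have := jbracket_sqr x; move: (J x) => j e.
by rewrite mulrDl !mulrDr [j * j](_ : _ = 1 + x ^+ 2)// ; ring.
Qed.

Lemma integral_jbracketV_unbounded (M I : R) :
  (exists2 b, M <= b & (I%:E < \int[leb]_(x in `[M, b]) ((J x)^-1)%:E)%E) /\
  (exists2 b, M <= b & (I%:E < \int[leb]_(x in `[(- b)%R, (- M)%R]) ((J x)^-1)%:E)%E).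
Proof.
(* At b = exp z the primitive is at least ln b = z, which exceeds I + g(M); moreover M <= z <= b. *)
pose z := `|M| + `|I + g M| + 1; pose b := expR z.
have z0 : 0 <= z by rewrite !addr_ge0.
have zb : z <= b by apply: le_trans (expR_ge1Dx z); rewrite lerDr.
have Mb : M <= b.
  by apply: le_trans zb; rewrite /z -addrA (le_trans (ler_norm M))// lerDl addr_ge0.
have Ig : I < g b - g M.
  rewrite ltrBrDr; apply: (@lt_le_trans _ _ z).
    rewrite /z -addrA [`|M| + _]addrC -addrA (le_lt_trans (ler_norm _))// ltrDl.
    by rewrite ltr_wpDr.
  rewrite -[leLHS]expRK ler_ln ?posrE ?expR_gt0// lerDl.
  by rewrite ltW// jbracket_gt0.
split; exists b => //; first by rewrite integral_jbracketV// lte_fin.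
by rewrite integral_jbracketV ?lerN2// lte_fin !gN opprK addrC.
Qed.

End Divergence.

(** * The weak equation and the growth of the moments *)

Section ModeEquation.
Variables (R : realType) (N : nat).
Local Notation rV := 'rV[R]_N.+3.
Local Notation leb := (@lebesgue_measure R).
Local Notation Rm := (measurableTypeR R).
Local Notation tup := (lebesgue_tuple R).
Local Notation tupn := (N.+3.-tuple Rm).
Local Notation rho x := ((x : 'rV[R]_N.+3) 0 ord0).
Local Notation J := (@jbracket R).
Local Notation A := (profile_flux N).
Local Notation W := (profile_volume N).
Local Notation q := (angular_weight N).
Local Notation K := (mode_potential N).
Local Notation row := (@row_of_tuple R N.+3).
Local Notation P := (@omega_monomial R N).
Local Notation cons x t := (cons_pair ((x : Rm), t) : tupn).
Local Notation wt delta p := (J (rho (row p)) `^ (2 * delta) * W (rho (row p)) * sigma (row p)).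
Implicit Types (w : seq 'I_N.+3) (p : tupn) (t : N.+2.-tuple Rm).
Variables (delta : R) (U : tupn -> R).
Hypothesis hd : - (N.+3%:R / 2) < delta.
Hypothesis mU : measurable_fun setT U.
Hypothesis U2 : (\int[tup N.+3]_p (wt delta p * U p ^+ 2)%:E < +oo)%E.

Lemma loc_integrable_mode w : loc_integrable (mode U w).
Proof.
have mm := measurable_mode mU w; split=> // a b.
pose c := `|a| + `|b|.
have [] := @mode_fubini R N delta U hd mU U2 w (\1_(`[a, b]%classic)) c 1.
- exact: measurable_indic.
- by move=> x; rewrite indicE; case: (_ \in _); rewrite ?normr1 ?normr0.
- move=> x cx; rewrite indicE memNset//= in_itv /= => /andP[ax xb].
  move: cx; rewrite ltNge => /negP; apply; rewrite ler_norml /c.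
  apply/andP; split.
    by rewrite (le_trans _ ax)// lerNl (le_trans (ler_norm _))// normrN lerDl.
  by rewrite (le_trans xb)// (le_trans (ler_norm b))// lerDr.
move=> ib _; apply/integrable_mkcond => //.
rewrite (_ : _ \_ _ = fun x => (\1_(`[a, b]%classic) x * mode U w x)%:E)//.
by apply/funext => x; rewrite patchE indicE; case: (_ \in _); rewrite ?mul1r ?mul0r.
Qed.

Lemma compact_bounded_fun (b : R -> R) : continuous b -> compact_support b ->
  exists B C, (forall x, `|b x| <= C) /\ (forall x, B < `|x| -> b x = 0).
Proof.
move=> cb [B bB]; have [C bC] := bounded_on_segment (normr_ge0 B) cb.
exists B, `|C|; split=> // x; have [xB|xB] := leP `|x| `|B|.
  exact: le_trans (bC _ xB) (ler_norm _).
by rewrite bB ?normr0// (le_lt_trans (ler_norm B)).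
Qed.

Lemma mode_weak w :
  (forall a, test1 a ->
    (\int[tup N.+3]_p (U p * jacobi_density (fun z => a (rho z) * P w z) (row p))%:E
     = 0)%E) ->
  (forall v, (size v < size w)%N -> {ae leb, forall x, mode U v x = 0}) ->
  forall a, test1 a -> Rintegral leb setT (fun x => mode U w x *
    ('D_1 (fun y => A y * 'D_1 a y) x - K (size w) x * a x)) = 0.
Proof.
move=> wU v0 a ta; have [L sL hL] := jacobi_density_mode R w.
pose c := 'D_1 (fun y => A y * 'D_1 a y).
have tA : test1 (fun y => A y * 'D_1 a y).
  by apply: test1_mul (test1_derive ta) => k; exact: Cn_profile_flux.
have tc : test1 c by exact: test1_derive.
have ha r : is_derive r (1 : R) a ('D_1 a r) := Cn_is_derive r 1 (ta.1 1%N).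
have hc r : is_derive r (1 : R) (fun r => A r * 'D_1 a r) (c r) :=
  Cn_is_derive r 1 (tA.1 1%N).
pose b1 x := c x - K (size w) x * a x.
pose b2 x := q x * a x.
have cb1 : continuous b1.
  move=> x; apply: cvgB; first exact: test1_cont.
  by apply: cvgM; [exact: continuous_mode_potential|exact: test1_cont].
have cb2 : continuous b2.
  move=> x; apply: cvgM; first exact: continuous_angular_weight.
  exact: test1_cont.
have sb1 : compact_support b1.
  by apply: compact_support_sub tc.2 _; exact: compact_support_mull ta.2.
have sb2 : compact_support b2 by exact: compact_support_mull ta.2.
have [B1 [C1 [bC1 bB1]]] := compact_bounded_fun cb1 sb1.
have [B2 [C2 [bC2 bB2]]] := compact_bounded_fun cb2 sb2.
have mb1 : measurable_fun setT (b1 : Rm -> R) by exact: continuous_measurable_fun.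
have mb2 : measurable_fun setT (b2 : Rm -> R) by exact: continuous_measurable_fun.
have f1 := mode_fubini hd mU U2 w mb1 bC1 bB1.
have f2 v := mode_fubini hd mU U2 v mb2 bC2 bB2.
have ih (b : R -> R) B C v : measurable_fun setT (b : Rm -> R) ->
    (forall x, `|b x| <= C) -> (forall x, B < `|x| -> b x = 0) ->
    (tup N.+3).-integrable setT
      (fun p => (U p * (b (rho (row p)) * P v (row p) * sigma (row p)))%:E).
  move=> mb bC bB; apply: (integrable_modal hd mU U2 (B := B) (C := C)).
  - apply: measurable_funM; last by apply: measurable_chart; exact: Cn_sigma.
    apply: measurable_funM; first exact: measurable_rho.
    by apply: measurable_chart; exact: Cn_omega_monomial.
  - move=> p; rewrite normrM (gtr0_norm (sigma_gt0 _)) ler_wpM2r ?(ltW (sigma_gt0 _))//.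
    by rewrite normrM -[leRHS]mulr1; apply: ler_pM => //; exact: omega_monomial_le1.
  - by move=> p /bB ->; rewrite !mul0r.
have := wU a ta.
rewrite (_ : (fun p => _) = fun p =>
  ((U p * (b1 (rho (row p)) * P w (row p) * sigma (row p)))%:E +
   \sum_(v <- L) (U p * (b2 (rho (row p)) * P v (row p) * sigma (row p)))%:E)%E); last first.
  apply/funext => p; rewrite sumEFin -EFinD; congr (_%:E).
  rewrite (hL _ _ _ _ ha hc) -/(b1 _).
  rewrite [X in _ = _ + X](eq_bigr (fun v =>
    U p * b2 (rho (row p)) * sigma (row p) * P v (row p))).
    rewrite -mulr_sumr /b2; move: (b1 _) (\sum_(v <- L) _) (P w _) (sigma _) => *.
    by ring.
  by move=> v _; rewrite /b2; move: (P v _) (sigma _) => *; ring.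
rewrite integralD//; last 2 first.
- exact: ih mb1 bC1 bB1.
- by apply: integrable_sum => // v _; exact: ih mb2 bC2 bB2.
rewrite integral_sum//; last by move=> v; exact: ih mb2 bC2 bB2.
rewrite big_seq big1 ?adde0 => [|v vL]; last first.
  have [_ ->] := f2 v.
  have mm := measurable_mode mU v.
  rewrite -[RHS](@integral0 _ _ _ leb setT); apply: ae_eq_integral => //.
    by apply/measurable_EFinP; exact: measurable_funM.
  have sv : (size v < size w)%N by move/allP : sL => /(_ _ vL) /eqP <-.
  by apply: (ae_mono (v0 v sv)) => x -> _; rewrite mulr0.
have [_ ->] := f1 => e.
rewrite (_ : (fun x => mode U w x * _) = fun x => b1 x * mode U w x); last first.
  by apply/funext => x; rewrite mulrC.
by rewrite /Rintegral e.
Qed.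

Let S := Rintegral (tup N.+2) setT (fun t => sigma (row (cons 0 t))).
Let M2 (x : R) := (\int[tup N.+2]_t (U (cons x t) ^+ 2 * sigma (row (cons x t)))%:E)%E.

Let measurable_row (x : R) (f : rV -> R) : (Cn (@axes R N.+3)) 0%N f ->
  measurable_fun setT (fun t => f (row (cons x t))).
Proof.
by move=> cf; apply: (measurable_cons x (f := fun p => f (row p))); exact: measurable_chart.
Qed.

Let sigma_int (x : R) : (tup N.+2).-integrable setT (fun t => (sigma (row (cons x t)))%:E).
Proof. by under eq_fun do rewrite sigma_cons; exact: integrable_sigma. Qed.

Let M2_ge0 x : (0 <= M2 x)%E.
Proof.
apply: integral_ge0 => t _; rewrite lee_fin.
exact: mulr_ge0 (sqr_ge0 _) (ltW (sigma_gt0 _)).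
Qed.

(* Cauchy-Schwarz on the sphere, through [2 |U| <= k U^2 + 1 / k]. *)
Let mode_le w (x c : R) : 0 < c -> c <= `|mode U w x| ->
  ((c ^+ 2 / (1 + `|S|))%:E <= M2 x)%E.
Proof.
move=> c0 cx; have [M2x|] := ltP (M2 x) +oo%E; last by apply: le_trans; rewrite leey.
have m2 : M2 x = (fine (M2 x))%:E by rewrite fineK// ge0_fin_numE.
rewrite m2 lee_fin; set m := fine (M2 x).
have S1 : 0 < 1 + `|S| by rewrite ltr_pwDl.
(* This k makes the term (4 k)^-1 S at most c / 2. The area S of the sphere is replaced by 1 + |S|,
   which is positive at sight. *)
pose k := (1 + `|S|) / (2 * c).
have k0 : 0 < k by rewrite divr_gt0 ?mulr_gt0.
have mUx : measurable_fun setT (fun t => U (cons x t)) by exact: measurable_cons.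
have ms : measurable_fun setT (fun t => sigma (row (cons x t))).
  by apply: measurable_row; exact: Cn_sigma.
pose f2 t : R := U (cons x t) ^+ 2 * sigma (row (cons x t)).
have i2 : (tup N.+2).-integrable setT (EFin \o f2).
  apply: ge0_integrable => //.
    by apply: measurable_funM => //; exact: measurable_funX.
  by move=> t; exact: mulr_ge0 (sqr_ge0 _) (ltW (sigma_gt0 _)).
pose G t := k * f2 t + (4 * k)^-1 * sigma (row (cons x t)).
have GE : EFin \o G = fun t => (k%:E * (EFin \o f2) t +
    ((4 * k)^-1)%:E * (sigma (row (cons x t)))%:E)%E.
  by apply/funext => t /=; rewrite EFinD !EFinM.
have iG : (tup N.+2).-integrable setT (EFin \o G).
  by rewrite GE; apply: integrableD => //; apply: integrableZl.
pose f t := U (cons x t) * P w (row (cons x t)) * sigma (row (cons x t)).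
have mf : measurable_fun setT f.
  apply: measurable_funM => //; apply: measurable_funM => //.
  by apply: measurable_row; exact: Cn_omega_monomial.
have fG t : `|f t| <= G t.
  rewrite /f /G /f2 [k * _]mulrA -mulrDl normrM (gtr0_norm (sigma_gt0 _)).
  rewrite ler_wpM2r ?(ltW (sigma_gt0 _))// normrM.
  apply: le_trans (ler_piMr _ (omega_monomial_le1 _ _)) _ => //.
  rewrite -(real_normK (num_real (U _))); move: `|U _| => z.
  rewrite -subr_ge0 (_ : _ - _ = k * (z - (2 * k)^-1) ^+ 2).
    by rewrite mulr_ge0 ?(ltW k0)// sqr_ge0.
  by field; rewrite gt_eqF.
have iff : (tup N.+2).-integrable setT (EFin \o f) by exact: integrable_le iG.
have : `|mode U w x| <= k * m + (4 * k)^-1 * S.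
  apply: le_trans (le_normr_Rintegral measurableT iff) _.
  apply: (@le_trans _ _ (Rintegral (tup N.+2) setT G)).
    apply: le_Rintegral => //; apply: (integrable_le _ _ iG); last by move=> t; rewrite normr_id.
    exact: measurableT_comp.
  rewrite le_eqVlt; apply/orP; left; apply/eqP; apply: EFin_inj.
  rewrite -Rintegral_EFin// -/(EFin \o G) GE integralD//; last 2 first.
  - exact: integrableZl.
  - exact: integrableZl.
  rewrite !integralZl// EFinD !EFinM -m2; congr (_ + _ * _)%E.
  rewrite /S -(Rintegral_EFin (sigma_int 0)).
  by apply: eq_integral => t _; rewrite sigma_cons.
move=> /(le_trans cx) cm.
have kS : (4 * k)^-1 * S <= c / 2.
  apply: (@le_trans _ _ ((4 * k)^-1 * (1 + `|S|))).
    apply: ler_wpM2l; last by rewrite (le_trans (ler_norm S))// lerDr.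
    by rewrite invr_ge0 mulr_ge0// ltW.
  by rewrite /k le_eqVlt; apply/orP; left; apply/eqP; field; rewrite !gt_eqF.
have : c / 2 <= k * m by move: cm kS; lra.
have c2 : 0 <= 2 * c by rewrite mulr_ge0// ltW.
move=> /(ler_wpM2l c2); rewrite ler_pdivrMr//.
rewrite (_ : 2 * c * (c / 2) = c ^+ 2); last by field.
by rewrite (_ : 2 * c * (k * m) = m * (1 + `|S|))// /k; field; rewrite gt_eqF.
Qed.

(** By [mode_le], a lower bound on |f| over a half-line bounds the L^2 norm of almost every slice of
    [U] there from below. With [weight_ge] the finite norm of [U] would then dominate a multiple of
    the integral of 1 / <x> over arbitrarily long segments of that half-line. *)
Lemma mode_no_growth w (f : R -> R) : {ae leb, forall x, mode U w x = f x} ->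
  no_growth f /\ no_growth (fun x => f (- x)).
Proof.
move=> fE; pose k := Num.sqrt N.+2%:R : R.
have k0 : 0 < k by rewrite sqrtr_gt0 ltr0n.
pose om x := J x `^ (2 * delta) * W x.
have om0 x : 0 <= om x by rewrite mulr_ge0 ?powR_ge0 ?(ltW (profile_volume_gt0 _ _)).
have mom : measurable_fun setT (om : Rm -> R).
  apply: measurable_funM; last exact: continuous_measurable_fun (@continuous_profile_volume R N).
  apply: (@measurableT_comp _ _ _ _ _ _ (@powR R ^~ (2 * delta))).
    exact: measurable_powR.
  exact: continuous_measurable_fun (@continuous_jbracket R).
have mM2 : measurable_fun setT (M2 : Rm -> \bar R).
  apply: (@measurable_fun_fubini_tonelli_F _ _ _ _ _ (tup N.+2)
    ((fun p => (U p ^+ 2 * sigma (row p))%:E) \o @cons_pair R N.+2)) => [|z].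
    apply: measurableT_comp (@measurable_cons_pair R N.+2); apply/measurable_EFinP.
    apply: measurable_funM; first exact: measurable_funX.
    by apply: measurable_chart; exact: Cn_sigma.
  by rewrite lee_fin mulr_ge0 ?sqr_ge0 ?(ltW (sigma_gt0 _)).
have I2 : (\int[leb]_x ((om x)%:E * M2 x) < +oo)%E.
  move: U2; rewrite ge0_integral_tupleS; last 2 first.
  - apply/measurable_EFinP; apply: measurable_funM; last exact: measurable_funX.
    exact: measurable_weight.
  - move=> p; rewrite lee_fin mulr_ge0 ?sqr_ge0// mulr_ge0 ?(ltW (sigma_gt0 _))//.
    exact: om0.
  rewrite (_ : (fun x => _) = fun x => ((om x)%:E * M2 x)%E)//.
  apply/funext => x; rewrite /M2 -ge0_integralZl_EFin//; last 2 first.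
  - by move=> t _; rewrite lee_fin mulr_ge0 ?sqr_ge0 ?(ltW (sigma_gt0 _)).
  - apply/measurable_EFinP; apply: measurable_funM.
      by apply: measurable_funX; exact: measurable_cons.
    by apply: measurable_row; exact: Cn_sigma.
  apply: eq_integral => t _; rewrite -EFinM row_cons0 /om; congr (_%:E).
  by move: (sigma _) (U _) => *; ring.
have key (c : R) (E : set R) : 0 < c -> measurable (E : set Rm) ->
    (forall x, E x -> c <= `|f x|) ->
    (\int[leb]_(x in E) ((J x)^-1)%:E <=
     (k * (1 + `|S|) / c ^+ 2)%:E * \int[leb]_x ((om x)%:E * M2 x))%E.
  move=> c0 mE Ec; pose d := k * (1 + `|S|) / c ^+ 2.
  have d0 : 0 < d by rewrite divr_gt0 ?mulr_gt0 ?exprn_gt0// ltr_pwDl.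
  have mg : measurable_fun setT (fun x : Rm => (om x)%:E * M2 x)%E.
    by apply: emeasurable_funM => //; exact/measurable_EFinP.
  have g0 x : (0 <= (om x)%:E * M2 x)%E by rewrite mule_ge0// lee_fin.
  rewrite -/d -ge0_integralZl_EFin//; last exact: ltW.
  apply: (@le_trans _ _ (\int[leb]_(x in E) (d%:E * ((om x)%:E * M2 x)))%E); last first.
    apply: ge0_subset_integral => //; first exact: measurable_funeM.
    by move=> x _; rewrite mule_ge0// lee_fin ltW.
  apply: ae_ge0_le_integral => //.
  - by move=> x _; rewrite lee_fin invr_ge0 ltW// jbracket_gt0.
  - apply/measurable_EFinP; apply: measurable_funTS.
    apply: continuous_measurable_fun => x; apply: cvgV.
      by rewrite gt_eqF// jbracket_gt0.
    exact: continuous_jbracket.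
  - by move=> x _; rewrite mule_ge0// lee_fin ltW.
  - by apply: measurable_funTS; exact: measurable_funeM.
  apply: (ae_mono fE) => x fx Ex.
  have cM := mode_le c0 (_ : c <= `|mode U w x|).
  have /cM {}cM : c <= `|mode U w x| by rewrite fx; exact: Ec.
  apply: (@le_trans _ _ (d%:E * ((om x)%:E * (c ^+ 2 / (1 + `|S|))%:E))%E); last first.
    apply: lee_wpmul2l; first by rewrite lee_fin ltW.
    by apply: lee_wpmul2l => //; rewrite lee_fin.
  rewrite -!EFinM lee_fin /d.
  have S1 : 1 + `|S| != 0 by rewrite gt_eqF// ltr_pwDl.
  rewrite [leRHS](_ : _ = k * om x).
    have := weight_ge x hd; rewrite -/(om x) -/k => h.
    by rewrite -ler_pdivrMl// -invfM [k * _]mulrC.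
  by move: (om x) => o; field; rewrite S1 gt_eqF.
have Ifin : (\int[leb]_x ((om x)%:E * M2 x))%E \is a fin_num.
  rewrite ge0_fin_numE//; apply: integral_ge0 => x _.
  by rewrite mule_ge0// lee_fin.
split=> c M c0 fc.
  have [[b Mb +] _] := integral_jbracketV_unbounded M
    (k * (1 + `|S|) / c ^+ 2 * fine (\int[leb]_x ((om x)%:E * M2 x))%E).
  rewrite ltNge EFinM fineK// => /negP; apply; apply: key => // x /=.
  by rewrite in_itv /= => /andP[Mx _]; exact: fc.
have [_ [b Mb]] := integral_jbracketV_unbounded M
  (k * (1 + `|S|) / c ^+ 2 * fine (\int[leb]_x ((om x)%:E * M2 x))%E).
rewrite ltNge EFinM fineK// => /negP; apply; apply: key => // x /=.
rewrite in_itv /= => /andP[_ xM]; rewrite -[x]opprK; apply: fc.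
by rewrite lerNr.
Qed.

End ModeEquation.

(** * Density of polynomials *)

Section StepFunctions.
Variable R : realType.
Implicit Types (x : R).

(* Polynomials bounded by 1 on [0, 1] with limit the indicator of [0, 1/2). *)
Definition step m x : R := (1 - x ^+ m) ^+ (m * 2 ^ m).

Lemma step_ge0 m x : 0 <= x <= 1 -> 0 <= step m x.
Proof. by move=> /andP[x0 x1]; rewrite exprn_ge0// subr_ge0 exprn_ile1. Qed.

Lemma step_le1 m x : 0 <= x <= 1 -> step m x <= 1.
Proof.
move=> /andP[x0 x1]; rewrite exprn_ile1//; first by rewrite subr_ge0 exprn_ile1.
by rewrite gerBl exprn_ge0.
Qed.

Let bernoulli k (z : R) : - 1 <= z -> 1 + k%:R * z <= (1 + z) ^+ k.
Proof.
move=> z1; elim: k => [|k IH]; first by rewrite mul0r addr0.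
have z0 : 0 <= 1 + z by rewrite -lerBlDl sub0r.
rewrite exprS; apply: le_trans (ler_wpM2l z0 IH).
rewrite -natr1 -subr_ge0 (_ : _ - _ = k%:R * z ^+ 2); last by ring.
by rewrite mulr_ge0// sqr_ge0.
Qed.

Let step_xE m x : (m * 2 ^ m)%:R * x ^+ m = m%:R * (2 * x) ^+ m.
Proof. by rewrite natrM natrX exprMn mulrA. Qed.

Lemma step_lt_half x : 0 <= x -> x < 1 / 2 -> step ^~ x @ \oo --> (1 : R).
Proof.
move=> x0 x2; have x01 : 0 <= x <= 1 by rewrite x0/=; lra.
(* Bernoulli's inequality leaves m (2 x)^m = (m r^m) r^m to be shown small: the first factor is at
   most 1 / (1 - r), and the second tends to 0. *)
pose r := Num.sqrt (2 * x).
have r0 : 0 <= r by exact: sqrtr_ge0.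
have rE : r ^+ 2 = 2 * x by rewrite sqr_sqrtr// mulr_ge0.
have r1 : r < 1.
  by rewrite -[ltRHS]sqrtr1 ltr_sqrt// mulrC -ltr_pdivlMr.
have lo m : 1 - m%:R * (r ^+ m * r ^+ m) <= step m x.
  rewrite -expr2 -exprM mulnC exprM rE -step_xE -mulrN.
  by apply: bernoulli; rewrite lerN2 exprn_ile1//; lra.
have mr m : m%:R * r ^+ m * (1 - r) <= 1 - r ^+ m.
  elim: m => [|m IH]; first by rewrite !mul0r subrr.
  have rm1 : r ^+ m.+1 <= 1 by rewrite exprn_ile1// ltW.
  have := ler_wpM2l r0 IH.
  have : 0 <= (1 - r) * (1 - r ^+ m.+1) by rewrite mulr_ge0 ?subr_ge0// ltW.
  by rewrite -natr1 !exprS; move: (r ^+ m) => P; lra.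
have lim1 : 1 - (1 - r)^-1 * r ^+ m @[m --> \oo] --> (1 : R).
  rewrite -[X in _ --> X]subr0 -(mulr0 (1 - r)^-1).
  apply: cvgB; first exact: cvg_cst.
  have h := @cvg_expr R r; apply: cvgM; first exact: cvg_cst.
  by apply: h; rewrite ger0_norm.
apply: (squeeze_cvgr _ lim1 (cvg_cst _)); apply: nearW => m.
rewrite step_le1// andbT; apply: le_trans (lo m); rewrite lerD2l lerN2 mulrA.
rewrite ler_wpM2r ?exprn_ge0// -[leRHS]mul1r ler_pdivlMr ?subr_gt0//.
by apply: le_trans (mr m) _; rewrite gerBl exprn_ge0.
Qed.

Lemma step_ge_half x : 1 / 2 <= x -> x <= 1 -> step ^~ x @ \oo --> (0 : R).
Proof.
move=> x2 x1; have x0 : 0 <= x by lra.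
have x01 : 0 <= x <= 1 by rewrite x0.
apply: (squeeze_cvgr _ (cvg_cst _) (@cvg_harmonic R)); apply: nearW => m.
rewrite step_ge0//= /harmonic /= -[leRHS]mul1r ler_pdivlMr//.
have z0 : 0 <= x ^+ m by rewrite exprn_ge0.
have z1 : x ^+ m <= 1 by rewrite exprn_ile1.
(* The inserted power is at least 1 + m (2 x)^m >= m + 1 by Bernoulli, and its product with [step]
   is a power of 1 - x^(2m), hence at most 1. *)
apply: (@le_trans _ _ (step m x * (1 + x ^+ m) ^+ (m * 2 ^ m))).
  rewrite ler_wpM2l ?step_ge0//.
  apply: le_trans (@bernoulli (m * 2 ^ m) (x ^+ m) _); last by lra.
  rewrite step_xE -natr1 addrC lerD2l ler_peMr//.
  by rewrite exprn_ege1//; lra.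
rewrite -exprMn exprn_ile1//; first by rewrite mulr_ge0//; lra.
rewrite (_ : (1 - x ^+ m) * (1 + x ^+ m) = 1 - (x ^+ m) ^+ 2); last by ring.
by rewrite gerBl sqr_ge0.
Qed.

End StepFunctions.

Section Completeness.
Variables (R : realType) (N : nat).
Local Notation leb := (@lebesgue_measure R).
Local Notation Rm := (measurableTypeR R).
Local Notation tup := (lebesgue_tuple R).
Local Notation tupn := (N.+3.-tuple Rm).
Local Notation rho x := ((x : 'rV[R]_N.+3) 0 ord0).
Local Notation J := (@jbracket R).
Local Notation W := (profile_volume N).
Local Notation row := (@row_of_tuple R N.+3).
Local Notation P := (@omega_monomial R N).
Local Notation wt delta p := (J (rho (row p)) `^ (2 * delta) * W (rho (row p)) * sigma (row p)).
Local Notation om a p := (omega_of (row p) 0 a).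
Implicit Types (w : seq 'I_N.+3) (p : tupn) (a : 'I_N.+3).
Variables (delta : R) (U : tupn -> R).
Hypothesis hd : - (N.+3%:R / 2) < delta.
Hypothesis mU : measurable_fun setT U.
Hypothesis U2 : (\int[tup N.+3]_p (wt delta p * U p ^+ 2)%:E < +oo)%E.
Hypothesis U0 : forall w, {ae leb, forall x, mode U w x = 0}.

Let measurable_om a : measurable_fun setT (fun p => om a p).
Proof. by apply: (measurable_chart (f := fun z => omega_of z 0 a)); exact: Cn_omega. Qed.

Let om_bound a p : - 1 <= om a p <= 1.
Proof. by rewrite -ler_norml omega_le1. Qed.

(* The multipliers [g] for which [g U] still has vanishing modes. *)
Let Z (B : R) (g : tupn -> R) := [/\ measurable_fun setT g,
  exists C, forall p, `|g p| <= C,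
  forall p, B < `|rho (row p)| -> g p = 0 &
  forall w, (\int[tup N.+3]_p (U p * (g p * P w (row p) * sigma (row p)))%:E = 0)%E].

Let Z_integrable B (g : tupn -> R) C w : measurable_fun setT g -> (forall p, `|g p| <= C) ->
  (forall p, B < `|rho (row p)| -> g p = 0) ->
  (tup N.+3).-integrable setT
    (EFin \o (fun p => U p * (g p * P w (row p) * sigma (row p)))).
Proof.
move=> mg gC gB; apply: (integrable_modal hd mU U2 (B := B) (C := C)).
- apply: measurable_funM; last by apply: measurable_chart; exact: Cn_sigma.
  by apply: measurable_funM => //; apply: measurable_chart; exact: Cn_omega_monomial.
- move=> p; rewrite normrM (gtr0_norm (sigma_gt0 _)) ler_wpM2r ?(ltW (sigma_gt0 _))//.
  by rewrite normrM -[leRHS]mulr1; apply: ler_pM => //; exact: omega_monomial_le1.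
- by move=> p /gB ->; rewrite !mul0r.
Qed.

Let chi (B x : R) : R := \1_(`[- B, B]%classic) x.

Let chiE B x : chi B x = if `|x| <= B then 1 else 0.
Proof. by rewrite /chi indicE mem_setE in_itv /= -ler_norml; case: ifP. Qed.

Let measurable_chi B : measurable_fun setT (chi B : Rm -> R).
Proof. exact: measurable_indic. Qed.

Let Z_eq B (g h : tupn -> R) : g =1 h -> Z B g -> Z B h.
Proof. by move=> /funext ->. Qed.

Let Z_rho B (b : R -> R) C : measurable_fun setT (b : Rm -> R) ->
  (forall x, `|b x| <= C) -> (forall x, B < `|x| -> b x = 0) ->
  Z B (fun p => b (rho (row p))).
Proof.
move=> mb bC bB; split=> [||p|w]; [exact: measurable_rho|by exists C|exact: bB|].
have [ib ->] := mode_fubini hd mU U2 w mb bC bB.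
rewrite -[RHS](@integral0 _ _ _ leb setT); apply: ae_eq_integral => //.
  by have /integrableP[] := ib.
by apply: (ae_mono (U0 w)) => x -> _; rewrite mulr0.
Qed.

Let Z_lin B g h (c d : R) : Z B g -> Z B h -> Z B (fun p => c * g p + d * h p).
Proof.
move=> [mg [C gC] gB g0] [mh [C' hC] hB h0]; split.
- by apply: measurable_funD; apply: measurable_funM.
- exists (`|c| * C + `|d| * C') => p; apply: le_trans (ler_normD _ _) _.
  by rewrite !normrM lerD// ler_wpM2l.
- by move=> p xB; rewrite gB// hB// !mulr0 addr0.
move=> w; have ig := Z_integrable w mg gC gB; have ih := Z_integrable w mh hC hB.
rewrite (_ : (fun p => _) = fun p =>
    (c%:E * (U p * (g p * P w (row p) * sigma (row p)))%:E +
     d%:E * (U p * (h p * P w (row p) * sigma (row p)))%:E)%E); last first.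
  apply/funext => p; rewrite -!EFinM -EFinD; congr (_%:E).
  by move: (P w _) (sigma _) => *; ring.
rewrite integralD//; [|exact: integrableZl|exact: integrableZl].
by rewrite !integralZl// g0 h0 !mule0 adde0.
Qed.

Let Z_omega B g a : Z B g -> Z B (fun p => g p * om a p).
Proof.
move=> [mg [C gC] gB g0]; split.
- exact: measurable_funM.
- exists C => p; rewrite normrM -[leRHS]mulr1; apply: ler_pM => //.
  exact: omega_le1.
- by move=> p /gB ->; rewrite mul0r.
move=> w; rewrite -[RHS](g0 (a :: w)); apply: eq_integral => p _.
by rewrite omega_monomial_cons; congr (_%:E); move: (P w _) (sigma _) => *; ring.
Qed.

Let Z_affine B g a (c d : R) : Z B g -> Z B (fun p => g p * (c * om a p + d)).
Proof.
move=> Zg; have := Z_lin c d (Z_omega a Zg) Zg.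
by apply: Z_eq => p; ring.
Qed.

Let Z_exp B g a (c d : R) m : Z B g -> Z B (fun p => g p * (c * om a p + d) ^+ m).
Proof.
move=> Zg; elim: m => [|m IH].
  by move: Zg; apply: Z_eq => p; rewrite mulr1.
have := Z_affine a c d IH; apply: Z_eq => p.
by rewrite exprSr mulrA.
Qed.

Let Z_step B g a (c d : R) m k : Z B g ->
  Z B (fun p => g p * (1 - (c * om a p + d) ^+ m) ^+ k).
Proof.
move=> Zg; elim: k => [|k IH].
  by move: Zg; apply: Z_eq => p; rewrite mulr1.
have := Z_lin 1 (- 1) IH (Z_exp a c d m IH); apply: Z_eq => p.
rewrite exprSr; move: ((c * om a p + d) ^+ m) => e.
by move: ((1 - e) ^+ k) => e'; ring.
Qed.

Let Z_lim B (g_ : nat -> tupn -> R) (g : tupn -> R) C : (forall m, Z B (g_ m)) ->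
  measurable_fun setT g -> (forall m p, `|g_ m p| <= C) ->
  (forall p, g_ ^~ p @ \oo --> g p) -> Z B g.
Proof.
move=> Zg mg gC gg.
have gB p : B < `|rho (row p)| -> g p = 0.
  move=> xB; have := gg p; rewrite (_ : g_ ^~ p = cst 0).
    by move/cvg_lim => <-//; exact: lim_cst.
  by apply/funext => m; have [_ _ + _] := Zg m; apply.
split=> //.
  exists C => p; have h : `|g_ m p| @[m --> \oo] --> `|g p| by apply: cvg_norm; exact: gg.
  have <- := cvg_lim (@Rhausdorff R) h.
  by apply: limr_le; [by apply/cvg_ex; eexists; exact: h|exact: nearW].
(* The dominating multiplier must be cut off to |rho| <= B, since [U] times [sigma] need not be
   integrable without a cutoff. *)
move=> w; pose b p : R := C * chi B (rho (row p)).
have mb : measurable_fun setT b.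
  apply: measurable_funM => //; exact: (measurable_rho (measurable_chi B)).
have ib : (tup N.+3).-integrable setT
    (EFin \o (fun p => U p * (b p * P [::] (row p) * sigma (row p)))).
  apply: (@Z_integrable B b `|C|) => // p; rewrite /b chiE.
    by case: ifP; rewrite ?mulr1// mulr0 normr0.
  by rewrite ltNge => /negbTE ->; rewrite mulr0.
have mt (h : tupn -> R) : measurable_fun setT h ->
    measurable_fun setT (fun p => U p * (h p * P w (row p) * sigma (row p))).
  move=> mh; apply: measurable_funM => //.
  apply: measurable_funM; last by apply: measurable_chart; exact: Cn_sigma.
  by apply: measurable_funM => //; apply: measurable_chart; exact: Cn_omega_monomial.
have := @dominated_cvg_EFin _ _ _ (tup N.+3)
  (fun m p => U p * (g_ m p * P w (row p) * sigma (row p)))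
  (fun p => U p * (g p * P w (row p) * sigma (row p)))
  (fun p => `|U p * (b p * P [::] (row p) * sigma (row p))|).
rewrite (_ : (fun k => _) = cst 0%E); last first.
  by apply/funext => m; have [_ _ _ h] := Zg m; exact: h.
move=> h; suff /cvg_lim hl : cst 0%E m @[m --> \oo] -->
    (\int[tup N.+3]_p (U p * (g p * P w (row p) * sigma (row p)))%:E)%E.
  by rewrite -(hl (@ereal_hausdorff R)) lim_cst//; exact: ereal_hausdorff.
apply: h.
- by move=> m; apply: mt; have [] := Zg m.
- exact: mt.
- move=> p; apply: cvgM; first exact: cvg_cst.
  apply: cvgM; last exact: cvg_cst.
  by apply: cvgM; [exact: gg|exact: cvg_cst].
- exact: integrable_norm.
move=> m p; rewrite omega_monomial_nil mulr1 !normrM ler_wpM2l// ler_wpM2r//.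
rewrite -[leRHS]mulr1; apply: ler_pM => //; last exact: omega_monomial_le1.
rewrite /b chiE; case: ifPn => xB.
  by rewrite normr1 mulr1 (le_trans (gC m p)) ?ler_norm.
by have [_ _ h' _] := Zg m; rewrite h' ?ltNge// normr0 mulr0.
Qed.

Let Z_indic B (g : tupn -> R) a (c : R) : Z B g -> 
  Z B (fun p : tupn => g p * (om a p < c)%R%:R).
Proof.
move=> Zg; have [mg [C gC] _ _] := Zg.
have mi : measurable_fun setT (fun p : tupn => (om a p < c)%R%:R : R).
  rewrite (_ : (fun p => _) = \1_(`]-oo, c[%classic) \o (fun p => om a p)).
    by apply: measurableT_comp => //; exact: measurable_indic.
  apply/funext => p; rewrite /= indicE; congr (_%:R).
  by rewrite mem_setE in_itv.
have [c1|c1] := ltP 1 c.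
  move: Zg; apply: Z_eq => p.
  by have /andP[_ h] := om_bound a p; rewrite (le_lt_trans h c1) mulr1.
have [c2|c2] := leP c (- 1).
  have := Z_lin 0 0 Zg Zg; apply: Z_eq => p.
  have /andP[h _] := om_bound a p; rewrite [_ < _]ltNge (le_trans c2 h) mulr0.
  by ring.
(* This affine map sends c to 1/2, the threshold of [step], and its slope 1/4 keeps the image of
   [-1, 1] inside [0, 1] for -1 < c <= 1. *)
have x01 p : 0 <= 4^-1 * om a p + (2^-1 - c / 4) <= 1.
  by have /andP[h1 h2] := om_bound a p; apply/andP; split; lra.
apply: (@Z_lim B (fun m p => g p * step m (4^-1 * om a p + (2^-1 - c / 4))) _ C).
- by move=> m; exact: Z_step.
- exact: measurable_funM.
- move=> m p; rewrite normrM -[leRHS]mulr1; apply: ler_pM => //.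
  by rewrite ger0_norm ?step_le1 ?step_ge0.
move=> p; apply: cvgM; first exact: cvg_cst.
have := x01 p; have [h|h] := ltP (om a p) c => /andP[x0 x1].
  by apply: step_lt_half => //; lra.
by apply: step_ge_half => //; lra.
Qed.

(** With a cutoff in rho, the indicators of these sets are products of the multipliers provided by
    [Z_rho] and [Z_indic]. *)
Let G : set (set tupn) := [set E | exists r (c : 'I_N.+3 -> R),
  E = [set p | rho (row p) < r /\ forall a, om a p < c a]].

Let G_setI : setI_closed G.
Proof.
move=> _ _ [r [c ->]] [r' [c' ->]]; exists (Num.min r r'), (fun a => Num.min (c a) (c' a)).
apply/seteqP; split=> p /=.
  move=> [[h1 h2] [h3 h4]]; split; first by rewrite lt_min h1.
  by move=> a; rewrite lt_min h2 h4.
rewrite lt_min => -[/andP[h1 h2] h]; split; split=> // a;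
  by have := h a; rewrite lt_min => /andP[].
Qed.

(* The stereographic coordinates are recovered from omega:
   [y_i < c] iff [omega_(i+1) + c * omega_0 < c]. *)
Let G_generates : @measurable _ tupn = <<s G >>.
Proof.
apply/seteqP; split.
  have id_meas : measurable_fun [set: g_sigma_algebraType G] (id : g_sigma_algebraType G -> tupn).
    have om_meas a : measurable_fun [set: g_sigma_algebraType G] (fun p : tupn => om a p).
      apply: (measurability _ (RGenInftyO.measurableE R)) => _ [_ [c ->] <-].
      (* The bound 2 is no restriction on a coordinate of omega, and the union over k removes the
         one on rho. *)
      rewrite setTI (_ : _ @^-1` _ = \bigcup_k [set p : tupn | rho (row p) < k%:R /\
          forall a', om a' p < if a' == a then c else 2]).
        apply: bigcupT_measurable => k; apply: sub_sigma_algebra.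
        by exists k%:R, (fun a' => if a' == a then c else 2).
      apply/seteqP; split=> p /=; rewrite in_itv /=.
        move=> pc; exists (Num.bound `|rho (row p)|) => //=; split.
          by rewrite (le_lt_trans (ler_norm _))// archi_boundP.
        move=> a'; case: eqVneq => [->//|_].
        by have /andP[_ h] := om_bound a' p; rewrite (le_lt_trans h)// ltr1n.
      by move=> [k _ /= [_ /(_ a)]]; rewrite eqxx.
    apply/measurable_fun_tnthP => i.
    apply: (measurability _ (RGenInftyO.measurableE R)) => _ [_ [c ->] <-].
    rewrite setTI; have [j ->|->] := unliftP ord0 i.
      have mc : measurable_fun [set: g_sigma_algebraType G]
          (fun p : tupn => om (lift ord0 j) p + c * om ord0 p).
        by apply: measurable_funD => //; apply: measurable_funM.
      have mE := mc measurableT _ (measurable_itv `]-oo, c[); rewrite setTI in mE.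
      rewrite (_ : _ @^-1` _ = (fun p : tupn => om (lift ord0 j) p + c * om ord0 p)
        @^-1` `]-oo, c[%classic); first exact: mE.
      have e p : (om (lift ord0 j) p + c * om ord0 p < c) = (tnth p (lift ord0 j) < c).
        rewrite omega_ofS omega_of0 [row_of_tuple _ _ _]mxE.
        have := sden_gt0 (row p); move: (sden _) (tnth _ _) => s z s0.
        rewrite -subr_gt0 (_ : _ - _ = 2 / s * (c - z)).
          by rewrite pmulr_rgt0 ?subr_gt0// divr_gt0.
        by field; rewrite gt_eqF.
      by apply/seteqP; split=> p /=; rewrite !in_itv /= e.
    apply: sub_sigma_algebra; exists c, (fun=> 2).
    apply/seteqP; split=> p /=; rewrite in_itv /= [row_of_tuple _ _ _]mxE; last by case.
    move=> pc; split=> // a; have /andP[_ h] := om_bound a p.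
    by rewrite (le_lt_trans h)// ltr1n.
  move=> E mE; have := id_meas measurableT E mE.
  by rewrite setTI.
apply: smallest_sub; first exact: sigma_algebra_measurable.
move=> _ [r [c ->]].
rewrite (_ : [set p | _ /\ _] = ((fun p => rho (row p)) @^-1` `]-oo, r[%classic) `&`
    \bigcap_(a in setT) ((fun p => om a p) @^-1` `]-oo, c a[%classic)).
  apply: measurableI.
    rewrite -[X in measurable X]setTI.
    by apply: (measurable_rho (b := id)) => //; exact: measurable_id.
  apply: fin_bigcap_measurable => // a _; rewrite -[X in measurable X]setTI.
  exact: measurable_om.
apply/seteqP; split=> p /=.
  by move=> [h1 h2]; split; [rewrite in_itv|move=> a _; rewrite /= in_itv /=].
move=> [h1 h2]; split=> [|a]; first by move: h1; rewrite in_itv.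
by have := h2 a I; rewrite /= in_itv.
Qed.

(** After a cutoff in rho, [U] times [sigma] is integrable and has integral 0 over every set of [G],
    hence vanishes almost everywhere; and [sigma] is positive. *)
Lemma vanish_of_modes : {ae tup N.+3, forall p, U p = 0}.
Proof.
pose b (k : nat) x : R := chi k%:R x.
have mb k : measurable_fun setT (b k : Rm -> R) by exact: measurable_chi.
have b1 k x : `|b k x| <= 1.
  by rewrite /b chiE; case: ifP => _; rewrite ?normr1 ?normr0.
have bk k x : k%:R < `|x| -> b k x = 0 by rewrite /b chiE leNgt => ->.
pose f k p : R := U p * (b k (rho (row p)) * P [::] (row p) * sigma (row p)).
have fk k : {ae tup N.+3, forall p, f k p = 0}.
  have [mg gC gB g0] := Z_rho (mb k) (b1 k) (bk k).
  apply: (ae0_of_pi_system G_generates G_setI).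
  - exact: (@Z_integrable k%:R (fun p => b k (rho (row p))) 1).
  - exact: g0.
  move=> _ [r [c ->]].
  pose lt_r x : R := \1_(`]-oo, r[%classic) x.
  have Zr : Z k%:R (fun p => (fun x => b k x * lt_r x) (rho (row p))).
    apply: (@Z_rho k%:R (fun x => b k x * lt_r x) 1).
    - by apply: measurable_funM => //; exact: measurable_indic.
    - move=> x; rewrite normrM -[leRHS]mulr1; apply: ler_pM => //.
      by rewrite /lt_r indicE; case: (_ \in _); rewrite ?normr1 ?normr0.
    - by move=> x /bk ->; rewrite mul0r.
  have Zs (s : seq 'I_N.+3) : Z k%:R (fun p : tupn => b k (rho (row p)) * lt_r (rho (row p)) *
      \prod_(a <- s) (om a p < c a)%R%:R).
    elim: s => [|a s IH].
      by move: Zr; apply: Z_eq => p; rewrite big_nil mulr1.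
    by have := Z_indic a (c a) IH; apply: Z_eq => p; rewrite big_cons -mulrA [X in _ * X]mulrC.
  have [_ _ _ h] := Zs (index_enum _).
  rewrite integral_mkcond -[RHS](h [::]); apply: eq_integral => p _.
  rewrite patchE /f; case: ifPn => pE.
    move: pE; rewrite inE /= => -[rp cp]; congr (_%:E).
    rewrite /lt_r indicE mem_set ?mulr1/= ?in_itv// big1 ?mulr1// => a _.
    by rewrite cp.
  have [rp|rp] := ltP (rho (row p)) r; last first.
    by rewrite /lt_r indicE memNset ?mulr0 ?mul0r ?mulr0//= in_itv /= ltNge rp.
  have [a ca] : exists a, ~ (om a p < c a).
    by apply/existsNP => cp; move/negP: pE; apply; rewrite inE.
  by rewrite (bigD1 a)//= (negbTE (introN idP ca)) mul0r !mulr0 !mul0r mulr0.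
apply: (negligibleS _ (negligible_bigcup fk)) => p Up.
apply: contrapT => nf; apply: Up.
have h k : f k p = 0 by apply: contrapT => fp; apply: nf; exists k.
have [k pk] : exists k : nat, `|rho (row p)| <= k%:R.
  by exists (Num.bound `|rho (row p)|); rewrite ltW// archi_boundP.
have /eqP := h k; rewrite /f /b chiE pk omega_monomial_nil mul1r /= mul1r.
by rewrite mulf_eq0 (gt_eqF (sigma_gt0 _)) orbF => /eqP.
Qed.

End Completeness.

(** * Null functions are combinations of the nu^j *)

Section NullSpaceModes.
Variables (R : realType) (N : nat).
Local Notation rV := 'rV[R]_N.+3.
Local Notation leb := (@lebesgue_measure R).
Local Notation Rm := (measurableTypeR R).
Local Notation tup := (lebesgue_tuple R).
Local Notation tupn := (N.+3.-tuple Rm).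
Local Notation rho x := ((x : 'rV[R]_N.+3) 0 ord0).
Local Notation CnD := (Cn (@axes R N.+3)).
Local Notation J := (@jbracket R).
Local Notation A := (profile_flux N).
Local Notation nuJ := (profile_nu N).
Local Notation W := (profile_volume N).
Local Notation q := (angular_weight N).
Local Notation K := (mode_potential N).
Local Notation row := (@row_of_tuple R N.+3).
Local Notation P := (@omega_monomial R N).
Local Notation cons x t := (cons_pair ((x : Rm), t) : tupn).
Local Notation wt delta p := (J (rho (row p)) `^ (2 * delta) * W (rho (row p)) * sigma (row p)).
Implicit Types (w v : seq 'I_N.+3) (p : tupn) (t : N.+2.-tuple Rm) (c : 'I_N.+3 -> R).

(* Weak solutions tested only against the products of a function of [rho] and
   a monomial in [omega]. *)
Definition modal_solution delta (U : tupn -> R) : Prop :=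
  [/\ measurable_fun setT U,
    (\int[tup N.+3]_p (wt delta p * U p ^+ 2)%:E < +oo)%E &
    forall w a, test1 a -> (\int[tup N.+3]_p
      (U p * jacobi_density (fun z => a (rho z) * P w z) (row p))%:E = 0)%E].

Lemma test_function_mode a w : test1 a ->
  test_function (fun (r : R) (omega : rV) => a r * monomial w omega).
Proof.
move=> [ca [B aB]]; split; last by exists B => r omega _ /aB ->; rewrite mul0r.
apply: Cn_smooth => k; apply: Cn_mul.
  under eq_fun do rewrite mxE.
  by apply: Cn_comp; [exact: ca|exact: Cn_coordinate].
apply: Cn_comp_row => [l|b]; first exact: Cn_monomial.
by under eq_fun do rewrite mxE; exact: Cn_coordinate.
Qed.

Lemma modal_solution_weak delta (u : R -> rV -> R) : in_H0 delta u -> weak_jacobi u ->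
  modal_solution delta (fun p => in_chart u (row p)).
Proof.
move=> [mu u2] wu; split=> //.
  apply: le_lt_trans u2; rewrite le_eqVlt; apply/orP; left; apply/eqP.
  apply: eq_integral => p _; congr (_%:E); rewrite volume_chart rho_ofE.
  by move: (_ `^ _) (in_chart u _) (sigma _) => *; ring.
move=> w a ta; rewrite -[RHS](wu _ (test_function_mode w ta)) catenoid_integral_jacobi.
rewrite (_ : in_chart (fun (r : R) (omega : rV) => a r * monomial w omega) =
  fun z => a (rho z) * P w z)//.
by apply/funext => z; rewrite /in_chart rho_ofE.
Qed.

Let omega_sum_le (L : seq (seq 'I_N.+3)) (z : rV) :
  `|\sum_(v <- L) P v z| <= (size L)%:R.
Proof.
elim: L => [|v L IH]; first by rewrite big_nil normr0.
rewrite big_cons /= -natr1 addrC; apply: le_trans (ler_normD _ _) _.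
by rewrite lerD ?omega_monomial_le1.
Qed.

Lemma Cn_separated a w k : test1 a -> CnD k (fun z => a (rho z) * P w z).
Proof.
move=> [ca _]; apply: Cn_mul; last exact: Cn_omega_monomial.
by apply: Cn_comp; [exact: ca|exact: Cn_coordinate].
Qed.

Lemma jacobi_density_separated_le a w : test1 a -> exists B C,
  (forall p, `|jacobi_density (fun z => a (rho z) * P w z) (row p)| <= C * sigma (row p)) /\
  (forall p, B < `|rho (row p)| ->
    jacobi_density (fun z => a (rho z) * P w z) (row p) = 0).
Proof.
move=> ta; have [L _ hL] := jacobi_density_mode R w.
pose c := 'D_1 (fun y => A y * 'D_1 a y).
have tA : test1 (fun y => A y * 'D_1 a y).
  by apply: test1_mul (test1_derive ta) => k; exact: Cn_profile_flux.
have tc : test1 c by exact: test1_derive.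
have ha r : is_derive r (1 : R) a ('D_1 a r) := Cn_is_derive r 1 (ta.1 1%N).
have hc r : is_derive r (1 : R) (fun r => A r * 'D_1 a r) (c r) :=
  Cn_is_derive r 1 (tA.1 1%N).
pose b1 x := c x - K (size w) x * a x.
pose b2 x := q x * a x.
have cb1 : continuous b1.
  move=> x; apply: cvgB; first exact: test1_cont.
  by apply: cvgM; [exact: continuous_mode_potential|exact: test1_cont].
have cb2 : continuous b2.
  move=> x; apply: cvgM; first exact: continuous_angular_weight.
  exact: test1_cont.
have sb1 : compact_support b1.
  by apply: compact_support_sub tc.2 _; exact: compact_support_mull ta.2.
have sb2 : compact_support b2 by exact: compact_support_mull ta.2.
have [B1 [C1 [bC1 bB1]]] := compact_bounded_fun cb1 sb1.
have [B2 [C2 [bC2 bB2]]] := compact_bounded_fun cb2 sb2.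
exists (Num.max B1 B2), (C1 + C2 * (size L)%:R); split=> p; rewrite (hL _ _ _ _ ha hc).
  rewrite normrM (gtr0_norm (sigma_gt0 _)) mulrC ler_wpM2r ?(ltW (sigma_gt0 _))//.
  apply: le_trans (ler_normD _ _) _; apply: lerD; rewrite normrM.
    by rewrite -[leRHS]mulr1; apply: ler_pM => //; [exact: bC1|exact: omega_monomial_le1].
  by apply: ler_pM => //; exact: bC2.
rewrite gt_max => /andP[h1 h2]; rewrite -/(b1 _) -/(b2 _).
by rewrite bB1// bB2// !mul0r addr0 mulr0.
Qed.

Section Solution.
Variable delta : R.
Hypothesis hd : - (N.+3%:R / 2) < delta.

(** Subtracting the weak equations asks for integrability of each of the two pairings. For separated
    test functions it follows from [jacobi_density_separated_le] and [integrable_modal]. *)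
Lemma modal_solutionB U1 U2 : modal_solution delta U1 -> modal_solution delta U2 ->
  modal_solution delta (fun p => U1 p - U2 p).
Proof.
move=> [m1 s1 w1] [m2 s2 w2]; split.
- exact: measurable_funB.
- have mw := @measurable_weight R N delta.
  have w0 p : 0 <= wt delta p.
    apply: mulr_ge0 (mulr_ge0 (powR_ge0 _ _) (ltW (profile_volume_gt0 _ _))) _.
    exact: ltW (sigma_gt0 _).
  have i (U : tupn -> R) : measurable_fun setT U ->
      (\int[tup N.+3]_p (wt delta p * U p ^+ 2)%:E < +oo)%E ->
      (tup N.+3).-integrable setT (EFin \o (fun p => wt delta p * U p ^+ 2)).
    move=> mU; apply: ge0_integrable => [|p].
      by apply: measurable_funM mw _; exact: measurable_funX.
    by rewrite mulr_ge0 ?sqr_ge0.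
  pose g p := 2 * (wt delta p * U1 p ^+ 2) + 2 * (wt delta p * U2 p ^+ 2).
  have ig : (tup N.+3).-integrable setT (EFin \o g).
    rewrite (_ : EFin \o g = fun p => (2%:E * (EFin \o (fun p => (wt delta p * U1 p ^+ 2)%R)) p
      + 2%:E * (EFin \o (fun p => (wt delta p * U2 p ^+ 2)%R)) p)%E)//.
    by apply: integrableD => //; apply: integrableZl => //; exact: i.
  have md : measurable_fun setT (fun p => wt delta p * (U1 p - U2 p) ^+ 2).
    by apply: measurable_funM mw _; apply: measurable_funX; exact: measurable_funB.
  have dg p : `|wt delta p * (U1 p - U2 p) ^+ 2| <= g p.
    rewrite ger0_norm; last by rewrite mulr_ge0 ?sqr_ge0.
    rewrite /g !(mulrCA 2) -mulrDr ler_wpM2l//.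
    rewrite -subr_ge0 (_ : _ - _ = (U1 p + U2 p) ^+ 2) ?sqr_ge0//.
    by ring.
  have /integrableP[_] := integrable_le md dg ig; apply: le_lt_trans.
  apply: ge0_le_integral => //.
  + by move=> p _; rewrite lee_fin mulr_ge0 ?sqr_ge0.
  + exact/measurable_EFinP.
  + by apply: measurableT_comp => //; exact/measurable_EFinP.
  + by move=> p _; rewrite /= lee_fin ler_norm.
- move=> w a ta.
  have [B [C [hC hB]]] := jacobi_density_separated_le w ta.
  have mj : measurable_fun setT
      (fun p => jacobi_density (fun z => a (rho z) * P w z) (row p)).
    apply: measurable_row_of_tuple; apply: continuous_jacobi_density.
    exact: Cn_separated.
  under eq_integral do rewrite mulrBl EFinB.
  rewrite integralB//; last 2 first.
  - exact: (integrable_modal hd m1 s1 mj hC hB).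
  - exact: (integrable_modal hd m2 s2 mj hC hB).
  by rewrite w1// w2// sube0.
Qed.

Lemma modal_solution_mode U w : modal_solution delta U ->
  (forall v, (size v < size w)%N -> {ae leb, forall x, mode U v x = 0}) ->
  (size w != 1%N -> {ae leb, forall x, mode U w x = 0}) /\
  exists e : R, {ae leb, forall x, mode U w x = e * nuJ x}.
Proof.
move=> [mU U2 wU] v0.
have [f [df [fs fE]]] := weak_solution_regular (@profile_flux_gt0 R N)
  (@Cn_profile_flux R N) (@continuous_mode_potential R N (size w))
  (loc_integrable_mode hd mU U2 w) (mode_weak hd mU U2 (wU w) v0).
have [g1 g2] := mode_no_growth hd mU U2 fE.
have [h0 [c hc]] := liouville_mode fs g1 g2.
split=> [/h0 f0|]; first by apply: (ae_mono fE) => x ->; rewrite f0.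
by exists c; apply: (ae_mono fE) => x ->; rewrite hc.
Qed.

Lemma modal_solution_eq0 U : modal_solution delta U ->
  (forall j, {ae leb, forall x, mode U [:: j] x = 0}) ->
  {ae tup N.+3, forall p, U p = 0}.
Proof.
move=> mU U1; have [m s _] := mU; apply: (vanish_of_modes hd m s).
suff h n w : (size w <= n)%N -> {ae leb, forall x, mode U w x = 0}.
  by move=> w; exact: (h (size w)).
elim: n w => [|n IH] w sw.
  have w0 : size w = 0%N by apply/eqP; rewrite -leqn0.
  have [|h _] := @modal_solution_mode U w mU; first by rewrite w0.
  by apply: h; rewrite w0.
have [w1|w1] := eqVneq (size w) 1%N.
  by case: w w1 {sw} => [|j []]// _; exact: U1.
have [|h _] := @modal_solution_mode U w mU; last exact: h.
by move=> v vw; apply: IH; rewrite -ltnS (leq_trans vw).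
Qed.

End Solution.

Definition sphere_gram : 'M[R]_N.+3 := \matrix_(j, k) Rintegral (tup N.+2) setT
  (fun t => P [:: j; k] (row (cons 0 t)) * sigma (row (cons 0 t))).

Let integrable_monomial w : (tup N.+2).-integrable setT
  (EFin \o (fun t => P w (row (cons 0 t)) * sigma (row (cons 0 t)))).
Proof.
apply: (@integrable_le _ _ _ _ _ (fun t => sigma (row (cons 0 t)))) => [||];
  last exact: integrable_sigma.
- apply: measurable_funM.
    apply: (measurable_cons 0 (f := fun p => P w (row p))).
    by apply: measurable_chart; exact: Cn_omega_monomial.
  apply: (measurable_cons 0 (f := fun p => sigma (row p))).
  by apply: measurable_chart; exact: Cn_sigma.
- move=> t; rewrite normrM (gtr0_norm (sigma_gt0 _)) -[leRHS]mul1r.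
by rewrite ler_wpM2r ?omega_monomial_le1// ltW ?sigma_gt0.
Qed.

Let omega_pair j k (z : rV) : P [:: j; k] z = omega_of z 0 j * omega_of z 0 k.
Proof. by rewrite !omega_monomial_cons omega_monomial_nil mulr1. Qed.

Let omega_single j (z : rV) : P [:: j] z = omega_of z 0 j.
Proof. by rewrite omega_monomial_cons omega_monomial_nil mulr1. Qed.

Let gram_comb (c : 'rV[R]_N.+3) j : (c *m sphere_gram) 0 j = Rintegral (tup N.+2) setT
  (fun t => (\sum_k c 0 k * omega_of (row (cons 0 t)) 0 k) * P [:: j] (row (cons 0 t)) *
    sigma (row (cons 0 t))).
Proof.
apply: EFin_inj; rewrite mxE -sumEFin.
transitivity (\sum_k \int[tup N.+2]_t ((c 0 k)%:E * (EFin \o (fun t =>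
    (P [:: k; j] (row (cons 0 t)) * sigma (row (cons 0 t)))%R)) t))%E.
  apply: eq_bigr => k _; rewrite integralZl//.
  by rewrite mxE EFinM -(Rintegral_EFin (integrable_monomial _)).
rewrite -integral_sum//; last first.
  by move=> k; apply: integrableZl => //; exact: integrable_monomial.
rewrite /Rintegral fineK.
  apply: eq_integral => t _ /=; rewrite omega_single !mulr_suml -sumEFin.
  by apply: eq_bigr => k _; rewrite -EFinM omega_pair !mulrA.
apply: integrable_fin_num => //.
rewrite (_ : (fun t => _) = fun t => \sum_k ((c 0 k)%:E * (EFin \o (fun t =>
    (P [:: k; j] (row (cons 0 t)) * sigma (row (cons 0 t)))%R)) t)%E).
  by apply: integrable_sum => // k _; apply: integrableZl => //; exact: integrable_monomial.
apply/funext => t /=; rewrite omega_single !mulr_suml -sumEFin.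
by apply: eq_bigr => k _; rewrite -EFinM omega_pair !mulrA.
Qed.

Let embed (z : 'rV[R]_N.+2) : rV := \row_a (if unlift ord0 a is Some i then z 0 i else 0).

Let embed_row t : embed (row_of_tuple t) = row (cons 0 t).
Proof.
apply/rowP => a; rewrite !mxE; case: unliftP => [i ->|->].
  by rewrite mxE /cons_pair tnthS.
by [].
Qed.

(** At the origin of the stereographic coordinates omega is -e_0, which gives c_0 = 0; at the i-th
    unit vector only one coefficient besides c_0 can contribute. *)
Let omega_independent (c : 'rV[R]_N.+3) :
  (forall z : 'rV[R]_N.+2, \sum_k c 0 k * omega_of (embed z) 0 k = 0) -> c = 0.
Proof.
move=> h; have s0 : sden (embed 0) = 1.
  by rewrite /sden big1 ?addr0// => i _; rewrite mxE liftK mxE expr0n.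
have c0 : c 0 ord0 = 0.
  have := h 0; rewrite big_ord_recl omega_of0 s0 big1 => [|i _].
    by rewrite divr1 addr0 => e; lra.
  by rewrite omega_ofS mxE liftK mxE mulr0 mul0r mulr0.
apply/rowP => a; rewrite mxE; case: (unliftP ord0 a) => [i ->|->//].
have := h (delta_mx 0 i); rewrite big_ord_recl c0 mul0r add0r (bigD1 i)//= big1 => [|k ki].
  rewrite addr0 omega_ofS mxE liftK mxE !eqxx => /eqP; rewrite mulf_eq0 => /orP[/eqP//|].
  by rewrite mulr1 mulf_eq0 invr_eq0 pnatr_eq0/= gt_eqF// sden_gt0.
by rewrite omega_ofS mxE liftK mxE (negbTE ki) andbF mulr0 mul0r mulr0.
Qed.

(** Pairing a kernel vector c with itself gives the integral over the sphere of the square of the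
    linear form with coefficients c. By continuity this form vanishes on the whole chart, hence c =
    0. *)
Lemma sphere_gram_unit : sphere_gram \in unitmx.
Proof.
rewrite -row_free_unit; apply: inj_row_free => c cG.
pose l (z : rV) := \sum_k c 0 k * omega_of z 0 k.
have cl k : CnD k l.
  by apply: Cn_sum => a _; apply: Cn_mul; [exact: Cn_cst|exact: Cn_omega].
pose f (z : rV) := l z ^+ 2 * sigma z.
have cf k : CnD k f by apply: Cn_mul; [exact: Cn_exp|exact: Cn_sigma].
have f_ge0 z : 0 <= f z by rewrite mulr_ge0 ?sqr_ge0 ?ltW ?sigma_gt0.
have mf : measurable_fun setT (fun t => f (row (cons 0 t))).
  by apply: (measurable_cons 0 (f := fun p => f (row p))); exact: measurable_chart.
have ig j : (tup N.+2).-integrable setT (EFin \o (fun t =>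
    l (row (cons 0 t)) * P [:: j] (row (cons 0 t)) * sigma (row (cons 0 t)))).
  rewrite (_ : EFin \o _ = fun t => \sum_k ((c 0 k)%:E * (EFin \o (fun t =>
      (P [:: k; j] (row (cons 0 t)) * sigma (row (cons 0 t)))%R)) t)%E).
    by apply: integrable_sum => // k _; apply: integrableZl => //; exact: integrable_monomial.
  apply/funext => t /=; rewrite omega_single /l !mulr_suml -sumEFin.
  by apply: eq_bigr => k _; rewrite -EFinM omega_pair !mulrA.
have f0 : (\int[tup N.+2]_t (f (row (cons 0 t)))%:E = 0)%E.
  rewrite (_ : (fun t => _) = fun t => (\sum_j (c 0 j)%:E * (EFin \o (fun t =>
      (l (row (cons 0 t)) * P [:: j] (row (cons 0 t)) * sigma (row (cons 0 t)))%R)) t)%E).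
    rewrite integral_sum//; last by move=> j; apply: integrableZl.
    apply: big1 => j _; rewrite integralZl// (Rintegral_EFin (ig j)) -gram_comb cG mxE.
    by rewrite mule0.
  apply/funext => t /=; rewrite /f expr2 [X in X * _](_ : _ = \sum_j
    c 0 j * (l (row (cons 0 t)) * P [:: j] (row (cons 0 t)))).
    by rewrite mulr_suml -sumEFin; apply: eq_bigr => j _; rewrite -EFinM !mulrA.
  rewrite {1}/l mulr_suml; apply: eq_bigr => j _.
  by rewrite omega_single mulrAC mulrA.
have fE : {ae tup N.+2, forall t, f (embed (row_of_tuple t)) = 0}.
  have : (\int[tup N.+2]_t `|(f (row (cons 0 t)))%:E|)%E = 0%E.
    by rewrite -[RHS]f0; apply: eq_integral => t _; rewrite gee0_abs// lee_fin.
  move/(ae_eq_integral_abs _ measurableT (proj2 (measurable_EFinP _ _) mf)) => h.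
  by apply: (ae_mono h) => t ft; rewrite embed_row; have [] := ft I.
apply: omega_independent => z.
have ce : continuous (fun z => f (embed z)).
  apply: (@Cn_cont _ _ (@axes R N.+2) 0%N); apply: Cn_comp_row => [k|a]; first exact: cf.
  under eq_fun do rewrite mxE.
  by case: unlift => [i|]; [exact: Cn_coordinate|exact: Cn_cst].
have /eqP := ae0_continuous ce fE z.
by rewrite mulf_eq0 (gt_eqF (sigma_gt0 _)) orbF sqrf_eq0 => /eqP.
Qed.

Lemma mode_nu c j x :
  mode (fun p => in_chart (fun r omega => \sum_k c k * nu k r omega) (row p)) [:: j] x =
  nuJ x * ((\row_k c k) *m sphere_gram) 0 j.
Proof.
rewrite gram_comb -RintegralZl//; last first.
  rewrite (_ : EFin \o _ = fun t => \sum_k ((c k)%:E * (EFin \o (fun t =>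
      (P [:: k; j] (row (cons 0 t)) * sigma (row (cons 0 t)))%R)) t)%E).
    by apply: integrable_sum => // k _; apply: integrableZl => //; exact: integrable_monomial.
  apply/funext => t /=; rewrite omega_single !mulr_suml -sumEFin.
  by apply: eq_bigr => k _; rewrite mxE -EFinM omega_pair !mulrA.
rewrite /mode; apply: eq_Rintegral => t _.
rewrite in_chart_sum sigma_cons omega_monomial_rho [in RHS]mulrA [X in _ = X * _]mulrA; congr (_ * _ * _).
rewrite mulr_sumr; apply: eq_bigr => k _.
by rewrite in_chart_nu row_cons0 omega_single omega_cons mxE mulrCA.
Qed.

(** At exceptional x the slices need not be integrable, hence the restriction to almost every x.
    Tested against functions of rho, the identity follows from [mode_fubini]. *)
Lemma modeB delta U1 U2 w : - (N.+3%:R / 2) < delta ->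
  modal_solution delta U1 -> modal_solution delta U2 ->
  {ae leb, forall x, mode (fun p => U1 p - U2 p) w x = mode U1 w x - mode U2 w x}.
Proof.
move=> hd mU1 mU2; have [mU U2' _] := modal_solutionB hd mU1 mU2.
have [m1 s1 _] := mU1; have [m2 s2 _] := mU2.
pose f x := mode (fun p => U1 p - U2 p) w x - (mode U1 w x - mode U2 w x).
have l1 := loc_integrable_mode hd m1 s1 w.
have l2 := loc_integrable_mode hd m2 s2 w.
have l3 := loc_integrable_mode hd mU U2' w.
suff h : {ae leb, forall x, f x = 0}.
  by apply: (ae_mono h) => x /eqP; rewrite subr_eq0 => /eqP.
apply: ae0_of_test; first by apply: loc_integrable_sub => //; exact: loc_integrable_sub.
move=> b tb.
rewrite pair_subl//; last exact: loc_integrable_sub.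
rewrite pair_subl//.
have [B [C [bC bB]]] := compact_bounded_fun (test1_cont tb) tb.2.
have mb : measurable_fun setT (b : Rm -> R).
  exact: continuous_measurable_fun (test1_cont tb).
have [_ e1] := mode_fubini hd m1 s1 w mb bC bB.
have [_ e2] := mode_fubini hd m2 s2 w mb bC bB.
have [_ e3] := mode_fubini hd mU U2' w mb bC bB.
pose h p := b (rho (row p)) * P w (row p) * sigma (row p).
have mh : measurable_fun setT h.
  apply: measurable_funM; last by apply: measurable_chart; exact: Cn_sigma.
  apply: measurable_funM; first exact: measurable_rho.
  by apply: measurable_chart; exact: Cn_omega_monomial.
have hC p : `|h p| <= C * sigma (row p).
  rewrite normrM (gtr0_norm (sigma_gt0 _)) ler_wpM2r ?(ltW (sigma_gt0 _))//.
  by rewrite normrM -[leRHS]mulr1; apply: ler_pM => //; exact: omega_monomial_le1.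
have hB p : B < `|rho (row p)| -> h p = 0 by move=> xB; rewrite /h bB// !mul0r.
have i1 := integrable_modal hd m1 s1 mh hC hB.
have i2 := integrable_modal hd m2 s2 mh hC hB.
have rE (g : R -> R) : Rintegral leb setT (fun x => g x * b x) =
    fine (\int[leb]_x (b x * g x)%:E)%E.
  by rewrite /Rintegral; congr fine; apply: eq_integral => x _; rewrite mulrC.
rewrite !rE -e1 -e2 -e3.
under eq_integral do rewrite mulrBl EFinB.
rewrite integralB// fineB ?subrr//; exact: integrable_fin_num.
Qed.

Lemma null_space_nu delta (u : R -> rV -> R) :
  - (N.+3%:R / 2) < delta -> delta < N.+3%:R / 2 - 2 -> null_space delta u ->
  exists c, catenoid_ae_eq u (fun r omega => \sum_j c j * nu j r omega).
Proof.
move=> hd hd2 [u2 wu]; have mU := modal_solution_weak u2 wu.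
(* The moment of degree 0 has none below it; its vanishing is the hypothesis needed for those of
   degree 1. *)
have nil0 (v : seq 'I_N.+3) : (size v < 0)%N -> {ae leb, forall x, mode (fun p => in_chart u (row p)) v x = 0} by [].
have [h0 _] := modal_solution_mode hd mU (w := [::]) nil0.
have {}h0 := h0 isT.
have e_ex j : exists e, {ae leb, forall x,
    mode (fun p => in_chart u (row p)) [:: j] x = e * nuJ x}.
  have [|_ //] := @modal_solution_mode delta hd _ [:: j] mU.
  by case=> // _; exact: h0.
have /choice[e he] := e_ex.
pose c := (\row_j e j) *m invmx sphere_gram.
exists (c 0).
have mV := modal_solution_weak (in_H0_nu (c 0) hd2) (weak_jacobi_nu (c 0)).
suff /(modal_solution_eq0 hd (modal_solutionB hd mU mV)) h : forall j,
    {ae leb, forall x, mode (fun p => in_chart u (row p) -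
      in_chart (fun r omega => \sum_k c 0 k * nu k r omega) (row p)) [:: j] x = 0}.
  by apply: (ae_mono h) => p /eqP; rewrite subr_eq0 => /eqP.
move=> j; have fl := ae_filter_ringOfSetsType (lebesgue_measure : measure Rm R).
apply: (@filterS2 _ _ fl _ _ _ _ (he j) (modeB [:: j] hd mU mV)) => x h1 ->.
rewrite h1 mode_nu (_ : \row_k c 0 k = c); last by apply/rowP => k; rewrite mxE.
by rewrite /c mulmxKV ?sphere_gram_unit// mxE mulrC subrr.
Qed.

End NullSpaceModes.

Theorem mainTheorem2 (R : realType) (n : nat) (delta : R)
    (hn : (3 <= n)%N)
    (hdelta1 : - (n%:R / 2) < delta) (hdelta2 : delta < n%:R / 2 - 2)
    (u : R -> 'rV[R]_n -> R) (hu : catenoid_measurable u) :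
  null_space delta u <->
  exists c : 'I_n -> R,
    catenoid_ae_eq u (fun rho omega => \sum_(j < n) c j * nu j rho omega).
Proof.
case: n hn hdelta1 hdelta2 u hu => [|[|[|N]]]// _ hd1 hd2 u hu.
split=> [|[c uE]]; first exact: null_space_nu.
exact: nu_null_space hd2 hu uE.
Qed.
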